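(* Let $0<\alpha,\beta\le1$, $k\ge1$, $\lambda_1,\dots,\lambda_k>0$, and let $\{M^{\alpha,\beta}(s,t),\ (s,t)\in\mathbb{R}^2_+\}\sim FGPRF\{\lambda_j\}_{1\le j\le k}$. Its distribution $p^{\alpha,\beta}(n,s,t)=\Pr\{M^{\alpha,\beta}(s,t)=n\}$, $n\ge0$, is given by $$p^{\alpha,\beta}(n,s,t)=\sum_{(n_1,\dots,n_k)\in\Theta(k,n)}\left(\prod_{j=1}^{k}\frac{(\lambda_js^\alpha t^\beta)^{n_j}}{n_j!}\right){}_2\Psi_2\left[\begin{matrix}(\sum_{j=1}^kn_j+1,1),&(\sum_{j=1}^kn_j+1,1)\\(\alpha\sum_{j=1}^kn_j+1,\alpha),&(\beta\sum_{j=1}^kn_j+1,\beta)\end{matrix}\;\middle|\;-\sum_{j=1}^{k}\lambda_js^\alpha t^\beta\right]$$ for all $(s,t)\in\mathbb{R}^2_+$. In particular, these point probabilities solve the system of fractional differential equations $$\frac{\partial^{\alpha+\beta}}{\partial t^\beta\partial s^\alpha}p^{\alpha,\beta}(n,s,t)=-\sum_{j=1}^{k}\lambda_j(I-B^j)\left(1+\sum_{j'=1}^{k}\lambda_{j'}\sum_{r=1}^{j'}B^{j'-r}\frac{\partial}{\partial\lambda_1}\right)p^{\alpha,\beta}(n,s,t),\quad n\ge0,$$ with initial condition $p^{\alpha,\beta}(0,0,0)=1$, where $B$ is the backward shift operator, $B^jp^{\alpha,\beta}(n,s,t)=p^{\alpha,\beta}(n-j,s,t)$, $I$ is the identity, and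 $p^{\alpha,\beta}(n,s,t)=0$ for all $n<0$.
   Context: $\mathbb{R}_+=[0,\infty)$; $\Theta(k,n)=\{(n_1,\dots,n_k)\in\mathbb{N}_0^k:\sum_{j=1}^kjn_j=n\}$. For a two parameter process $X$ and $s\le s'$, $t\le t'$, the rectangular increment is $\Delta_{s,t}X(s',t')=X(s',t')-X(s',t)-X(s,t')+X(s,t)$. Two parameter generalized Poisson random field $\{M(s,t),\ (s,t)\in\mathbb{R}^2_+\}\sim GPRF\{\lambda_j\}_{1\le j\le k}$: a non-negative integer valued process with $M(0,t)=M(s,0)=0$ almost surely, with independent rectangular increments over disjoint rectangles $(s,s']\times(t,t']$, and with $$\Pr\{\Delta_{s,t}M(s',t')=n\}=\sum_{(n_1,\dots,n_k)\in\Theta(k,n)}\prod_{j=1}^{k}\frac{(\lambda_j(s'-s)(t'-t))^{n_j}}{n_j!}e^{-\lambda_j(s'-s)(t'-t)},\quad n\ge0.$$ For $\alpha\in(0,1)$ let $H^\alpha$ be the stable subordinator (non-decreasing Lévy process with $\mathbb{E}e^{-uH^\alpha(t)}=e^{-tu^\alpha}$, $u>0$); $L^\alpha(t)=\inf\{s\ge0:H^\alpha(s)\ge t\}$ is the inverse stable subordinator of index $\alpha$; for $\alpha=1$, $L^1(t)=t$ almost surely. The fractional GPRF, $FGPRF\{\lambda_j\}_{1\le j\le k}$, is $M^{\alpha,\beta}(s,t)=M(L^\alpha(s),L^\beta(t))$, where $M\sim GPRF\{\lambda_j\}_{1\le j\le k}$ and $M$, $L^\alpha$, $L^\beta$ are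 independent of each other. Fractional derivatives are Caputo derivatives: $\frac{d^\alpha}{dt^\alpha}f(t)=\frac{1}{\Gamma(1-\alpha)}\int_0^t\frac{f'(s)}{(t-s)^\alpha}ds$ for $0<\alpha<1$, and $f'(t)$ for $\alpha=1$. The operator $\frac{\partial^{\alpha+\beta}}{\partial t^\beta\partial s^\alpha}$ is the Caputo derivative of order $\alpha$ in $s$ and of order $\beta$ in $t$. The derivative $\partial/\partial\lambda_1$ is with respect to the parameter $\lambda_1$. Generalized Wright function: ${}_m\Psi_l\left[\begin{matrix}(a_1,\alpha_1),\dots,(a_m,\alpha_m)\\(b_1,\beta_1),\dots,(b_l,\beta_l)\end{matrix}\middle|x\right]=\sum_{r=0}^\infty\frac{\prod_{i=1}^m\Gamma(\alpha_ir+a_i)}{\prod_{j=1}^l\Gamma(\beta_jr+b_j)\,r!}x^r$, $x\in\mathbb{R}$, for $a_i,b_j\in\mathbb{R}$ and $\alpha_i,\beta_j\in\mathbb{R}\setminus\{0\}$.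
   Formalization: The formula is asserted where the Wright series converge (always if α+β>1; they diverge for α+β<1, s,t>0); the system is for s,t>0, as it fails at s=0; M is assumed jointly measurable (e.g. right-continuous), without which the law of M(L^α,L^β) is undetermined. *)

(* Defs.v *)
From HB Require Import structures.
From mathcomp Require Import all_boot all_order all_algebra.
From mathcomp Require Import all_classical all_reals all_analysis.
Import Order.TTheory GRing.Theory Num.Theory.
Import numFieldNormedType.Exports.

Set Implicit Arguments.
Unset Strict Implicit.
Unset Printing Implicit Defensive.

Local Open Scope classical_set_scope.
Local Open Scope ring_scope.

(* Euler's Gamma function. For x > 0 the shift is 0 and this is Euler's
   integral; for x <= 0 it is its extension by Gamma (x + 1) = x Gamma x. At the
   poles 0, -1, -2, ... the value is 0, so that 1 / Gamma = 0 there. *)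
Definition Gamma (R : realType) (x : R) : R :=
  let m := Num.truncn (1 - x) in
  (\int[lebesgue_measure]_(u in `]0%R, +oo[)
     (u `^ (x + m%:R - 1) * expR (- u))) / \prod_(i < m) (x + i%:R).

(* A pair in the list stands for (a_i, alpha_i), resp. (b_j, beta_j). *)
Definition wright_term (R : realType) (a b : seq (R * R)) (x : R) (r : nat) : R :=
  (\prod_(p <- a) Gamma (p.2 * r%:R + p.1)) /
  ((\prod_(p <- b) Gamma (p.2 * r%:R + p.1)) * (r`!)%:R) * x ^+ r.

Definition wright_cvg (R : realType) (a b : seq (R * R)) (x : R) : Prop :=
  cvgn (series (wright_term a b x)).

(* Meaningful only under [wright_cvg a b x]. *)
Definition wright (R : realType) (a b : seq (R * R)) (x : R) : R :=
  limn (series (wright_term a b x)).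

Definition caputo (R : realType) (a : R) (f : R -> R) (t : R) : R :=
  if a == 1 then derive1 f t
  else (Gamma (1 - a))^-1 *
       \int[lebesgue_measure]_(x in `]0%R, t[) (derive1 f x / (t - x) `^ a).

(* [caputo a f t] is well defined. *)
Definition caputo_derivable (R : realType) (a : R) (f : R -> R) (t : R) : Prop :=
  if a == 1 then derivable f t 1
  else (forall x : R, 0 < x < t -> derivable f x 1) /\
       (@lebesgue_measure R).-integrable `]0%R, t[
         (fun x => (derive1 f x / (t - x) `^ a)%:E).

(* Theta(k, n); the index j : 'I_k stands for j + 1 in {1, ..., k}, so that
   every solution has entries at most n. *)
Definition Theta (k n : nat) : pred {ffun 'I_k -> 'I_n.+1} :=
  fun m => (\sum_(j < k) j.+1 * m j)%N == n.

(* Processes are indexed by all of R, but only their values at nonnegative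
   parameters are constrained. *)

Definition mutually_independent d (T : measurableType d) (R : realType)
    (P : probability T R) (m : nat) (X : 'I_m -> T -> R) : Prop :=
  forall B : 'I_m -> set R, (forall i, measurable (B i)) ->
    P (\bigcap_i (X i @^-1` B i)) = (\prod_(i < m) P (X i @^-1` B i))%E.

(* <<s family_class D X >> is the sigma-algebra sigma(X i, i in D). *)
Definition family_class d d' (T : measurableType d) (U : measurableType d')
    (I : Type) (D : set I) (X : I -> T -> U) : set (set T) :=
  [set A | exists i B, [/\ D i, measurable B & A = X i @^-1` B]].

Definition independent3 d (T : measurableType d) (R : realType)
    (P : probability T R) (G1 G2 G3 : set (set T)) : Prop :=
  forall A B C, <<s G1 >> A -> <<s G2 >> B -> <<s G3 >> C ->
    P (A `&` B `&` C) = (P A * P B * P C)%E.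

Record levy_process d (T : measurableType d) (R : realType)
    (P : probability T R) (H : R -> {RV P >-> R}) : Prop := {
  levy_start : {ae P, forall w, H 0 w = 0} ;
  levy_indep : forall (m : nat) (u : nat -> R), 0 <= u 0%N ->
    {homo u : i j / (i <= j)%N >-> i <= j} ->
    mutually_independent P (fun (i : 'I_m) w => H (u i.+1) w - H (u i) w) ;
  levy_stationary : forall u h : R, 0 <= u -> 0 <= h ->
    forall B : set R, measurable B ->
    P [set w | B (H (u + h) w - H u w)] = P [set w | B (H h w)] ;
  levy_cadlag : {ae P, forall w,
    (forall u : R, 0 <= u -> H x w @[x --> u^'+] --> H u w) /\
    (forall u : R, 0 < u -> exists l : R, H x w @[x --> u^'-] --> l)} }.

Record stable_subordinator d (T : measurableType d) (R : realType)
    (P : probability T R) (a : R) (H : R -> {RV P >-> R}) : Prop := {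
  stable_levy : levy_process H ;
  stable_nondecreasing : {ae P, forall w, forall u v : R,
    0 <= u -> u <= v -> H u w <= H v w} ;
  stable_laplace : forall u t : R, 0 < u -> 0 <= t ->
    ('E_P[fun w => expR (- (u * H t w))] = (expR (- (t * u `^ a)))%:E)%E }.

Definition inverse_stable_subordinator d (T : measurableType d) (R : realType)
    (P : probability T R) (a : R) (L : R -> {RV P >-> R}) : Prop :=
  if a == 1 then forall t : R, 0 <= t -> {ae P, forall w, L t w = t}
  else exists2 H : R -> {RV P >-> R}, stable_subordinator a H &
       forall t : R, 0 <= t ->
         {ae P, forall w, L t w = inf [set x | 0 <= x /\ t <= H x w]}.

Section random_field.
Context d (T : measurableType d) (R : realType) (P : probability T R).

Definition rect_increment (M : R -> R -> {RV P >-> nat}) (s t s' t' : R) (w : T)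
  : R := (M s' t' w)%:R - (M s' t w)%:R - (M s t' w)%:R + (M s t w)%:R.

Definition quadrant : set (R * R) := [set x | 0 <= x.1 /\ 0 <= x.2].

Definition field_class (M : R -> R -> {RV P >-> nat}) : set (set T) :=
  family_class quadrant (fun x => M x.1 x.2 : T -> nat).

Definition process_class (L : R -> {RV P >-> R}) : set (set T) :=
  family_class [set u | 0 <= u] (fun u => L u : T -> R).

(* [gprf_measurable]: (w, s, t) |-> M s t w is measurable for the product of
   sigma(M) and the Borel sets. It holds e.g. for right-continuous paths.
   Without it the law of M at an independent random point is not determined by
   the finite-dimensional laws of M. *)
Record gprf (k : nat) (lam : 'I_k -> R) (M : R -> R -> {RV P >-> nat}) : Prop := {
  gprf_left : forall t : R, 0 <= t -> {ae P, forall w, M 0 t w = 0%N} ;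
  gprf_bottom : forall s : R, 0 <= s -> {ae P, forall w, M s 0 w = 0%N} ;
  gprf_indep : forall (m : nat) (s s' t t' : 'I_m -> R),
    (forall i, 0 <= s i <= s' i /\ 0 <= t i <= t' i) ->
    trivIset setT (fun i => `]s i, s' i] `*` `]t i, t' i]) ->
    mutually_independent P
      (fun i => rect_increment M (s i) (t i) (s' i) (t' i)) ;
  gprf_law : forall (s s' t t' : R) (n : nat),
    0 <= s <= s' -> 0 <= t <= t' ->
    P [set w | rect_increment M s t s' t' w = n%:R] =
    (\sum_(m : {ffun 'I_k -> 'I_n.+1} | Theta m) \prod_(j < k)
       ((lam j * (s' - s) * (t' - t)) ^+ m j / (m j)`!%:R *
        expR (- (lam j * (s' - s) * (t' - t)))))%:E ;
  gprf_measurable :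
    measurable_fun [set x : g_sigma_algebraType (field_class M) * (R * R) |
                      quadrant x.2]
                   (fun x => M x.2.1 x.2.2 x.1) }.

Definition fgprf (a b : R) (k : nat) (lam : 'I_k -> R)
    (Z : R -> R -> {RV P >-> nat}) : Prop :=
  exists (M : R -> R -> {RV P >-> nat}) (L1 L2 : R -> {RV P >-> R}),
  [/\ gprf lam M,
      inverse_stable_subordinator a L1,
      inverse_stable_subordinator b L2,
      independent3 P (field_class M) (process_class L1) (process_class L2) &
      forall (s t : R) (w : T), 0 <= s -> 0 <= t -> Z s t w = M (L1 s w) (L2 t w) w].

(* The index n is an integer: the value is 0 for n < 0. *)
Definition point_prob (Z : R -> R -> {RV P >-> nat}) (n : int) (s t : R) : R :=
  fine (P [set w | (Z s t w)%:Z = n]).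

End random_field.

Section wright_parameters.
Context (R : realType).

(* With these parameters the Wright series converges everywhere if
   alpha + beta > 1, but only at 0 if alpha + beta < 1: its r-th term is of the
   order of (r!)^(1 - alpha - beta), up to a geometric factor. *)
Definition wright_top (N : nat) : seq (R * R) := [:: (N%:R + 1, 1); (N%:R + 1, 1)].

Definition wright_bottom (a b : R) (N : nat) : seq (R * R) :=
  [:: (a * N%:R + 1, a); (b * N%:R + 1, b)].

End wright_parameters.

Definition set_param (R : realType) (k : nat) (i : 'I_k) (lam : 'I_k -> R) (x : R)
  : 'I_k -> R := fun j => if j == i then x else lam j.

Definition partial_param (R : realType) (k : nat) (i : 'I_k)
    (q : ('I_k -> R) -> int -> R) : ('I_k -> R) -> int -> R :=
  fun lam n => derive1 (fun x => q (set_param i lam x) n) (lam i).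

Definition bshift (R : realType) (j : nat) (q : int -> R) : int -> R :=
  fun n => q (n - j%:Z).

(* (1 + sum_j' lambda_j' sum_(r = 1)^j' B^(j' - r) d/dlambda_i) q *)
Definition inner_operator (R : realType) (k : nat) (i : 'I_k)
    (q : ('I_k -> R) -> int -> R) (lam : 'I_k -> R) : int -> R :=
  fun n => q lam n + \sum_(j < k) lam j *
    \sum_(1 <= r < j.+2) bshift (j.+1 - r) (partial_param i q lam) n.

(* - sum_j lambda_j (I - B^j) q *)
Definition outer_operator (R : realType) (k : nat) (lam : 'I_k -> R)
    (q : int -> R) : int -> R :=
  fun n => - \sum_(j < k) lam j * (q n - bshift j.+1 q n).

(* Main.v *)
(* The law of the fractional field is a double mixture. By independence,
   Pr{Z(s,t) = n} is the double integral of F_n(lambda x y) against the laws of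
   L^alpha(s) and L^beta(t), where F_n is the law of a generalized Poisson
   variable. The Laplace transform of the stable subordinator H gives
   L^alpha(s) = (s / H(1))^alpha in law, with moments s^(alpha q) b(q),
   b(q) = q! / Gamma(alpha q + 1); since b(q) u^q / q! tends to 0 for every u,
   these moments determine the Laplace transform, hence the law.
   F_n(lambda z) is a polynomial times exp(-Lambda z), and the remainder of the
   Taylor expansion of exp(-y), y >= 0, is at most y^m / m!; so, as soon as the
   terms of the Wright series tend to 0, its sum is the mixture.
   For the equation with alpha < 1, let Y have the moments b(q) and put
   k(v) = alpha v^(alpha-1) (1-v)^(-alpha) / Gamma(1-alpha) on (0,1). Comparing
   moments by means of the Beta integral, the integral of k(v) E[Y phi(v^alpha Y)]
   over v is E[phi(Y)], and this says that the Caputo derivative of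
   s |-> E[f(s^alpha Y)] is E[f'(s^alpha Y)]. Applied in s and then in t, it produces
   E[f'(W) + W f''(W)] with f = F_n(lambda .) and
   W = s^alpha t^beta Y_1 Y_2. As f' = - sum_j lambda_j (I - B^j) f and
   d/dlambda_1 f = -z (I - B) f, this is the right-hand side. *)
Require Import Defs.
From mathcomp Require Import all_boot all_order all_algebra.
From mathcomp Require Import all_classical all_reals all_analysis.
From mathcomp Require Import measurable_realfun.
From mathcomp Require Import ring lra zify.
Import Order.TTheory GRing.Theory Num.Theory.
Import numFieldNormedType.Exports.
Set Implicit Arguments.
Unset Strict Implicit.
Unset Printing Implicit Defensive.
Local Open Scope classical_set_scope.
Local Open Scope ring_scope.

(** * Integrals over half-lines and the Gamma function *)

(** The governing system covers all indices, including those whose Wright series diverge, so it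
    cannot come from termwise differentiation; it is derived from the mixture alone. The same
    divergence affects the moment series of the product [Y_1 Y_2]. Each Caputo derivative is
    therefore treated with one factor frozen and absorbed in the scale: only the moment series of a
    single Mittag-Leffler law then occurs, and it converges for every index. The derivative in
    [lambda_1] compares fields that live on different probability spaces. Hence the time changes are
    replaced by two fixed laws on the line, those at time 1, while s, t and the parameters enter
    only through the integrand. Absolute values make these variables nonnegative everywhere instead
    of almost everywhere. Identities are checked on the functions [z ^ N * e^(-u z)], which are
    nonnegative on the half-line, so that Tonelli applies before integrability is known; signed sums
    follow by linearity. Laws are compared through strict against non-strict half-lines, in both
    directions, which determines a law in spite of possible atoms. *)

Section lebesgue_substitution.
Context {R : realType}.
Local Notation mu := (@lebesgue_measure R).

Lemma continuous_powR_gt0 (p x : R) : 0 < x -> {for x, continuous (@powR R ^~ p)}.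
Proof.
move=> x0; apply: differentiable_continuous.
by apply/derivable1_diffP; have [] := is_derive1_powR p x0.
Qed.

(** The image of Lebesgue measure under [x -> c x + d], multiplied by c, gives half-open intervals
    their length, hence is Lebesgue measure by uniqueness. *)
Lemma ge0_integral_affine (c d : R) (f : R -> \bar R) : 0 < c ->
  measurable_fun [set: R] f -> (forall x, 0 <= f x)%E ->
  (\int[mu]_x f x = c%:E * \int[mu]_x f (c * x + d)%R)%E.
Proof.
move=> c0 mf f0.
have mphi : measurable_fun [set: measurableTypeR R]
    (fun x : measurableTypeR R => c * x + d : measurableTypeR R).
  by apply: measurable_funD => //; apply: measurable_funM.
pose m0 : {measure set measurableTypeR R -> \bar R} :=
  mscale (NngNum (ltW c0)) (pushforward mu (fun x : measurableTypeR R => c * x + d : measurableTypeR R)).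
pose m1 := m0 mphi.
transitivity (\int[m1]_x f x)%E.
  apply: eq_measure_integral => A mA _.
  apply: (@lebesgue_measure_unique R m1) => // _ [[a b]] _ <-.
  transitivity (c%:E * mu ((fun x : R => (c * x + d)%R) @^-1` `]a, b]))%E; last by [].
  have -> : (fun x : R => c * x + d) @^-1` `]a, b] = `](a - d) / c, (b - d) / c]%classic.
    by apply/seteqP; split => x /=; rewrite !in_itv/= ltr_pdivrMr// ler_pdivlMr//
      ltrBlDr lerBrDr (mulrC x).
  rewrite !lebesgue_measure_itv/= !lte_fin ltr_pM2r ?invr_gt0// ltrD2r.
  case: ifP => _; last by rewrite mule0.
  by rewrite -!EFinD -EFinM; congr EFin; field; rewrite gt_eqF.
rewrite ge0_integral_mscale//.
by rewrite ge0_integral_pushforward.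
Qed.

(** Monotone convergence along intervals that stay away from 0. It serves integrands such as
    [v ^ (p - 1)] with p < 1, whose singularity at 0 keeps the fundamental theorem of calculus from
    being applied on the whole interval. *)
Lemma cvg_integral_itv_right0 (a_ : nat -> R) (f : R -> \bar R) (b : itv_bound R) :
  (forall n, 0 < a_ n) -> {homo a_ : n m / (n <= m)%N >-> m <= n} ->
  a_ @ \oo --> 0 ->
  measurable_fun [set: R] f -> (forall x, 0 <= f x)%E ->
  (\int[mu]_(x in [set` Interval (BLeft (a_ n)) b]) f x)%E @[n --> \oo] -->
  (\int[mu]_(x in [set` Interval (BRight 0%R) b]) f x)%E.
Proof.
move=> a0 a_dec a_cvg mf f0.
have -> : [set` Interval (BRight 0%R) b] =
    \bigcup_n [set` Interval (BLeft (a_ n)) b].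
  apply/seteqP; split => x /=.
    rewrite itv_boundlr => /andP[]; rewrite bnd_simp => x0 xb.
    have [n _ /(_ n)] := (cvgrPdist_lt _ _).1 a_cvg _ x0; rewrite /= leqnn => /(_ isT).
    rewrite sub0r normrN gtr0_norm// => anx.
    by exists n => //=; rewrite itv_boundlr xb andbT bnd_simp ltW.
  move=> [n _] /=; rewrite !itv_boundlr => /andP[+ ->]; rewrite andbT !bnd_simp.
  by apply: lt_le_trans.
apply: ge0_nondecreasing_set_cvg_integral => //.
- move=> n m nm; apply/subsetPset => x /=; rewrite !itv_boundlr => /andP[+ ->].
  by rewrite andbT !bnd_simp; apply: le_trans; exact: a_dec.
- by move=> i; exact: measurable_funTS.
Qed.

Lemma powR_cvg0n (p : R) : 0 < p -> (n.+1%:R^-1 `^ p : R) @[n --> \oo] --> 0.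
Proof.
move=> p0; apply/cvgrPdist_lt => e e0; near=> n.
rewrite sub0r normrN ger0_norm ?powR_ge0//.
have -> : e = (e `^ p^-1) `^ p by rewrite -powRrM mulVf ?gt_eqF// powRr1// ltW.
rewrite gt0_ltr_powR ?nnegrE ?powR_ge0 ?invr_ge0//.
rewrite invf_plt ?posrE ?powR_gt0//; apply: lt_trans (_ : n%:R < _); last by rewrite ltr_nat.
by near: n; exact: nbhs_infty_gtr.
Unshelve. all: by end_near. Qed.

Lemma powR_nincr (p : R) : 0 < p ->
  {homo (fun n => n.+1%:R^-1 `^ p : R) : n m / (n <= m)%N >-> m <= n}.
Proof.
move=> p0 n m nm; rewrite ge0_ler_powR ?nnegrE ?invr_ge0 ?(ltW p0)//.
by rewrite lef_pV2 ?posrE// ler_nat.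
Qed.

Lemma integral_powR (p u : R) : 0 < p -> 0 <= u ->
  (\int[mu]_(v in `]0%R, u]) (p * v `^ (p - 1))%:E = (u `^ p)%:E)%E.
Proof.
move=> p0; rewrite le_eqVlt => /predU1P[<-|u0].
  by rewrite set_itv_ge ?bnd_simp// integral_set0 powR0// gt_eqF.
have mf : measurable_fun [set: R] (fun v : R => (p * v `^ (p - 1))%:E).
  by apply/measurable_EFinP; apply: measurable_funM => //; exact: measurable_powR.
have f0 (x : R) : (0%R <= (p * x `^ (p - 1))%:E)%E.
  by rewrite lee_fin mulr_ge0 ?powR_ge0// ltW.
(* The exponent 1 gives the sequence [1 / (n + 1)] the form in which [powR_nincr] and [powR_cvg0n]
   apply. *)
have a0 n : 0 < n.+1%:R^-1 `^ 1 :> R by rewrite powR_gt0 ?invr_gt0.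
have := @cvg_integral_itv_right0 _ _ (BRight u) a0 (powR_nincr ltr01)
  (powR_cvg0n ltr01) mf f0.
move=> h; apply/esym; apply: (cvg_unique _ _ h) => //.
have H : \forall n \near \oo, (u `^ p - (n.+1%:R^-1) `^ p)%:E =
    (\int[mu]_(x in `[(n.+1%:R^-1 `^ 1 : R)%R, u]) (p * x `^ (p - 1))%:E)%E.
  near=> n; rewrite powRr1//.
  have nu : n.+1%:R^-1 < u.
    rewrite invf_plt ?posrE//; apply: lt_trans (_ : n%:R < _); last by rewrite ltr_nat.
    by near: n; exact: nbhs_infty_gtr.
  have n0 : 0 < n.+1%:R^-1 :> R by rewrite invr_gt0.
  apply/esym; apply: (@continuous_FTC2 R (fun x => p * x `^ (p - 1)) (@powR R ^~ p)) => //.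
  - apply: derivable_within_continuous => x; rewrite in_itv/= => /andP[nx _].
    have x0 := lt_le_trans n0 nx.
    apply: derivableM => //.
    by have [] := is_derive1_powR (p - 1) x0.
  - split.
    + move=> x; rewrite in_itv/= => /andP[nx _].
      by have [] := is_derive1_powR p (lt_trans n0 nx).
    + by apply: cvg_at_right_filter; exact: continuous_powR_gt0.
    + by apply: cvg_at_left_filter; exact: continuous_powR_gt0.
  - move=> x; rewrite in_itv/= => /andP[nx _]; apply: powR_derive1.
    by rewrite in_itv/= (lt_trans n0 nx).
apply: cvg_trans; first by apply: near_eq_cvg; exact: H.
apply: cvg_EFin; first exact: nearW.
have : (u `^ p - n.+1%:R^-1 `^ p : R) @[n --> \oo] --> u `^ p - 0.
  by apply: cvgB; [exact: cvg_cst|exact: powR_cvg0n].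
by rewrite subr0.
Unshelve. all: by end_near. Qed.

Lemma integral_expRN (v : R) :
  (\int[mu]_(u in `[v, +oo[) (expR (- u))%:E = (expR (- v))%:E)%E.
Proof.
rewrite (@ge0_continuous_FTC2y R (fun u => expR (- u)) (fun u => - expR (- u)) v 0).
- by rewrite -EFinD sub0r opprK.
- by move=> x _; exact: expR_ge0.
- by apply: continuous_subspaceT => x; apply: continuous_comp;
    [exact: opp_continuous|exact: continuous_expR].
- by rewrite -oppr0; apply: cvgN; exact: cvgr_expR.
- by move=> x _; apply: ex_derive.
- apply: cvg_at_right_filter; apply: cvgN.
  by apply: continuous_comp; [exact: opp_continuous|exact: continuous_expR].
- by move=> x _; rewrite derive1E; apply: derive_val; apply: is_derive_eq; rewrite /GRing.scale/=; lra.
Qed.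

Lemma integral_itvE d (T : measurableType d) (m : {measure set T -> \bar R}) (D : set T)
    (b : pred T) (f : T -> \bar R) : (forall x, D x <-> b x) ->
  (\int[m]_(x in D) f x = \int[m]_x (if b x then f x else 0))%E.
Proof.
move=> Db; rewrite integral_mkcond; apply: eq_integral => x _; rewrite patchE.
case: ifPn => [|/negP]; rewrite inE => xD; first by rewrite (Db x).1.
by case: ifPn => // /(Db x).2.
Qed.

End lebesgue_substitution.

Lemma measurable_EFin d (T : measurableType d) (R : realType) (D : set T) (f : T -> R) :
  measurable_fun D f -> measurable_fun D (fun x => (f x)%:E).
Proof. by move=> mf; apply/measurable_EFinP. Qed.

(** Measurability by recursion on the syntax of the function. A comparison whose right argument is
    the variable itself appears eta-reduced, as [Order.lt c] or [Order.le c], hence the separate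
    cases. *)
Ltac meas1 := lazymatch goal with
  | |- measurable_fun _ (fun _ => ?c) => exact: measurable_cst
  | |- measurable_fun _ (Order.lt ?c) =>
      apply: (measurable_fun_ltr (f := fun=> c) (g := fun x => x))
  | |- measurable_fun _ (Order.le ?c) =>
      apply: (measurable_fun_ler (f := fun=> c) (g := fun x => x))
  | |- measurable_fun _ (fun x => x) => exact: measurable_id
  | |- measurable_fun _ (fun x => x.1) => exact: measurable_fst
  | |- measurable_fun _ (fun x => x.2) => exact: measurable_snd
  | |- measurable_fun _ (fun x => (@?f x)%:E) => apply: measurable_EFin
  | |- measurable_fun _ (fun x => @?f x && @?g x) => apply: measurable_and
  | |- measurable_fun _ (fun x => (@?f x < @?g x)%R) => apply: measurable_fun_ltr
  | |- measurable_fun _ (fun x => (@?f x <= @?g x)%R) => apply: measurable_fun_ler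
  | |- measurable_fun _ (fun x => (@?f x * @?g x)%E) => apply: emeasurable_funM
  | |- measurable_fun _ (fun x => (@?f x + @?g x)%E) => apply: emeasurable_funD
  | |- measurable_fun _ (fun x => (@?f x * @?g x)%R) => apply: measurable_funM
  | |- measurable_fun _ (fun x => (@?f x + - @?g x)%R) => apply: measurable_funB
  | |- measurable_fun _ (fun x => (@?f x + @?g x)%R) => apply: measurable_funD
  | |- measurable_fun _ (fun x => (- @?f x)%R) =>
      apply: (measurableT_comp (@oppr_measurable _ _) (g := f))
  | |- measurable_fun _ (fun x => (@?f x ^+ ?n)%R) =>
      apply: (measurable_funX n (f := f))
  | |- measurable_fun _ (fun x => powR (@?f x) ?p) =>
      apply: (measurableT_comp (measurable_powR p) (g := f))
  | |- measurable_fun _ (fun x => expR (@?f x)) =>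
      apply: (measurableT_comp (@measurable_expR _) (g := f))
  | |- _ => first [apply: measurable_fun_ifT | done]
  end.

Ltac meas := repeat meas1.

Section gamma_integral.
Context {R : realType}.
Local Notation mu := (@lebesgue_measure R).
Implicit Types p q x : R.

(** Valued in the extended reals, so that the identities below follow from Tonelli alone; finiteness
    is proved afterwards, in [gamma_integral_fin]. *)
Definition gamma_integral (x : R) : \bar R :=
  (\int[mu]_(u in `]0%R, +oo[) (u `^ (x - 1) * expR (- u))%:E)%E.

Let itv0y (x : R) : (x \in `]0%R, +oo[) = (0 < x).
Proof. by rewrite in_itv/= andbT. Qed.

Lemma itv0yP (x : R) : `]0%R, +oo[%classic x <-> 0 < x.
Proof. by rewrite /= itv0y. Qed.

Let mgamma p : measurable_fun [set: R] (fun u : R => (u `^ (p - 1) * expR (- u))%:E).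
Proof. meas. Qed.

Lemma gamma_integral_ge0 x : (0 <= gamma_integral x)%E.
Proof. by apply: integral_ge0 => u _; rewrite lee_fin mulr_ge0 ?powR_ge0 ?expR_ge0. Qed.

Lemma lebesgue_integral_ifE (D : set R) (b : pred R) (f : R -> \bar R) :
  (forall x, D x <-> b x) ->
  (\int[mu]_(x in D) f x = \int[mu]_x (if b x then f x else 0))%E.
Proof. by move=> Db; exact: integral_itvE. Qed.

Lemma integral_gt0E (f : R -> \bar R) :
  (\int[mu]_(x in `]0%R, +oo[) f x = \int[mu]_x (if (0 < x)%R then f x else 0))%E.
Proof. by apply: integral_itvE; exact: itv0yP. Qed.

Lemma ge0_integral_scale (c : R) (f : R -> \bar R) : 0 < c ->
  measurable_fun [set: R] f -> (forall x, 0 <= f x)%E ->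
  (\int[mu]_(x in `]0%R, +oo[) f x = c%:E * \int[mu]_(x in `]0%R, +oo[) f (c * x)%R)%E.
Proof.
move=> c0 mf f0; rewrite !integral_gt0E.
rewrite (@ge0_integral_affine R c 0)//.
- by congr (_ * _)%E; apply: eq_integral => x _; rewrite addr0 pmulr_rgt0.
- meas.
- by move=> x; case: ifP.
Qed.

Lemma gamma_integral_scale p (h : R) : 0 < h ->
  (\int[mu]_(u in `]0%R, +oo[) (u `^ (p - 1) * expR (- (u * h)))%:E =
   (h `^ (- p))%:E * gamma_integral p)%E.
Proof.
move=> h0; rewrite [in RHS]/gamma_integral [X in (_ * X)%E](@ge0_integral_scale h)//; last first.
  by move=> x; rewrite lee_fin mulr_ge0 ?powR_ge0 ?expR_ge0.
have -> : (\int[mu]_(x in `]0%R, +oo[) ((h * x) `^ (p - 1) * expR (- (h * x)))%:E =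
    (h `^ (p - 1))%:E * \int[mu]_(x in `]0%R, +oo[) (x `^ (p - 1) * expR (- (x * h)))%:E)%E.
  rewrite -ge0_integralZl//=.
  - apply: eq_integral => u; rewrite inE => /itv0yP u0.
    by rewrite powRM ?ltW// -mulrA EFinM (mulrC h).
  - by apply: measurable_funTS; meas.
  - by move=> x _; rewrite lee_fin mulr_ge0 ?powR_ge0 ?expR_ge0.
  - by rewrite lee_fin powR_ge0.
rewrite !muleA -!EFinM.
rewrite (_ : _ * _ = 1)%R ?mul1e//.
rewrite -{2}(powRr1 (ltW h0)) -!powRD ?(gt_eqF h0) ?implybT//.
by rewrite (_ : _ + _ = 0)%R ?powRr0//; lra.
Qed.

(* Tonelli applied to [x v^(x-1) e^(-u)] on [0 < v <= u]. *)
Lemma gamma_integralS x : 0 < x ->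
  gamma_integral (x + 1) = (x%:E * gamma_integral x)%E.
Proof.
move=> x0.
pose K (z : R * R) : \bar R := (if (0 < z.2) && (z.2 <= z.1) then
  x * z.2 `^ (x - 1) * expR (- z.1) else 0)%:E.
have mK : measurable_fun setT K by rewrite /K; meas.
have K0 z : (0 <= K z)%E.
  by rewrite lee_fin; case: ifP => // _; rewrite !mulr_ge0 ?powR_ge0 ?expR_ge0// ltW.
transitivity (\int[mu]_u \int[mu]_v K (u, v))%E.
  rewrite /gamma_integral integral_gt0E; apply: eq_integral => u _.
  case: ifPn => u0; last first.
    rewrite integral0_eq// => v _; rewrite /K/=; case: ifP => // /andP[v0 vu].
    by rewrite (lt_le_trans v0 vu) in u0.
  rewrite addrK mulrC EFinM -(integral_powR x0 (ltW u0)) -ge0_integralZl//=; last 2 first.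
  - by apply: measurable_funTS; meas.
  - by move=> v _; rewrite lee_fin mulr_ge0 ?powR_ge0// ltW.
  rewrite (@lebesgue_integral_ifE _ (fun v : R => (0 < v) && (v <= u))).
    by apply: eq_integral => v _; rewrite /K/=; case: ifP => // _; rewrite -EFinM mulrC.
  by move=> v /=; rewrite in_itv.
rewrite fubini_tonelli//.
rewrite /gamma_integral integral_gt0E -ge0_integralZl//=; last 3 first.
- by meas.
- by move=> v _; case: ifP => // _; rewrite lee_fin mulr_ge0 ?powR_ge0 ?expR_ge0.
- by rewrite lee_fin ltW.
apply: eq_integral => v _; case: ifPn => v0; last first.
  by rewrite mule0 integral0_eq// => u _; rewrite /K/= (negbTE v0).
rewrite -EFinM mulrA EFinM -integral_expRN -ge0_integralZl//=; last 2 first.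
- by apply: measurable_funTS; meas.
- by rewrite lee_fin mulr_ge0 ?powR_ge0// ltW.
rewrite [in RHS](@lebesgue_integral_ifE _ (fun u : R => (v <= u))).
  by apply: eq_integral => u _; rewrite /K/= v0/=; case: ifP.
by move=> u /=; rewrite in_itv/= andbT.
Qed.

Lemma gamma_integral1 : gamma_integral 1 = 1%E.
Proof.
rewrite /gamma_integral integral_itv_obnd_cbnd; last first.
  by apply: measurable_funTS.
transitivity (\int[mu]_(u in `[0%R, +oo[) (expR (- u))%:E)%E.
  by apply: eq_integral => u _; rewrite subrr powRr0 mul1r.
by rewrite integral_expRN oppr0 expR0.
Qed.

Lemma gamma_integral_nat n : gamma_integral n.+1%:R = (n`!%:R)%:E.
Proof.
elim: n => [|n IH]; first exact: gamma_integral1.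
by rewrite -natr1 gamma_integralS// IH -EFinM -natrM factS.
Qed.

(* A power with exponent between those of two others is at most their sum. *)
Lemma powR_le_sum (u a b c : R) : 0 < u -> a <= b <= c -> u `^ b <= u `^ a + u `^ c.
Proof.
move=> u0 /andP[ab bc]; have [u1|u1] := leP 1 u.
  by rewrite (le_trans (ler_powR u1 bc))// lerDr powR_ge0.
apply: le_trans (_ : u `^ a <= _); last by rewrite lerDl powR_ge0.
by apply: ger_powR => //; rewrite u0 ltW.
Qed.

Lemma gamma_integral_le (a b c : R) : a <= b <= c ->
  (gamma_integral b <= gamma_integral a + gamma_integral c)%E.
Proof.
move=> abc; rewrite /gamma_integral -ge0_integralD//=; last 4 first.
- by move=> x _; rewrite lee_fin mulr_ge0 ?powR_ge0 ?expR_ge0.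
- by apply: measurable_funTS; meas.
- by move=> x _; rewrite lee_fin mulr_ge0 ?powR_ge0 ?expR_ge0.
- by apply: measurable_funTS; meas.
apply: ge0_le_integral => //=.
- by move=> x _; rewrite lee_fin mulr_ge0 ?powR_ge0 ?expR_ge0.
- by apply: measurable_funTS; meas.
- by apply: measurable_funTS; apply: emeasurable_funD; meas.
- move=> u /itv0yP u0; rewrite -EFinD lee_fin -mulrDl ler_wpM2r ?expR_ge0//.
  by apply: powR_le_sum => //; rewrite !lerD2r.
Qed.

(** Interpolation between the arguments 1 and an integer bounds the value at [x + 1], which lies
    above 1; by the functional equation an infinite value at x would be infinite at [x + 1] too. *)
Lemma gamma_integral_fin x : 0 < x -> gamma_integral x \is a fin_num.
Proof.
move=> x0; rewrite ge0_fin_numE ?gamma_integral_ge0//.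
have : (gamma_integral (x + 1) < +oo)%E.
  apply: le_lt_trans (@gamma_integral_le 1 _ ((Num.truncn (x + 1)).+2)%:R _) _.
    rewrite lerDr ltW//= -natr1 ltW// (lt_trans (truncnS_gt _))//.
    by rewrite natr1 ltr_nat.
  by rewrite gamma_integral1 gamma_integral_nat -EFinD ltry.
rewrite gamma_integralS//; have := gamma_integral_ge0 x.
by case: (gamma_integral x) => [r||]//=; rewrite ?ltry// mulry gtr0_sg// mul1e.
Qed.

(** A zero at x would propagate to [x + 1] by the functional equation, and by interpolation to the
    integer between them, where the value is a factorial. *)
Lemma gamma_integral_gt0 x : 0 < x -> (0 < gamma_integral x)%E.
Proof.
move=> x0; rewrite lt_neqAle gamma_integral_ge0 andbT; apply/eqP => g0.
have tx : (Num.truncn x)%:R <= x < (Num.truncn x).+1%:R by apply: truncn_itv; exact: ltW.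
have : (gamma_integral (Num.truncn x).+1%:R <= gamma_integral x + gamma_integral (x + 1))%E.
  by apply: gamma_integral_le; case/andP: tx => h1 h2; rewrite ltW//= -natr1 lerD2r.
by rewrite gamma_integralS// -g0 mule0 adde0 gamma_integral_nat lee_fin leNgt ltr0n fact_gt0.
Qed.

Lemma GammaE x : 0 < x -> (Gamma x)%:E = gamma_integral x.
Proof.
move=> x0; rewrite /Gamma.
have -> : Num.truncn (1 - x) = 0%N by apply/truncn0Pn; rewrite -ltNge; lra.
rewrite big_ord0 divr1 /Rintegral addr0 fineK//; exact: gamma_integral_fin.
Qed.

Lemma Gamma_gt0 x : 0 < x -> 0 < Gamma x.
Proof. by move=> x0; rewrite -lte_fin GammaE// gamma_integral_gt0. Qed.

Lemma GammaS x : 0 < x -> Gamma (x + 1) = x * Gamma x.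
Proof.
by move=> x0; have := gamma_integralS x0; rewrite -!GammaE ?addr_gt0// -EFinM => -[].
Qed.

Lemma Gamma_nat n : Gamma (n%:R + 1) = n`!%:R :> R.
Proof. by have := gamma_integral_nat n; rewrite -GammaE// -natr1 => -[]. Qed.

End gamma_integral.

(** * Beta integral, stretched exponentials and growth of Gamma *)

Section gamma_identities.
Context {R : realType}.
Local Notation mu := (@lebesgue_measure R).
Implicit Types p q a : R.

(* Beta integral: substitute [y = w - x] in the double integral for
   [Gamma p * Gamma q], swap, and scale [x = w v]. *)
Lemma gamma_integral_beta p q :
  (gamma_integral p * gamma_integral q = gamma_integral (p + q) *
   \int[mu]_(v in `]0%R, 1%R[) (v `^ (p - 1) * (1 - v) `^ (q - 1))%:E)%E.
Proof.
(* Extended by 0, the integrand itself encodes [0 < x < w]: all integrals run over the whole line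
   and the affine substitutions leave the domain unchanged. *)
pose g p (x : R) : R := if 0 < x then x `^ (p - 1) * expR (- x) else 0.
have g0 r x : 0 <= g r x by rewrite /g; case: ifP => // _; rewrite mulr_ge0 ?powR_ge0 ?expR_ge0.
have mg r : measurable_fun [set: R] (g r) by rewrite /g; meas.
have mgE r : measurable_fun [set: R] (fun x => (g r x)%:E) by exact: measurable_EFin.
have gE r : gamma_integral r = (\int[mu]_x (g r x)%:E)%E.
  by rewrite /gamma_integral integral_gt0E; apply: eq_integral => x _; rewrite /g; case: ifP.
pose h (v : R) : R := if (0 < v) && (v < 1) then v `^ (p - 1) * (1 - v) `^ (q - 1) else 0.
have h0 v : 0 <= h v by rewrite /h; case: ifP => // _; rewrite mulr_ge0 ?powR_ge0.
have mh : measurable_fun [set: R] h by rewrite /h; meas.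
have -> : (\int[mu]_(v in `]0%R, 1%R[) (v `^ (p - 1) * (1 - v) `^ (q - 1))%:E =
    \int[mu]_v (h v)%:E)%E.
  rewrite (@lebesgue_integral_ifE _ _ (fun v : R => (0 < v) && (v < 1))).
    by apply: eq_integral => v _; rewrite /h; case: ifP.
  by move=> v /=; rewrite in_itv.
have key (w v : R) : 0 < w ->
    w * (g p (w * v) * g q (w - w * v)) = w `^ (p + q - 1) * expR (- w) * h v.
  move=> w0; rewrite /g /h pmulr_rgt0// (_ : w - w * v = w * (1 - v)) ?pmulr_rgt0 ?subr_gt0//; last by rewrite mulrBr mulr1.
  case: (ltP 0 v) => v0/=; last by rewrite !(mul0r, mulr0).
  case: (ltP v 1) => v1; last by rewrite !(mul0r, mulr0).
  rewrite !powRM ?ltW ?subr_gt0//.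
  have -> : w `^ (p + q - 1) = w * (w `^ (p - 1) * w `^ (q - 1)).
    rewrite -{2}(powRr1 (ltW w0)) -!powRD ?(gt_eqF w0) ?implybT//.
    by congr (_ `^ _); lra.
  have -> : expR (- w) = expR (- (w * v)) * expR (- (w * (1 - v))).
    by rewrite -expRD; congr expR; ring.
  ring.
pose K (z : R * R) := (g p z.1 * g q (z.2 - z.1))%:E.
have mK : measurable_fun setT K.
  apply: measurable_EFin; apply: measurable_funM.
    exact: (measurableT_comp (mg p) measurable_fst).
  by apply: (measurableT_comp (mg q)); meas.
transitivity (\int[mu]_x \int[mu]_w K (x, w))%E.
  rewrite (gE p) -ge0_integralZr//=; last 3 first.
  - exact: mgE.
  - by move=> x _; rewrite lee_fin.
  - exact: gamma_integral_ge0.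
  apply: eq_integral => x _; rewrite gE (@ge0_integral_affine R 1 (- x))//; last first.
    by move=> y; rewrite lee_fin.
  rewrite mul1e -ge0_integralZl//=.
  - by apply: eq_integral => w _; rewrite mul1r.
  - by apply: measurable_EFin; apply: (measurableT_comp (mg q)); meas.
  - by move=> y _; rewrite lee_fin.
  - by rewrite lee_fin.
have K0 z : (0 <= K z)%E by rewrite lee_fin mulr_ge0.
rewrite fubini_tonelli//.
rewrite (gE (p + q)) -ge0_integralZr//=; last 3 first.
- exact: mgE.
- by move=> x _; rewrite lee_fin.
- by apply: integral_ge0 => v _; rewrite lee_fin.
apply: eq_integral => w _; have [w0|w0] := ltP 0 w; last first.
  rewrite [g _ w]/g ltNge w0/= mul0e integral0_eq// => x _.
  rewrite /K /g/=; case: ifP => [x0|_]; last by rewrite mul0r.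
  by rewrite subr_gt0 ltNge (le_trans w0 (ltW x0)) mulr0.
rewrite /K/= (@ge0_integral_affine R w 0)//; last 2 first.
- apply: measurable_EFin; apply: measurable_funM => //.
  by apply: (measurableT_comp (mg q)); meas.
- by move=> y; rewrite lee_fin mulr_ge0.
rewrite [g _ w]/g w0 -[RHS]ge0_integralZl//=; last 3 first.
- exact: measurable_EFin.
- by move=> y _; rewrite lee_fin.
- by rewrite lee_fin mulr_ge0 ?powR_ge0 ?expR_ge0.
rewrite -[LHS]ge0_integralZl//=; last 3 first.
- by apply: measurable_EFin; apply: measurable_funM;
    [apply: (measurableT_comp (mg p))|apply: (measurableT_comp (mg q))]; meas.
- by move=> y _; rewrite lee_fin mulr_ge0.
- by rewrite lee_fin ltW.
apply: eq_integral => v _; rewrite addr0 -!EFinM; congr EFin.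
exact: key.
Qed.

(* Tonelli applied to [a p u^(a p - 1) e^(-w)] on [0 < u, u^a <= w]. *)
Lemma integral_stretched_expR a p : 0 < a -> 0 < p ->
  (\int[mu]_(u in `]0%R, +oo[) (a * p * u `^ (a * p - 1) * expR (- (u `^ a)))%:E =
   gamma_integral (p + 1))%E.
Proof.
move=> a0 p0.
pose K (z : R * R) : \bar R := (if (0 < z.1) && (z.1 `^ a <= z.2) then
  a * p * z.1 `^ (a * p - 1) * expR (- z.2) else 0)%:E.
have mK : measurable_fun setT K by rewrite /K; meas.
have ap0 := mulr_gt0 a0 p0.
have K0 z : (0 <= K z)%E.
  by rewrite lee_fin; case: ifP => // _; rewrite mulr_ge0 ?expR_ge0// mulr_ge0 ?powR_ge0// ltW.
transitivity (\int[mu]_u \int[mu]_w K (u, w))%E.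
  rewrite integral_gt0E; apply: eq_integral => u _.
  case: ifPn => u0; last first.
    by rewrite integral0_eq// => v _; rewrite /K/= (negbTE u0).
  rewrite EFinM -integral_expRN -ge0_integralZl//=; last 2 first.
  - by apply: measurable_funTS; meas.
  - by rewrite lee_fin mulr_ge0 ?powR_ge0// ltW.
  rewrite [in LHS](@lebesgue_integral_ifE _ _ (fun v : R => (u `^ a <= v))).
    by apply: eq_integral => v _; rewrite /K/= u0/=; case: ifP.
  by move=> v /=; rewrite in_itv/= andbT.
have I (w : R) : 0 < w ->
    (w `^ p)%:E = (\int[mu]_(v in `]0%R, (w `^ a^-1)%R]) (a * p * v `^ (a * p - 1))%:E)%E.
  by move=> w0; rewrite integral_powR ?powR_ge0// -powRrM mulrA mulVf ?gt_eqF// mul1r.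
rewrite fubini_tonelli// /gamma_integral integral_gt0E.
apply: eq_integral => w _; case: ifPn => w0; last first.
  rewrite integral0_eq// => u _; rewrite /K/=; case: ifP => // /andP[u0 uw].
  by move: w0; rewrite (lt_le_trans _ uw)// powR_gt0.
rewrite addrK mulrC EFinM.
rewrite I//.
rewrite -ge0_integralZl//=; last 2 first.
- by apply: measurable_funTS; meas.
- by move=> v _; rewrite lee_fin mulr_ge0 ?powR_ge0// ltW.
rewrite [in RHS](@lebesgue_integral_ifE _ _ (fun u : R => (0 < u) && (u `^ a <= w))).
  apply: eq_integral => u _; rewrite /K/=; case: ifP => // _.
  by rewrite -EFinM mulrC.
move=> u /=; rewrite in_itv/=; split=> /andP[u0 uw]; rewrite u0/=.
  have -> : w = (w `^ a^-1) `^ a by rewrite -powRrM mulVf ?gt_eqF// powRr1// ltW.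
  by rewrite ge0_ler_powR ?nnegrE ?powR_ge0// ltW.
have -> : u = (u `^ a) `^ a^-1 by rewrite -powRrM mulfV ?gt_eqF// powRr1// ltW.
by rewrite ge0_ler_powR ?nnegrE ?powR_ge0 ?invr_ge0// ltW.
Qed.

(** Concavity at the point c, obtained from Young's inequality for [(u / c) ^ t] and 1 with
    conjugate exponents [1 / t] and [1 / (1 - t)]. *)
Lemma powR_le_tangent (u c t : R) : 0 <= u -> 0 < c -> 0 < t < 1 ->
  u `^ t <= c `^ t * (1 - t + t * (u / c)).
Proof.
move=> u0 c0 /andP[t0 t1].
have -> : u `^ t = c `^ t * (u / c) `^ t.
  rewrite -powRM ?divr_ge0 ?(ltW c0)//; congr (_ `^ _).
  by rewrite mulrC divfK ?gt_eqF.
rewrite ler_wpM2l ?powR_ge0//.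
have := @conjugate_powR R ((u / c) `^ t) 1 t^-1 (1 - t)^-1.
rewrite powR_ge0 ler01 !invr_gt0 subr_gt0 !invrK addrC subrK mulr1 => /(_ isT isT t0 t1 erefl).
move=> /le_trans; apply.
rewrite -powRrM mulfV ?gt_eqF// powRr1 ?divr_ge0 ?(ltW c0)// powR1 mul1r.
by rewrite addrC mulrC.
Qed.

(* Integrate the tangent line of [u^(1 - a)] at [u = y + a] against
   [u^(y + a - 1) e^(-u)]. *)
Lemma Gamma_growth (y a : R) : 0 <= y -> 0 < a <= 1 ->
  Gamma (y + 1) <= (y + a) `^ (1 - a) * Gamma (y + a).
Proof.
move=> y0 /andP[a0]; rewrite le_eqVlt => /predU1P[->|a1].
  by rewrite subrr powRr0 mul1r.
have c0 : 0 < y + a by rewrite ltr_wpDl.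
(* The density proportional to [u ^ (c - 1) * e^(-u)] has mean c, so averaging the tangent line at c
   returns its value at c. *)
set c := y + a in c0 *.
suff: (gamma_integral (y + 1) <= (c `^ (1 - a) * a)%:E * gamma_integral c +
    (c `^ (1 - a) * ((1 - a) / c))%:E * gamma_integral (c + 1))%E.
  rewrite -(GammaE (ltr_wpDl y0 ltr01)) -(GammaE c0).
  rewrite -(GammaE (addr_gt0 c0 ltr01)) (GammaS c0) lee_fin.
  move=> /le_trans; apply.
  rewrite -!mulrA -mulrDr ler_wpM2l ?powR_ge0//.
  by rewrite mulKf ?gt_eqF// -mulrDl addrC subrK mul1r.
have t0 : 0 < 1 - a by rewrite subr_gt0.
rewrite /gamma_integral -!ge0_integralZl//=; last 6 first.
- by apply: measurable_funTS; meas.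
- by move=> u _; rewrite lee_fin mulr_ge0 ?powR_ge0 ?expR_ge0.
- by rewrite lee_fin mulr_ge0 ?powR_ge0// divr_ge0// ltW.
- by apply: measurable_funTS; meas.
- by move=> u _; rewrite lee_fin mulr_ge0 ?powR_ge0 ?expR_ge0.
- by rewrite lee_fin mulr_ge0 ?powR_ge0// ltW.
rewrite -ge0_integralD//=; last 4 first.
- by move=> u _; rewrite lee_fin !mulr_ge0 ?powR_ge0 ?expR_ge0// ltW.
- by apply: measurable_funTS; rewrite /=; meas.
- by move=> u _; rewrite lee_fin !mulr_ge0 ?powR_ge0 ?expR_ge0 ?invr_ge0// ltW.
- by apply: measurable_funTS; rewrite /=; meas.
apply: ge0_le_integral => //=.
- by move=> u _; rewrite lee_fin mulr_ge0 ?powR_ge0 ?expR_ge0.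
- by apply: measurable_funTS; meas.
- by apply: measurable_funTS; apply: (@measurable_EFin _ _ _ _ (fun u => _ + _)); meas.
- move=> u /itv0yP u0; rewrite -!EFinM -EFinD lee_fin.
  have := @powR_le_tangent u c (1 - a) (ltW u0) c0; rewrite t0 ltrBlDr ltrDl a0 => /(_ isT).
  move=> /(ler_wpM2l (powR_ge0 u (c - 1))) /(ler_wpM2r (expR_ge0 (- u))).
  rewrite -powRD ?(gt_eqF u0) ?implybT// (_ : c - 1 + (1 - a) = y + 1 - 1); last by rewrite /c; ring.
  move=> /le_trans; apply.
  rewrite addrK -(@mulr_powRB1 _ u c (ltW u0) c0); rewrite le_eqVlt.
  by apply/orP; left; apply/eqP; field; rewrite gt_eqF.
Qed.

End gamma_identities.

(** * A ratio test, derivatives, and the exponential series *)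

Section ratio_test.
Context {R : realType}.

Lemma ratio_cvgn (t : R^nat) (K theta : R) (N : nat) : 0 <= K -> 0 <= theta < 1 ->
  (forall r, `|t r.+1| <= K * (N + r).+2%:R `^ theta / r.+1%:R * `|t r|) ->
  cvgn (series t).
Proof.
move=> K0 /andP[th0 th1] tr.
(* Since [(N + r).+2 <= N.+2 * r.+1], this constant absorbs the shift N, and the ratio is at most
   [C * r.+1 ^ (theta - 1)], which tends to 0. *)
pose C := K * N.+2%:R `^ theta.
have C0 : 0 <= C by rewrite mulr_ge0 ?powR_ge0.
have [r0 Hr0] : exists r0, forall r, (r0 <= r)%N -> `|t r.+1| <= 2^-1 * `|t r|.
  (* The summand 1 keeps the threshold meaningful when C = 0; C times the threshold is at most
     1/2. *)
  have h : 0 < (2 * (C + 1))^-1 by rewrite invr_gt0 mulr_gt0// ltr_wpDl.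
  have th1' : 0 < 1 - theta by rewrite subr_gt0.
  have [r0 _ Hr0] := (cvgrPdist_lt _ _).1 (powR_cvg0n th1') _ h.
  exists r0 => r r0r; have := Hr0 r r0r.
  rewrite /= sub0r normrN ger0_norm ?powR_ge0// => Hr.
  apply: (le_trans (tr r)); rewrite ler_wpM2r//.
  have r1 : 0 < r.+1%:R :> R by [].
  have E : r.+1%:R^-1 `^ (1 - theta) = r.+1%:R `^ theta / r.+1%:R.
    rewrite -powR_inv1 ?ler0n// -powRrM -powRD ?(gt_eqF r1) ?implybT//.
    by congr (_ `^ _); ring.
  apply: (@le_trans _ _ (C * r.+1%:R^-1 `^ (1 - theta))).
    rewrite E mulrA ler_wpM2r ?invr_ge0// /C -mulrA ler_wpM2l// -powRM//.
    rewrite ge0_ler_powR ?nnegrE ?mulr_ge0// -natrM ler_nat.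
    by rewrite mulnS -!addSn leq_add2l leq_pmull.
  apply: (@le_trans _ _ (C * (2 * (C + 1))^-1)); first by rewrite ler_wpM2l// ltW.
  rewrite invfM mulrCA ler_piMr// ler_pdivrMr ?ltr_wpDl//; lra.
(* D dominates every term up to r0 after multiplication by [2 ^ k]; beyond r0 the halving of the
   ratios preserves the bound. *)
pose D := \sum_(k < r0.+1) `|t k| * 2 ^+ k.
have tD k : `|t k| <= D * 2^-1 ^+ k.
  have [kr|] := leqP k r0.
    rewrite exprVn ler_pdivlMr ?exprn_gt0//.
    rewrite /D (bigD1 (Ordinal (kr : (k < r0.+1)%N)))//= lerDl.
    by apply: sumr_ge0 => i _; rewrite mulr_ge0 ?exprn_ge0.
  elim: k => // k IH; rewrite ltnS leq_eqVlt => /predU1P[r0k|rk].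
    apply: (le_trans (Hr0 _ _)); first by rewrite r0k.
    rewrite -r0k exprS mulrCA ler_wpM2l ?invr_ge0// exprVn ler_pdivlMr ?exprn_gt0//.
    rewrite /D big_ord_recr/= lerDr.
    by apply: sumr_ge0 => i _; rewrite mulr_ge0 ?exprn_ge0.
  apply: (le_trans (Hr0 _ (ltnW rk))).
  by rewrite exprS mulrCA ler_wpM2l ?invr_ge0// IH.
apply: normed_cvg; apply: (@series_le_cvg _ _ (geometric D 2^-1)) => //.
- by move=> n; rewrite /=.
- by move=> n; rewrite /= mulr_ge0 ?exprn_ge0 ?invr_ge0//; apply: sumr_ge0 => i _; rewrite mulr_ge0 ?exprn_ge0.
- apply: is_cvg_geometric_series; by rewrite ger0_norm ?invr_ge0// invf_lt1// (ltr1n R 2).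
Qed.

End ratio_test.

Section pointwise_derivatives.
Context {R : realType}.
Implicit Types (f g : R -> R) (x a b c : R).

Lemma isd_cst c x : is_derive x 1 (fun _ : R => c) 0.
Proof. exact: is_derive_cst. Qed.

Lemma isd_id x : is_derive x 1 (fun y : R => y) 1.
Proof. exact: is_derive_id. Qed.

Lemma isdD f g x a b : is_derive x 1 f a -> is_derive x 1 g b ->
  is_derive x 1 (fun y => f y + g y) (a + b).
Proof. by move=> fa gb; exact: is_deriveD. Qed.

Lemma isdN f x a : is_derive x 1 f a -> is_derive x 1 (fun y => - f y) (- a).
Proof. by move=> fa; exact: is_deriveN. Qed.

Lemma isd_eq f x a b : is_derive x 1 f a -> a = b -> is_derive x 1 f b.
Proof. by move=> h <-. Qed.

Lemma isdM f g x a b : is_derive x 1 f a -> is_derive x 1 g b ->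
  is_derive x 1 (fun y => f y * g y) (a * g x + f x * b).
Proof.
move=> fa gb; have h := is_deriveM fa gb.
have -> : a * g x + f x * b = f x *: b + g x *: a by rewrite addrC [a * _]mulrC.
exact h.
Qed.

Lemma isd_comp f g x a b : is_derive (g x) 1 f a -> is_derive x 1 g b ->
  is_derive x 1 (fun y => f (g y)) (a * b).
Proof.
move=> fa gb; have h := is_derive1_comp fa gb.
exact h.
Qed.

Lemma isd_expR f x a : is_derive x 1 f a ->
  is_derive x 1 (fun y => expR (f y)) (expR (f x) * a).
Proof. by move=> fa; apply: isd_comp. Qed.

Lemma isdX f x a n : is_derive x 1 f a ->
  is_derive x 1 (fun y => f y ^+ n.+1) (n.+1%:R * f x ^+ n * a).
Proof.
move=> fa; elim: n => [|n IH].
  by rewrite expr0 mulr1 mul1r; under eq_fun do rewrite expr1.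
under eq_fun do rewrite exprS.
by apply: isd_eq (isdM fa IH) _; rewrite -(natr1 n.+1) exprS; ring.
Qed.

Lemma isd_sum (I : Type) (s : seq I) (P : pred I) (f : I -> R -> R) (a : I -> R) x :
  (forall i, P i -> is_derive x 1 (f i) (a i)) ->
  is_derive x 1 (fun y => \sum_(i <- s | P i) f i y) (\sum_(i <- s | P i) a i).
Proof.
move=> fa; elim: s => [|i s IH].
  by rewrite big_nil; under eq_fun do rewrite big_nil; exact: isd_cst.
rewrite big_cons; under eq_fun do rewrite big_cons.
by case: ifPn => // Pi; apply: isdD => //; exact: fa.
Qed.

Lemma isd_powR f x a p : 0 < f x -> is_derive x 1 f a ->
  is_derive x 1 (fun y => f y `^ p) (p * f x `^ (p - 1) * a).
Proof. by move=> fx fa; apply: (isd_comp (f := @powR R ^~ p)); first exact: is_derive1_powR. Qed.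

End pointwise_derivatives.

(** Since [is_derive] is a class, [notypeclasses refine] keeps instance search away from the
    premises: the derivative is computed by recursion on the syntax, in the ring form given by
    [isdD], [isdM] and their companions, and [der] leaves one algebraic identity. *)
Ltac der1 := lazymatch goal with
  | |- is_derive _ _ (fun _ => ?c) _ => exact: isd_cst
  | |- is_derive _ _ (fun y => y) _ => exact: isd_id
  | |- is_derive _ _ (fun y => @?f y + @?g y) _ => notypeclasses refine (isdD (f := f) (g := g) _ _)
  | |- is_derive _ _ (fun y => - @?f y) _ => notypeclasses refine (isdN (f := f) _)
  | |- is_derive _ _ (fun y => @?f y * @?g y) _ => notypeclasses refine (isdM (f := f) (g := g) _ _)
  | |- is_derive _ _ (fun y => expR (@?f y)) _ => notypeclasses refine (isd_expR (f := f) _)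
  | |- is_derive _ _ (fun y => @?f y ^+ ?n) _ => notypeclasses refine (isdX (f := f) _ _)
  | |- _ => eassumption
  end.

Ltac der := notypeclasses refine (isd_eq _ _); [repeat der1|].

Section moment_series.
Context {R : realType}.

Lemma ge0_fun (f df : R -> R) : (forall x : R, is_derive x 1 f (df x)) ->
  0 <= f 0 -> (forall x, 0 < x -> 0 <= df x) -> forall x, 0 <= x -> 0 <= f x.
Proof.
move=> fdf f0 df0 x; rewrite le_eqVlt => /predU1P[<-//|x0].
have cf : {within `[0, x], continuous f}.
  by apply: derivable_within_continuous => y _; have [] := fdf y.
have [c] := MVT x0 (fun y _ => fdf y) cf.
rewrite in_itv/= => /andP[c0 _] E; apply: (le_trans f0).
by rewrite -subr_ge0 E mulr_ge0 ?df0// subr0 ltW.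
Qed.

Lemma natr_fact_neq0 m : m`!%:R != 0 :> R.
Proof. by rewrite pnatr_eq0 -lt0n fact_gt0. Qed.

Lemma natr_succ_neq0 m : m.+1%:R != 0 :> R.
Proof. by rewrite pnatr_eq0. Qed.

Definition exp_partial m (y : R) : R := \sum_(r < m) (- y) ^+ r / r`!%:R.

Lemma is_derive_exp_partial m (x : R) :
  is_derive x 1 (exp_partial m.+1) (- exp_partial m x).
Proof.
elim: m => [|m IH]; rewrite /exp_partial.
  under eq_fun do rewrite big_ord_recr big_ord0/=.
  by rewrite big_ord0; under eq_fun do rewrite expr0; rewrite oppr0; exact: isd_cst.
under eq_fun do rewrite big_ord_recr/=.
der.
rewrite /= big_ord_recr/= -/(exp_partial m x) factS natrM.
move: (natr_fact_neq0 m) (natr_succ_neq0 m).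
move: (m.+1%:R : R) (m`!%:R : R) => a b b0 a0.
by field; rewrite a0 b0.
Qed.

(** The derivative of the signed remainder of order m + 1 is the signed remainder of order m, and
    both the remainder and its bound vanish at 0; so the two inequalities at order m integrate to
    those at order m + 1. *)
Lemma exp_remainder_bounds m (y : R) : 0 <= y ->
  0 <= (-1) ^+ m * (expR (- y) - exp_partial m y) <= y ^+ m / m`!%:R.
Proof.
elim: m y => [|m IH] y y0.
  rewrite expr0 mul1r /exp_partial big_ord0 subr0 expR_ge0 mul1r invr1.
  by rewrite expR_le1 oppr_le0.
have dR (x : R) : is_derive x 1 (fun y => (-1) ^+ m.+1 * (expR (- y) - exp_partial m.+1 y))
    ((-1) ^+ m * (expR (- x) - exp_partial m x)).
  have h := is_derive_exp_partial m x.
  by der; rewrite exprS; ring.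
have R0 : (-1) ^+ m.+1 * (expR (- 0) - exp_partial m.+1 0) = 0 :> R.
  rewrite oppr0 expR0 /exp_partial big_ord_recl/= oppr0 expr0 divr1 big1 ?addr0 ?subrr ?mulr0//.
  by move=> i _; rewrite expr0n/= mul0r.
apply/andP; split.
  apply: (ge0_fun dR) => //; first by rewrite R0.
  by move=> x x0; have /andP[] := IH x (ltW x0).
rewrite -subr_ge0.
apply: (@ge0_fun (fun y => y ^+ m.+1 / m.+1`!%:R -
     (-1) ^+ m.+1 * (expR (- y) - exp_partial m.+1 y))
  (fun x => x ^+ m / m`!%:R - (-1) ^+ m * (expR (- x) - exp_partial m x))) => //.
- move=> x; have h := is_derive_exp_partial m x; der.
  rewrite /= !exprS factS natrM; move: (natr_fact_neq0 m) (natr_succ_neq0 m).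
  move: (m.+1%:R : R) (m`!%:R : R) => a b b0 a0.
  by field; rewrite a0 b0.
- by rewrite R0 expr0n/= mul0r subr0.
- by move=> x x0; rewrite subr_ge0; have /andP[] := IH x (ltW x0).
Qed.

Lemma norm_exp_remainder m (y : R) : 0 <= y ->
  `|expR (- y) - exp_partial m y| <= y ^+ m / m`!%:R.
Proof.
move=> y0; have /andP[r0 r1] := exp_remainder_bounds m y0.
have -> : `|expR (- y) - exp_partial m y| = `|(-1) ^+ m * (expR (- y) - exp_partial m y)|.
  by rewrite normrM normr_sign mul1r.
by rewrite ger0_norm.
Qed.

End moment_series.

(** * Laws determined by their moments *)

Section moments.
Context d (T : measurableType d) {R : realType} (m : {measure set T -> \bar R}).

Lemma integrable_le_Rfun (D : set T) (f g : T -> R) : measurable D ->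
  measurable_fun D f -> (forall x, D x -> `|f x| <= g x) ->
  m.-integrable D (EFin \o g) -> m.-integrable D (EFin \o f).
Proof.
move=> mD mf fg; apply: le_integrable => //; first exact: measurable_EFin.
by move=> x Dx /=; rewrite lee_fin; apply: (le_trans (fg x Dx)); rewrite ler_norm.
Qed.

Lemma integrableZ_Rfun (D : set T) (k : R) (f : T -> R) : measurable D ->
  m.-integrable D (EFin \o f) -> m.-integrable D (EFin \o (fun x => k * f x)).
Proof. by move=> mD intf; exact: (@integrableZl _ _ _ m D mD k (EFin \o f)). Qed.

Lemma integrableD_Rfun (D : set T) (f g : T -> R) : measurable D ->
  m.-integrable D (EFin \o f) -> m.-integrable D (EFin \o g) ->
  m.-integrable D (EFin \o (fun x => f x + g x)).
Proof. by move=> mD intf intg; exact: (@integrableD _ _ _ m D mD (EFin \o f) (EFin \o g)). Qed.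

Lemma integrableB_Rfun (D : set T) (f g : T -> R) : measurable D ->
  m.-integrable D (EFin \o f) -> m.-integrable D (EFin \o g) ->
  m.-integrable D (EFin \o (fun x => f x - g x)).
Proof. by move=> mD intf intg; exact: (@integrableB _ _ _ m D mD (EFin \o f) (EFin \o g)). Qed.

Section series_of_moments.
Variables (D : set T) (W X : T -> R) (M : nat -> R).
Hypotheses (mD : measurable D) (mW : measurable_fun D W) (mX : measurable_fun D X)
  (W0 : forall x, D x -> 0 <= W x) (X0 : forall x, D x -> 0 <= X x)
  (XM : forall q, (\int[m]_(x in D) (W x * X x ^+ q)%:E = (M q)%:E)%E).

Lemma integrable_moment q : m.-integrable D (EFin \o (fun x => W x * X x ^+ q)).
Proof.
apply/integrableP; split.
  by apply: measurable_EFin; apply: measurable_funM => //; exact: measurable_funX.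
rewrite (_ : (\int[m]_(x in D) _)%E = (M q)%:E) ?ltry// -XM.
apply: eq_integral => x; rewrite inE => Dx.
by rewrite /= ger0_norm// mulr_ge0 ?W0// exprn_ge0// X0.
Qed.

Lemma Rintegral_moment q : \int[m]_(x in D) (W x * X x ^+ q) = M q.
Proof. by rewrite /Rintegral XM. Qed.

Lemma integrable_moment_bounded N (f : T -> R) (C : R) : measurable_fun D f ->
  (forall x, D x -> `|f x| <= C) -> m.-integrable D (EFin \o (fun x => W x * X x ^+ N * f x)).
Proof.
move=> mf fC; apply: (@integrable_le_Rfun _ _ (fun x => C * (W x * X x ^+ N))) => //.
- by apply: measurable_funM => //; apply: measurable_funM => //; exact: measurable_funX.
- move=> x Dx; have WX0 : 0 <= W x * X x ^+ N by rewrite mulr_ge0 ?W0 ?exprn_ge0 ?X0.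
  by rewrite normrM (ger0_norm WX0) mulrC ler_wpM2r// fC.
- by apply: integrableZ_Rfun => //; exact: integrable_moment.
Qed.

Lemma integrable_moment_exp N (u : R) : 0 <= u ->
  m.-integrable D (EFin \o (fun x => W x * X x ^+ N * expR (- (u * X x)))).
Proof.
move=> u0; apply: (@integrable_moment_bounded _ _ 1) => [|x Dx].
  by apply: (measurableT_comp (@measurable_expR R)); apply: measurable_funN; apply: measurable_funM.
by rewrite ger0_norm ?expR_ge0// expR_le1 oppr_le0 mulr_ge0 ?X0.
Qed.

(** The partial sums are the integrals with the exponential replaced by its Taylor polynomial, and
    the error is at most the first omitted term in absolute value. That the terms tend to 0 is thus
    enough. The weight W makes room for the Caputo kernel. *)
Lemma cvg_weighted_moment_series N (u : R) : 0 <= u ->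
  (u ^+ r * M (N + r)%N / r`!%:R) @[r --> \oo] --> 0 ->
  series (fun r => (- u) ^+ r * M (N + r)%N / r`!%:R) @ \oo -->
  \int[m]_(x in D) (W x * X x ^+ N * expR (- (u * X x))).
Proof.
move=> u0 t0; set t := fun r => _.
pose S q x := W x * X x ^+ N * exp_partial q (u * X x).
have SS q x : S q.+1 x = S q x + (- u) ^+ q / q`!%:R * (W x * X x ^+ (N + q)).
  rewrite /S /exp_partial big_ord_recr/= mulrDr; congr (_ + _).
  by rewrite -mulNr exprMn exprD; ring.
have intT q : m.-integrable D (EFin \o (fun x => (- u) ^+ q / q`!%:R * (W x * X x ^+ (N + q)))).
  by apply: integrableZ_Rfun => //; exact: integrable_moment.
have intS q : m.-integrable D (EFin \o S q).
  elim: q => [|q IH].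
    apply: (eq_integrable _ _ _ _ (integrable0 _ _)) => //.
    by move=> x _; rewrite /S /exp_partial/= big_ord0 mulr0.
  rewrite (_ : S q.+1 = fun x => S q x + (- u) ^+ q / q`!%:R * (W x * X x ^+ (N + q))).
    exact: integrableD_Rfun.
  by apply/funext => x; rewrite SS.
have RS q : \int[m]_(x in D) S q x = series t q.
  elim: q => [|q IH].
    rewrite /series/= big_geq// /S /exp_partial; under eq_Rintegral do rewrite big_ord0 mulr0.
    by rewrite Rintegral_cst// mul0r.
  rewrite seriesSr -IH; under eq_Rintegral do rewrite SS.
  rewrite RintegralD// RintegralZl//; last exact: integrable_moment.
  by rewrite Rintegral_moment /t; congr (_ + _); rewrite mulrAC.
have inte := integrable_moment_exp N u0.
apply/cvgrPdist_lt => e e0; have [q0 _ Hq] := (cvgrPdist_lt _ _).1 t0 _ e0.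
exists q0 => // q /= q0q; have := Hq q q0q; rewrite /= sub0r normrN; apply: le_lt_trans.
rewrite -RS -RintegralB//.
apply: le_trans (le_normr_Rintegral _ _) _ => //.
  exact: integrableB_Rfun.
rewrite ger0_norm; last first.
  rewrite divr_ge0// mulr_ge0 ?exprn_ge0// -Rintegral_moment Rintegral_ge0// => x Dx.
  by rewrite mulr_ge0 ?W0// exprn_ge0// X0.
have -> : u ^+ q * M (N + q)%N / q`!%:R =
    \int[m]_(x in D) (u ^+ q / q`!%:R * (W x * X x ^+ (N + q))).
  by rewrite RintegralZl ?Rintegral_moment//; [rewrite mulrAC|exact: integrable_moment].
apply: le_Rintegral => //.
- apply: (@integrable_le_Rfun _ _ (fun x => `|W x * X x ^+ N * expR (- (u * X x)) - S q x|)) => //.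
  + apply: measurableT_comp => //; apply: measurable_funB.
      exact/measurable_EFinP/(measurable_int m inte).
    exact/measurable_EFinP/(measurable_int m (intS q)).
  + by move=> x Dx; rewrite normr_id.
  apply: integrable_norm.
  exact: integrableB_Rfun.
- by apply: integrableZ_Rfun => //; exact: integrable_moment.
move=> x Dx; have WX0 : 0 <= W x * X x ^+ N by rewrite mulr_ge0 ?W0 ?exprn_ge0 ?X0.
rewrite -mulrBr normrM ger0_norm//.
apply: (@le_trans _ _ (W x * X x ^+ N * ((u * X x) ^+ q / q`!%:R))).
  by rewrite ler_wpM2l// norm_exp_remainder// mulr_ge0 ?X0.
by rewrite exprMn exprD le_eqVlt; apply/orP; left; apply/eqP; ring.
Qed.

End series_of_moments.

Lemma cvg_moment_series (D : set T) (X : T -> R) (M : nat -> R) N (u : R) : measurable D ->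
  measurable_fun D X -> (forall x, D x -> 0 <= X x) ->
  (forall q, (\int[m]_(x in D) (X x ^+ q)%:E = (M q)%:E)%E) -> 0 <= u ->
  (u ^+ r * M (N + r)%N / r`!%:R) @[r --> \oo] --> 0 ->
  series (fun r => (- u) ^+ r * M (N + r)%N / r`!%:R) @ \oo -->
  \int[m]_(x in D) (X x ^+ N * expR (- (u * X x))).
Proof.
move=> mD mX X0 XM u0 t0.
rewrite (_ : (fun x => X x ^+ N * _) = fun x => 1 * X x ^+ N * expR (- (u * X x))).
  apply: (@cvg_weighted_moment_series D (cst 1) X M) => // q.
  by rewrite -XM; apply: eq_integral => x _; rewrite mul1r.
by apply/funext => x; rewrite mul1r.
Qed.

End moments.

Section halflines.
Context {R : realType}.

Lemma probability_eq_halfline (m1 m2 : probability R R) :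
  (forall y : R, m1 `]-oo, y[%classic = m2 `]-oo, y[%classic) ->
  forall A, measurable A -> m1 A = m2 A.
Proof.
move=> m12 A mA.
apply: (@measure_unique _ _ _ (@RGenInftyO.G R) (fun n => `]-oo, n%:R[%classic)) => //.
- exact: RGenInftyO.measurableE.
- move=> _ _ [x ->] [y ->]; exists (Order.min x y).
  by apply/seteqP; split=> z /=; rewrite !in_itv/= lt_min => /andP.
- by move=> i; exists i%:R.
- apply/seteqP; split => // x _; exists (Num.truncn x).+1 => //=.
  by rewrite in_itv/= truncnS_gt.
- by move=> B [y ->]; exact: m12.
- by move=> k; apply: le_lt_trans (probability_le1 _ _) _ => //; rewrite ltry.
Qed.

(** The hypothesis is applied at [y - 1 / (n + 1)], where even the closed half-line misses y;
    continuity from below then recovers the open half-line, whatever atom [m2] has at y. *)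
Lemma halfline_le (m1 m2 : probability R R) :
  (forall y : R, (m1 `]-oo, y[%classic <= m2 `]-oo, y]%classic)%E) ->
  forall y : R, (m1 `]-oo, y[%classic <= m2 `]-oo, y[%classic)%E.
Proof.
move=> m12 y; pose F n : set R := `]-oo, (y - n.+1%:R^-1)%R[%classic.
have FE : \bigcup_n F n = `]-oo, y[%classic.
  apply/seteqP; split=> x /=.
    by move=> [n _] /=; rewrite !in_itv/= => /lt_trans; apply; rewrite ltrBlDr ltrDl invr_gt0.
  rewrite in_itv/= => xy; have yx : 0 < y - x by rewrite subr_gt0.
  exists (Num.truncn (y - x)^-1) => //=; rewrite /F/= in_itv/= ltrBrDr -ltrBrDl.
  by rewrite invf_plt ?posrE// truncnS_gt.
have : (m1 \o F) n @[n --> \oo] --> m1 (\bigcup_n F n).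
  apply: nondecreasing_cvg_mu; [by move=> n; exact: measurable_itv|by rewrite FE|].
  move=> n k nk; apply/subsetPset => x /=; rewrite /F/= !in_itv/= => /lt_le_trans; apply.
  by rewrite lerD2l lerN2 lef_pV2 ?posrE// ler_nat.
rewrite FE => h; apply: (lee_cvg_to h (cvg_cst _)).
apply: nearW => n /=; apply: le_trans (m12 _) _; apply: le_measure; rewrite ?inE//.
move=> x /=; rewrite !in_itv/= => /le_lt_trans; apply.
by rewrite ltrBlDr ltrDl invr_gt0.
Qed.

(** Both the approximation of indicators by exponentials and the inversion of monotone paths leave
    the endpoint undecided and deliver exactly these one-sided comparisons. *)
Lemma probability_eq_sandwich (m1 m2 : probability R R) :
  (forall y : R, (m1 `]-oo, y[%classic <= m2 `]-oo, y]%classic)%E) ->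
  (forall y : R, (m2 `]-oo, y[%classic <= m1 `]-oo, y]%classic)%E) ->
  forall A, measurable A -> m1 A = m2 A.
Proof.
move=> m12 m21; apply: probability_eq_halfline => y.
by apply/eqP; rewrite eq_le !halfline_le.
Qed.

End halflines.

(** * Uniqueness of Laplace transforms on the half-line *)

Section laplace_uniqueness.
Context {R : realType}.
Local Notation D0 := (`[0%R, +oo[%classic : set R).

Lemma prob_bounded_integrable d (T : measurableType d) (m : probability T R) (D : set T)
    (f : T -> R) (C : R) : measurable D -> measurable_fun D f ->
  (forall x, D x -> `|f x| <= C) -> m.-integrable D (EFin \o f).
Proof.
move=> mD mf fC; apply: (@integrable_le_Rfun _ _ _ _ D f (cst C)) => //.
exact: finite_measure_integrable_cst.
Qed.

Lemma expR_mul_bern (M : nat) (v : R) : 0 <= v <= 1 -> 1 - M%:R * v <= (1 - v) ^+ M.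
Proof.
move=> /andP[v0 v1]; elim: M => [|M IH]; first by rewrite mul0r subr0.
have v1' : 0 <= 1 - v by rewrite subr_ge0.
rewrite exprS; apply: (le_trans _ (ler_wpM2l v1' IH)).
rewrite -subr_ge0 -natr1 (_ : _ - _ = M%:R * v * v); last by ring.
by rewrite mulr_ge0// mulr_ge0.
Qed.

(** From [1 - v <= e^(-v)] and [M v <= 1 + M v <= e^(M v)]. *)
Lemma expX_mul_le (M : nat) (v : R) : 0 <= v <= 1 -> 0 < M%:R * v ->
  (1 - v) ^+ M <= (M%:R * v)^-1.
Proof.
move=> /andP[v0 v1] Mv.
have v1' : 0 <= 1 - v by rewrite subr_ge0.
apply: (@le_trans _ _ (expR (- v) ^+ M)).
  by rewrite lerXn2r ?nnegrE ?expR_ge0//; have := expR_ge1Dx (- v).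
rewrite -expRM_natl mulrN expRN lef_pV2 ?posrE ?expR_gt0//.
by apply: le_trans (expR_ge1Dx _); rewrite lerDr.
Qed.

Section one_sided.
Variables (m1 m2 : probability R R) (t : R).
Hypotheses (t0 : 0 < t) (m10 : m1 `]-oo, 0%R[%classic = 0%E) (m20 : m2 `]-oo, 0%R[%classic = 0%E)
  (m12 : forall u : R, 0 < u -> (\int[m1]_(x in D0) (expR (- (u * x)))%:E =
    \int[m2]_(x in D0) (expR (- (u * x)))%:E)%E).

(** The choice gives [w t = 1/2]. Then [2 ^ n * v n x = (2 * w x) ^ n] tends to 0 for x > t and to
    infinity for 0 <= x < t, so [g n], which is roughly the exponential of minus this quantity,
    tends to the indicator of the points beyond t. Being polynomials in exponentials, the [g n] have
    integrals determined by the Laplace transform. *)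
Let c := ln 2 / t.
Let c0 : 0 < c. Proof. by rewrite divr_gt0// ln_gt0// ltr1n. Qed.
Let w (x : R) := expR (- (c * x)).
Let v (n : nat) (x : R) := expR (- (n%:R * c * x)).
Let g n x := (1 - v n x) ^+ (2 ^ n).

Let vE n x : v n x = w x ^+ n.
Proof. by rewrite /v /w -expRM_natl; congr expR; ring. Qed.

Let v01 n x : 0 <= x -> 0 <= v n x <= 1.
Proof.
by move=> x0; rewrite expR_ge0 expR_le1 oppr_le0 mulr_ge0// mulr_ge0// ltW.
Qed.

Let mv n : measurable_fun [set: R] (v n). Proof. by rewrite /v; meas. Qed.

Let mg n : measurable_fun [set: R] (g n).
Proof. by apply: measurable_funX; apply: measurable_funB. Qed.

Let g01 n x : 0 <= x -> 0 <= g n x <= 1.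
Proof.
move=> x0; have /andP[v0 v1] := v01 n x0.
by rewrite exprn_ge0 ?subr_ge0//= exprn_ile1 ?subr_ge0// lerBlDr lerDl.
Qed.

Let D0P x : D0 x -> 0 <= x. Proof. by rewrite /= in_itv/= andbT. Qed.

Let mass (m : probability R R) : m `]-oo, 0%R[%classic = 0%E -> m D0 = 1%E.
Proof.
move=> h; have := @probability_setC _ _ _ m `]-oo, 0%R[%classic (measurable_itv _).
by rewrite setCitvl h sube0.
Qed.

Let intgv M j n (m : probability R R) :
  m.-integrable D0 (EFin \o (fun x => (1 - v n x) ^+ M * v n x ^+ j)).
Proof.
apply: (@prob_bounded_integrable _ _ _ _ _ 1) => //.
  apply: measurable_funTS; apply: measurable_funM; apply: measurable_funX => //.
  exact: measurable_funB.
move=> x /D0P x0; have /andP[v0 v1] := v01 n x0.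
rewrite ger0_norm ?mulr_ge0 ?exprn_ge0 ?subr_ge0//.
by rewrite mulr_ile1 ?exprn_ge0 ?exprn_ile1 ?subr_ge0// lerBlDr lerDl.
Qed.

Let Ev M j n : \int[m1]_(x in D0) ((1 - v n x) ^+ M * v n x ^+ j) =
  \int[m2]_(x in D0) ((1 - v n x) ^+ M * v n x ^+ j).
Proof.
elim: M j => [|M IH] j.
  have E (m : probability R R) : \int[m]_(x in D0) ((1 - v n x) ^+ 0 * v n x ^+ j) =
      fine (\int[m]_(x in D0) (expR (- (j%:R * n%:R * c * x)))%:E)%E.
    rewrite /Rintegral; congr fine; apply: eq_integral => x _.
    by rewrite expr0 mul1r /v -expRM_natl; congr (expR _)%:E; ring.
  (* The Laplace hypothesis requires a positive argument; for [j * n = 0] the integrand is 1 and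
     both integrals are the total mass. *)
  rewrite !E; congr fine; have [jn|jn] := posnP (j * n); last first.
    by apply: m12; rewrite mulr_gt0// -natrM ltr0n.
  have E1 (m : probability R R) : m `]-oo, 0%R[%classic = 0%E ->
      (\int[m]_(x in D0) (expR (- (j%:R * n%:R * c * x)))%:E = 1)%E.
    move=> m0; transitivity (\int[m]_(x in D0) (cst 1 x))%E.
      by apply: eq_integral => x _; rewrite -natrM jn !mul0r oppr0 expR0.
    by rewrite integral_cst// mul1e; exact: mass m0.
  by rewrite !E1.
(* Expanding one factor [1 - v] raises the exponent of v, which is why the induction on M is carried
   out for all j. *)
have E (m : probability R R) : \int[m]_(x in D0) ((1 - v n x) ^+ M.+1 * v n x ^+ j) =
    \int[m]_(x in D0) ((1 - v n x) ^+ M * v n x ^+ j) -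
    \int[m]_(x in D0) ((1 - v n x) ^+ M * v n x ^+ j.+1).
  rewrite -RintegralB//; [|exact: intgv|exact: intgv].
  apply: eq_Rintegral => x _.
  by rewrite !exprS; ring.
by rewrite !E !IH.
Qed.

Let Eg n : (\int[m1]_(x in D0) (g n x)%:E = \int[m2]_(x in D0) (g n x)%:E)%E.
Proof.
have E (m : probability R R) : (\int[m]_(x in D0) (g n x)%:E =
    (\int[m]_(x in D0) ((1 - v n x) ^+ (2 ^ n) * v n x ^+ 0))%:E)%E.
  rewrite /Rintegral fineK.
    by apply: eq_integral => x _; rewrite expr0 mulr1.
  exact: integrable_fin_num (intgv _ _ _ _).
by rewrite !E Ev.
Qed.

Let wt : 2 * w t = 1.
Proof.
by rewrite /w /c divfK ?gt_eqF// expRN lnK ?posrE// mulfV.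
Qed.

Let w_lt x : t < x -> 2 * w x < 1.
Proof. by move=> tx; rewrite -[ltRHS]wt ltr_pM2l// ltr_expR ltrN2 ltr_pM2l. Qed.

Let w_gt x : x < t -> 1 < 2 * w x.
Proof. by move=> tx; rewrite -[ltLHS]wt ltr_pM2l// ltr_expR ltrN2 ltr_pM2l. Qed.

Let g_cvg1 x : t < x -> (g n x)%:E @[n --> \oo] --> 1%E.
Proof.
move=> tx; have x0 : 0 <= x by rewrite ltW// (lt_trans t0).
apply: cvg_EFin; first exact: nearW.
have w0 : 0 <= 2 * w x by rewrite mulr_ge0 ?expR_ge0.
have : (1 - (2 * w x) ^+ n) @[n --> \oo] --> (1 - 0 : R).
  by apply: cvgB; [exact: cvg_cst|apply: cvg_expr; rewrite ger0_norm// w_lt].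
rewrite subr0 => h; apply: squeeze_cvgr h (cvg_cst _).
apply: nearW => n /=; have /andP[_ ->] := g01 n x0; rewrite andbT.
have -> : (2 * w x) ^+ n = (2 ^ n)%:R * v n x by rewrite natrX vE exprMn.
exact: expR_mul_bern (v01 n x0).
Qed.

Let g_cvg0 x : 0 <= x < t -> (g n x)%:E @[n --> \oo] --> 0%E.
Proof.
move=> /andP[x0 xt]; apply: cvg_EFin; first exact: nearW.
have w0 : 0 < 2 * w x by rewrite mulr_gt0 ?expR_gt0.
have h : ((2 * w x)^-1 ^+ n) @[n --> \oo] --> (0 : R).
  by apply: cvg_expr; rewrite ger0_norm ?invr_ge0 ?ltW// invf_lt1// w_gt.
apply: squeeze_cvgr (cvg_cst _) h.
apply: nearW => n /=; have /andP[-> _] := g01 n x0; rewrite /=.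
rewrite exprVn; have E : (2 * w x) ^+ n = (2 ^ n)%:R * v n x by rewrite natrX vE exprMn.
by rewrite E; apply: expX_mul_le (v01 n x0) _; rewrite -E exprn_gt0.
Qed.

(** At t itself the limit of [g n] gives no indicator, so t is excluded on the left, and on the
    right it is included with the bound [g n <= 1]. *)
Lemma laplace_one_sided : (m1 `]t, +oo[%classic <= m2 `[t, +oo[%classic)%E.
Proof.
have sub1 : `]t, +oo[%classic `<=` D0.
  by move=> x /=; rewrite !in_itv/= !andbT => /ltW; apply: le_trans; exact: ltW.
have c1 : (\int[m1]_(x in `]t, +oo[) (g n x)%:E)%E @[n --> \oo] --> m1 `]t, +oo[%classic.
  have -> : m1 `]t, +oo[%classic = (\int[m1]_(x in `]t, +oo[) (cst 1 x))%E.
    by rewrite integral_cst// mul1e.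
  apply: (@dominated_cvg _ _ _ _ _ _ _ _ (cst 1%E)) => //=.
  - by move=> n; apply: measurable_funTS; apply: measurable_EFin.
  - by move=> x; rewrite in_itv/= andbT; exact: g_cvg1.
  - exact: finite_measure_integrable_cst.
  - move=> n x /sub1/D0P x0; have /andP[g0 g1] := g01 n x0.
    by rewrite lee_fin ger0_norm.
have c2 : (\int[m2]_(x in `[0%R, t[) (g n x)%:E)%E @[n --> \oo] --> 0%E.
  have -> : (0 = \int[m2]_(x in `[0%R, t[) (cst 0 x))%E by rewrite integral_cst// mul0e.
  apply: (@dominated_cvg _ _ _ _ _ _ _ _ (cst 1%E)) => //=.
  - by move=> n; apply: measurable_funTS; apply: measurable_EFin.
  - exact: finite_measure_integrable_cst.
  - move=> n x; rewrite in_itv/= => /andP[x0 _]; have /andP[g0 g1] := g01 n x0.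
    by rewrite lee_fin ger0_norm.
have c3 : (\int[m2]_(x in `[0%R, t[) (g n x)%:E + m2 `[t, +oo[%classic)%E @[n --> \oo] -->
    (0 + m2 `[t, +oo[%classic)%E.
  by apply: cvgeD => //; exact: cvg_cst.
rewrite -[leRHS]add0e; apply: (lee_cvg_to c1 c3); apply: nearW => n.
apply: (@le_trans _ _ (\int[m1]_(x in D0) (g n x)%:E)%E).
  apply: ge0_subset_integral => //.
  - by apply: measurable_funTS; apply: measurable_EFin.
  - by move=> x /D0P x0; have /andP[] := g01 n x0.
rewrite Eg.
have DE : D0 = `[0%R, t[%classic `|` `[t, +oo[%classic.
  by rewrite -itv_bndbnd_setU// bnd_simp// ltW.
rewrite {1}DE ge0_integral_setU//; last 3 first.
- by apply: measurable_funTS; apply: measurable_EFin.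
- by rewrite -DE => x /D0P x0; have /andP[] := g01 n x0.
- apply/disj_setPS => x [] /=; rewrite !in_itv/= andbT => /andP[_ xt] tx.
  by move: xt; rewrite ltNge tx.
rewrite leeD2l//.
apply: (@le_trans _ _ (\int[m2]_(x in `[t, +oo[) (cst 1 x))%E).
  apply: ge0_le_integral => //.
  - move=> x /=; rewrite in_itv/= andbT => tx.
    by have /andP[] := @g01 n x (le_trans (ltW t0) tx).
  - by apply: measurable_funTS; apply: measurable_EFin.
  - move=> x /=; rewrite in_itv/= andbT => tx.
    by have /andP[] := @g01 n x (le_trans (ltW t0) tx).
by rewrite integral_cst// mul1e.
Qed.

End one_sided.

Lemma laplace_unique (m1 m2 : probability R R) :
  m1 `]-oo, 0%R[%classic = 0%E -> m2 `]-oo, 0%R[%classic = 0%E ->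
  (forall u : R, 0 < u -> (\int[m1]_(x in D0) (expR (- (u * x)))%:E =
    \int[m2]_(x in D0) (expR (- (u * x)))%:E)%E) ->
  forall A, measurable A -> m1 A = m2 A.
Proof.
have side (m m' : probability R R) : m `]-oo, 0%R[%classic = 0%E -> m' `]-oo, 0%R[%classic = 0%E ->
    (forall u : R, 0 < u -> (\int[m]_(x in D0) (expR (- (u * x)))%:E =
    \int[m']_(x in D0) (expR (- (u * x)))%:E)%E) ->
    forall y : R, (m' `]-oo, y[%classic <= m `]-oo, y]%classic)%E.
  move=> m0 m'0 mm' y; have [y0|y0] := leP y 0.
    apply: (@le_trans _ _ (m' `]-oo, 0%R[%classic)); last by rewrite m'0.
    apply: le_measure; rewrite ?inE// => x /=; rewrite !in_itv/= => /lt_le_trans.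
    exact.
  have := laplace_one_sided y0 m0 m'0 mm'.
  rewrite -setCitvl -[X in m' X]setCitvl !probability_setC//.
  rewrite -(fineK (fin_num_measure m _ (measurable_itv `]-oo, y]))).
  rewrite -(fineK (fin_num_measure m' _ (measurable_itv `]-oo, y[))).
  by rewrite -!EFinB !lee_fin; lra.
move=> m10 m20 m12; apply: probability_eq_sandwich => y; last exact: side.
by apply: side => // u u0; rewrite m12.
Qed.

End laplace_uniqueness.

(** * Stable subordinators and their inverses *)

Lemma measurable_normX {R : realType} q :
  measurable_fun [set: R] (fun x : R => (`|x| ^+ q)%:E).
Proof. by apply: measurable_EFin; apply: measurable_funX; exact: normr_measurable. Qed.

Section random_variables.
Context d (T : measurableType d) {R : realType} (P : probability T R).
Local Notation D0 := (`[0%R, +oo[%classic : set R).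

Definition rv_of d' (T' : measurableType d') (f : T -> T') (mf : measurable_fun [set: T] f) :
    {RV P >-> T'} :=
  mfun_Sub (mem_set mf : f \in mfun).

Lemma ae_le_measure (A B : set T) : measurable A -> measurable B ->
  {ae P, forall w, A w -> B w} -> (P A <= P B)%E.
Proof.
move=> mA mB [N [mN N0 AB]].
apply: (@le_trans _ _ (P (B `|` N))).
  apply: le_measure; rewrite ?inE//; first exact: measurableU.
  move=> w Aw; have [Bw|nBw] := pselect (B w); first by left.
  by right; apply: AB => /= h; apply: nBw; exact: h.
by apply: (le_trans (measureU2 _ mB mN)); rewrite [X in (_ + X)%E](_ : _ = 0%E) ?adde0//.
Qed.

Lemma ae_eq_measure (A B : set T) : measurable A -> measurable B ->
  {ae P, forall w, A w <-> B w} -> P A = P B.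
Proof.
move=> mA mB AB; apply/eqP; rewrite eq_le.
by rewrite !ae_le_measure//; apply: filterS AB => w [].
Qed.

Lemma measurable_ge_set (f : T -> R) (x : R) : measurable_fun [set: T] f ->
  measurable [set w | x <= f w].
Proof.
move=> mf; rewrite (_ : [set w | _] = f @^-1` `[x, +oo[%classic).
  by rewrite -[X in measurable X]setTI; exact: mf.
by apply/seteqP; split => w /=; rewrite in_itv/= andbT.
Qed.

Lemma measurable_le_set (f : T -> R) (x : R) : measurable_fun [set: T] f ->
  measurable [set w | f w <= x].
Proof.
move=> mf; rewrite (_ : [set w | _] = f @^-1` `]-oo, x]%classic).
  by rewrite -[X in measurable X]setTI; exact: mf.
by apply/seteqP; split => w /=; rewrite in_itv/=.
Qed.

Lemma measurable_lt_set (f : T -> R) (x : R) : measurable_fun [set: T] f ->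
  measurable [set w | f w < x].
Proof.
move=> mf; rewrite (_ : [set w | _] = f @^-1` `]-oo, x[%classic).
  by rewrite -[X in measurable X]setTI; exact: mf.
by apply/seteqP; split => w /=; rewrite in_itv/=.
Qed.

Lemma distribution_neg (X : {RV P >-> R}) : {ae P, forall w, 0 <= X w} ->
  distribution P X `]-oo, 0%R[%classic = 0%E.
Proof.
move=> X0; apply/eqP; rewrite -measure_le0.
rewrite -(measure0 P); apply: ae_le_measure => //.
  by rewrite -[X in measurable X]setTI; exact: (measurable_funPT X).
by apply: filterS X0 => w X0 /=; rewrite in_itv/= ltNge X0.
Qed.

Lemma integral_distribution_D0 (X : {RV P >-> R}) (f : R -> \bar R) :
  {ae P, forall w, 0 <= X w} -> measurable_fun [set: R] f -> (forall x, 0 <= f x)%E ->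
  (\int[distribution P X]_(x in D0) f x = \int[P]_w f (X w))%E.
Proof.
move=> X0 mf f0.
have mX := measurable_funPT X.
have mXD : measurable (X @^-1` D0) by rewrite -[X in measurable X]setTI; exact: mX.
rewrite ge0_integral_pushforward//; last exact: measurable_funTS.
rewrite [LHS]integral_mkcond; apply: ge0_ae_eq_integral => //.
- apply/(measurable_restrictT _ mXD) => //; apply: measurable_funTS.
  exact: measurableT_comp.
- exact: measurableT_comp.
- by move=> w _; apply: erestrict_ge0 => v _; exact: f0.
- by apply: filterS X0 => w Xw _; rewrite patchE mem_set//= in_itv/= andbT.
Qed.

Lemma probability_eq0_expR (A : set T) (C : R) : measurable A -> 0 < C ->
  (forall y : R, 0 < y -> (P A <= (C * expR (- y))%:E)%E) -> P A = 0%E.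
Proof.
move=> mA C0; rewrite -(fineK (fin_num_measure P _ mA)).
have : 0 <= fine (P A) by rewrite fine_ge0.
(* If p > 0, the bound at [y = C / p] reads [e^(C / p) <= C / p], against [1 + x <= e^x]. *)
set p := fine _; rewrite le_eqVlt => /predU1P[<-//|p0] /(_ _ (divr_gt0 C0 p0)).
rewrite lee_fin expRN ler_pdivlMr ?expR_gt0// mulrC -ler_pdivlMr// => h.
by have := le_trans (expR_ge1Dx (C / p)) h; rewrite gerDr ler10.
Qed.

Lemma exp_markov (X : {RV P >-> R}) (c u : R) (L : R) : 0 <= u ->
  (\int[P]_w (expR (- (u * X w)))%:E = L%:E)%E ->
  (P [set w | (X w <= c)%R] <= (expR (u * c) * L)%:E)%E.
Proof.
move=> u0 XL.
have mX := measurable_funPT X.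
have mA : measurable [set w | X w <= c] by exact: measurable_le_set.
rewrite EFinM -XL -ge0_integralZl//=; last first.
  apply: measurable_EFin; apply: (measurableT_comp (@measurable_expR R)).
  by apply: (measurableT_comp (@oppr_measurable R _)); apply: measurable_funM.
rewrite -[X in (P X <= _)%E]setIT -integral_indic//.
apply: ge0_le_integral => //=.
- by apply: measurable_EFin; exact: measurable_indic.
- apply: measurable_EFin; apply: measurable_funM => //; apply: (measurableT_comp (@measurable_expR R)).
  by apply: (measurableT_comp (@oppr_measurable R _)); apply: measurable_funM.
move=> w _; rewrite -EFinM -expRD lee_fin indicE; case: (boolP (w \in _)) => [|_]/=.
  by rewrite inE/= => h; rewrite -expR0 ler_expR -mulrBr mulr_ge0// subr_ge0.
exact: expR_ge0.
Qed.

End random_variables.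

Section rv_laplace.
Context d (T : measurableType d) d' (T' : measurableType d') {R : realType}.
Variables (P : probability T R) (P' : probability T' R).

Lemma rv_laplace_unique (X : {RV P >-> R}) (Y : {RV P' >-> R}) :
  {ae P, forall w, 0 <= X w} -> {ae P', forall w, 0 <= Y w} ->
  (forall u : R, 0 < u -> (\int[P]_w (expR (- (u * X w)))%:E =
     \int[P']_w (expR (- (u * Y w)))%:E)%E) ->
  forall A : set R, measurable A -> P (X @^-1` A) = P' (Y @^-1` A).
Proof.
move=> X0 Y0 XY A mA.
apply: (@laplace_unique R (distribution P X) (distribution P' Y)) => //;
  try exact: distribution_neg.
move=> u u0; rewrite !integral_distribution_D0//; [exact: XY| |]; by meas.
Qed.

End rv_laplace.

Section stable_subordinators.
Context d (T : measurableType d) {R : realType} (P : probability T R).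
Variables (a : R) (H : R -> {RV P >-> R}).
Hypotheses (a01 : 0 < a < 1) (stableH : stable_subordinator a H).

Let a0 : 0 < a. Proof. by case/andP: a01. Qed.

Let mH x : measurable_fun [set: T] (H x). Proof. exact: measurable_funPT. Qed.

Let mexpH (u x : R) : measurable_fun [set: T] (fun w => (expR (- (u * H x w)))%:E).
Proof.
apply: measurable_EFin; apply: (measurableT_comp (@measurable_expR R)).
by apply: (measurableT_comp (@oppr_measurable R _)); apply: measurable_funM.
Qed.

Let mHp (x p : R) : measurable_fun [set: T] (fun w => H x w `^ p).
Proof. exact: (measurableT_comp (measurable_powR p) (mH x)). Qed.

Lemma stable_ge0 x : 0 <= x -> {ae P, forall w, 0 <= H x w}.
Proof.
move=> x0; have H0 := levy_start (stable_levy stableH).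
have := stable_nondecreasing stableH; apply: filterS2 H0 => w H0w Hw.
by rewrite -H0w; exact: Hw.
Qed.

Lemma stable_laplaceE (u x : R) : 0 < u -> 0 <= x ->
  (\int[P]_w (expR (- (u * H x w)))%:E = (expR (- (x * u `^ a)))%:E)%E.
Proof.
by move=> u0 x0; rewrite -(stable_laplace stableH u0 x0) unlock.
Qed.

(** Self-similarity: [H x] and [x ^ (1 / a) * H 1] both have the Laplace transform
    [exp (- x u^a)]. *)
Lemma stable_scaling (x t : R) : 0 < x ->
  P [set w | t <= H x w] = P [set w | t <= x `^ a^-1 * H 1 w].
Proof.
move=> x0.
have mY : measurable_fun [set: T] (fun w => x `^ a^-1 * H 1 w) by apply: measurable_funM.
pose Y : {RV P >-> R} := rv_of P mY.
have := @rv_laplace_unique _ _ _ _ _ P P (H x) Y (stable_ge0 (ltW x0)) _ _ `[t, +oo[%classic.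
rewrite (_ : H x @^-1` _ = [set w | t <= H x w]); last first.
  by apply/seteqP; split => w /=; rewrite in_itv/= andbT.
rewrite (_ : Y @^-1` _ = [set w | t <= x `^ a^-1 * H 1 w]); last first.
  by apply/seteqP; split => w /=; rewrite in_itv/= andbT.
have Y0 : {ae P, forall w, 0 <= Y w}.
  by apply: filterS (stable_ge0 ler01) => w h; rewrite mulr_ge0 ?powR_ge0.
apply; [exact: Y0| |exact: measurable_itv] => u u0.
have ux0 : 0 < u * x `^ a^-1 by rewrite mulr_gt0 ?powR_gt0.
have E : (u * x `^ a^-1) `^ a = x * u `^ a.
  rewrite powRM ?powR_ge0 ?(ltW u0)// -powRrM mulVf ?gt_eqF//.
  by rewrite (powRr1 (ltW x0)) mulrC.
rewrite (stable_laplaceE u0 (ltW x0)) -E -[X in expR (- X)]mul1r.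
rewrite -(stable_laplaceE ux0 ler01); apply: eq_integral => w _.
by rewrite mulrA.
Qed.

Lemma stable_gt0 : {ae P, forall w, 0 < H 1 w}.
Proof.
have mA : measurable [set w | H 1 w <= 0] by exact: measurable_le_set.
suff A0 : P [set w | (H 1 w <= 0)%R] = 0%E.
  by exists [set w | H 1 w <= 0]; split => // w /= /negP; rewrite -leNgt.
apply: (@probability_eq0_expR _ _ _ _ _ 1) => // y y0.
(* At [u = y ^ (1 / a)] the Laplace transform of [H 1] is [e^(-y)], and the exponential Markov bound
   at level 0 has no other factor. *)
have ya : 0 < y `^ a^-1 by rewrite powR_gt0.
have := exp_markov 0 (ltW ya) (stable_laplaceE ya ler01).
by rewrite mulr0 expR0 !mul1r -powRrM mulVf ?gt_eqF// powRr1 ?(ltW y0).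
Qed.

(** This makes the set that defines the inverse almost surely nonempty; on the empty set the infimum
    would take its default value 0. *)
Lemma stable_unbounded (t : R) : {ae P, forall w, exists n : nat, t <= H n%:R w}.
Proof.
pose A := \bigcap_n [set w | H n%:R w < t].
have mA : measurable A.
  by apply: bigcapT_measurable => n; exact: measurable_lt_set.
suff A0 : P A = 0%E.
  exists A; split => // w /= nE n _ /=; rewrite ltNge; apply/negP => h.
  by apply: nE; exists n.
apply: (@probability_eq0_expR _ _ _ _ _ (expR t)) => //; first exact: expR_gt0.
move=> y y0; pose n := (Num.truncn y).+1.
apply: (@le_trans _ _ (P [set w | (H n%:R w <= t)%R])).
  apply: le_measure; rewrite ?inE//; first exact: measurable_le_set.
  by move=> w /(_ n I) /ltW.
apply: le_trans (exp_markov t ler01 (stable_laplaceE ltr01 (ler0n R n))) _.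
rewrite lee_fin mul1r powR1 mulr1 ler_wpM2l ?expR_ge0// ler_expR lerN2 ltW//.
exact: truncnS_gt.
Qed.

Section inverse.
Variables (L : R -> {RV P >-> R}) (t : R).
Hypotheses (t0 : 0 < t)
  (LH : {ae P, forall w, L t w = inf [set x | 0 <= x /\ t <= H x w]}).

Let lb0 w : has_lbound [set x | 0 <= x /\ t <= H x w].
Proof. by exists 0 => x []. Qed.

Lemma inverse_ge0 : {ae P, forall w, 0 <= L t w}.
Proof.
apply: filterS LH => w ->.
have [->|/set0P[x Sx]] := eqVneq [set x | 0 <= x /\ t <= H x w] set0; first by rewrite inf0.
by apply: lb_le_inf; [exists x|move=> y []].
Qed.

Lemma inverse_le (x : R) : 0 <= x ->
  (P [set w | (t <= H x w)%R] <= P [set w | (L t w <= x)%R])%E.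
Proof.
move=> x0; apply: ae_le_measure; [exact: measurable_ge_set|exact: measurable_le_set|].
by apply: filterS LH => w /= -> tH; apply: ge_inf.
Qed.

(** The infimum need not be attained, hence the strict inequality: some y < x then lies in the set,
    and the monotone path carries [t <= H y w] to x. *)
Lemma inverse_ge (x : R) : 0 < x ->
  (P [set w | (L t w < x)%R] <= P [set w | (t <= H x w)%R])%E.
Proof.
move=> x0; apply: ae_le_measure; [exact: measurable_lt_set|exact: measurable_ge_set|].
have := stable_nondecreasing stableH.
apply: filterS3 LH (stable_unbounded t) => w /= -> [n tn] mono; set S := [set x | _] => Sx.
have hS : has_inf S by split; [exists n%:R; split|exact: lb0].
have e0 : 0 < x - inf S by rewrite subr_gt0.
have [y [y0 ty]] := inf_adherent e0 hS.
rewrite addrC subrK => yx; apply: (le_trans ty); apply: mono => //; exact: ltW.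
Qed.

Lemma measurable_inverse_stable :
  measurable_fun [set: T] (fun w => t `^ a * H 1 w `^ (- a)).
Proof. by apply: measurable_funM => //; exact: mHp. Qed.

(** The probability of [t <= H x] lies between those of [L t < x] and [L t <= x], and by
    self-similarity it equals that of [Y <= x]. This is the sandwich on half-lines. *)
Lemma inverse_law (A : set R) : measurable A ->
  P (L t @^-1` A) = P ((fun w => t `^ a * H 1 w `^ (- a)) @^-1` A).
Proof.
move=> mA; pose Y : {RV P >-> R} := rv_of P measurable_inverse_stable.
have YE (x : R) : 0 < x -> P [set w | Y w <= x] = P [set w | t <= H x w].
  move=> x0; rewrite stable_scaling//; apply: ae_eq_measure.
  - exact: measurable_le_set.
  - by apply: measurable_ge_set; apply: measurable_funM.
  apply: filterS stable_gt0 => w H0 /=; rewrite powRN ler_pdivrMr ?powR_gt0//.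
  have xa : x = (x `^ a^-1) `^ a by rewrite -powRrM mulVf ?gt_eqF// powRr1 ?ltW.
  rewrite {1}xa -powRM ?powR_ge0 ?(ltW H0)//; split => h.
    rewrite leNgt; apply/negP => /(gt0_ltr_powR a0) h2; move: h; apply/negP; rewrite -ltNge.
    by apply: h2; rewrite ?nnegrE ?mulr_ge0 ?powR_ge0 ?(ltW H0) ?(ltW t0).
  by rewrite ge0_ler_powR ?nnegrE ?mulr_ge0 ?powR_ge0 ?(ltW H0) ?(ltW t0) ?(ltW a0).
have L0 := distribution_neg inverse_ge0.
have Y0 : distribution P Y `]-oo, 0%R[%classic = 0%E.
  by apply: distribution_neg; apply: aeW => w; rewrite mulr_ge0 ?powR_ge0.
have dlt (X : {RV P >-> R}) y : distribution P X `]-oo, y[%classic = P [set w | X w < y].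
  by congr (P _); apply/seteqP; split => w /=; rewrite in_itv.
have dle (X : {RV P >-> R}) y : distribution P X `]-oo, y]%classic = P [set w | X w <= y].
  by congr (P _); apply/seteqP; split => w /=; rewrite in_itv.
have neg (X : {RV P >-> R}) y : distribution P X `]-oo, 0%R[%classic = 0%E -> y <= 0 ->
    distribution P X `]-oo, y[%classic = 0%E.
  move=> X0 y0; apply/eqP; rewrite -measure_le0 -X0; apply: le_measure; rewrite ?inE//.
  by move=> z /=; rewrite !in_itv/= => /lt_le_trans; exact.
have LY (y : R) : (P [set w | (L t w < y)%R] <= P [set w | (Y w <= y)%R])%E.
  have [y0|y0] := leP y 0; first by rewrite -dlt neg.
  by rewrite YE// inverse_ge.
have YL (y : R) : (P [set w | (Y w < y)%R] <= P [set w | (L t w <= y)%R])%E.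
  have [y0|y0] := leP y 0; first by rewrite -dlt neg.
  apply: le_trans (inverse_le (ltW y0)); rewrite -YE//.
  apply: le_measure; rewrite ?inE; [exact: measurable_lt_set|exact: measurable_le_set|].
  by move=> w /= /ltW.
apply: (@probability_eq_sandwich R (distribution P (L t)) (distribution P Y)) => // y.
Qed.

End inverse.

(** Integrate [u ^ (a p - 1) * e^(-u H)] over u and over the sample space. One order gives the
    negative moment times a Gamma integral, the other the stretched exponential integral. As an
    identity of extended reals it also yields the finiteness of the moment. *)
Lemma stable_negative_moment (p : R) : 0 < p ->
  ((a * p)%:E * (\int[P]_w (H 1 w `^ (- (a * p)))%:E) * gamma_integral (a * p) =
   gamma_integral (p + 1))%E.
Proof.
move=> p0; have ap0 := mulr_gt0 a0 p0.
pose K (z : T * R) : \bar R := (if (0 < z.2) then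
  z.2 `^ (a * p - 1) * expR (- (z.2 * H 1 z.1)) else 0)%:E.
have mK : measurable_fun setT K.
  apply: measurable_EFin; apply: measurable_fun_ifT; [by meas| |by meas].
  apply: measurable_funM; first by meas.
  apply: (measurableT_comp (@measurable_expR R)).
  apply: (measurableT_comp (@oppr_measurable R _)); apply: measurable_funM; first by meas.
  exact: measurableT_comp.
have K0 z : (0 <= K z)%E.
  by rewrite lee_fin; case: ifP => // _; rewrite mulr_ge0 ?powR_ge0 ?expR_ge0.
have E1 : (\int[P]_w (H 1 w `^ (- (a * p)))%:E * gamma_integral (a * p) =
    \int[P]_w \int[@lebesgue_measure R]_u K (w, u))%E.
  rewrite -ge0_integralZr//=; last 3 first.
  - by apply: measurable_EFin; exact: mHp.
  - by move=> w _; rewrite lee_fin powR_ge0.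
  - exact: gamma_integral_ge0.
  apply: ge0_ae_eq_integral => //.
  - apply: emeasurable_funM => //; apply: measurable_EFin; exact: mHp.
  - exact (@measurable_fun_fubini_tonelli_F _ _ _ _ _ (@lebesgue_measure R) K mK K0).
  - by move=> w _; rewrite mule_ge0 ?lee_fin ?powR_ge0 ?gamma_integral_ge0.
  - by move=> w _; apply: integral_ge0.
  apply: filterS stable_gt0 => w H0 _.
  rewrite -gamma_integral_scale// integral_gt0E; apply: eq_integral => u _.
  by rewrite /K/=; case: ifP.
rewrite -muleA E1 fubini_tonelli//.
rewrite -ge0_integralZl//=; last 3 first.
- exact (@measurable_fun_fubini_tonelli_G _ _ _ _ _ P K mK K0).
- by move=> w _; apply: integral_ge0.
- by rewrite lee_fin ltW.
rewrite -(integral_stretched_expR a0 p0) integral_gt0E; apply: eq_integral => u _.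
case: ifPn => u0; last by rewrite integral0_eq ?mule0// => w _; rewrite /K/= (negbTE u0).
rewrite /K/= u0; under eq_integral do rewrite EFinM.
rewrite ge0_integralZl//=; last by rewrite lee_fin powR_ge0.
by rewrite stable_laplaceE// mul1r -!EFinM mulrA.
Qed.

Local Notation D0 := (`[0%R, +oo[%classic : set R).

Lemma inverse_stable_moment (L : R -> {RV P >-> R}) (t : R) (q : nat) : 0 < t ->
  {ae P, forall w, L t w = inf [set x | 0 <= x /\ t <= H x w]} ->
  (\int[distribution P (L t)]_(x in (`[0%R, +oo[%classic : set R)) (x ^+ q)%:E =
   ((t `^ a) ^+ q * q`!%:R / Gamma (a * q%:R + 1))%:E)%E.
Proof.
move=> t0 LH.
pose Y : {RV P >-> R} := rv_of P (measurable_inverse_stable t).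
transitivity (\int[distribution P Y]_(x in D0) (x ^+ q)%:E)%E.
  by apply: eq_measure_integral => A mA _; exact: (inverse_law t0 LH mA).
have -> : (\int[distribution P Y]_(x in D0) (x ^+ q)%:E =
    \int[distribution P Y]_(x in D0) (`|x| ^+ q)%:E)%E.
  by apply: eq_integral => x; rewrite inE/= in_itv/= andbT => x0; rewrite ger0_norm.
rewrite (@integral_distribution_D0 _ _ _ _ Y (fun x => (`|x| ^+ q)%:E)); last 3 first.
- by apply: aeW => w; rewrite mulr_ge0 ?powR_ge0.
- exact: measurable_normX.
- by move=> x; rewrite lee_fin exprn_ge0.
transitivity (\int[P]_w (((t `^ a) ^+ q)%:E * (H 1 w `^ (- (a * q%:R)))%:E))%E.
  apply: eq_integral => w _; rewrite -EFinM; congr EFin.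
  rewrite ger0_norm ?mulr_ge0 ?powR_ge0// exprMn; congr (_ * _).
  by rewrite -powR_mulrn ?powR_ge0// -powRrM mulNr.
rewrite ge0_integralZl//=; last 3 first.
- by apply: measurable_EFin; exact: mHp.
- by move=> w _; rewrite lee_fin powR_ge0.
- by rewrite lee_fin exprn_ge0 ?powR_ge0.
rewrite -mulrA EFinM; congr (_ * _)%E.
(* The formula for negative moments requires a positive exponent; q = 0 is the total mass. *)
case: q => [|q].
  under eq_integral do rewrite mulr0 oppr0 powRr0.
  have -> : Gamma (a * 0 + 1) = 1 :> R by rewrite mulr0; exact: (@Gamma_nat R 0).
  transitivity (\int[P]_w (cst 1 w))%E; first by [].
  rewrite integral_cst// divr1 [X in (_ * X)%E](_ : _ = 1%E) ?mule1//.
  exact: probability_setT.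
have aq0 : 0 < a * q.+1%:R by rewrite mulr_gt0.
have := @stable_negative_moment q.+1%:R (ltr0Sn R q).
rewrite natr1 gamma_integral_nat -(GammaE aq0) (GammaS aq0).
have := Gamma_gt0 aq0; set G := Gamma _ => G0.
case: (\int[P]_w _)%E => [r||].
- rewrite -!EFinM => -[<-]; congr EFin; field.
  by rewrite !gt_eqF.
- by rewrite gt0_muley ?lte_fin// gt0_mulye ?lte_fin.
- by rewrite gt0_muleNy ?lte_fin// gt0_mulNye ?lte_fin.
Qed.

End stable_subordinators.

Section inverse_stable.
Context d (T : measurableType d) {R : realType} (P : probability T R).
Local Notation D0 := (`[0%R, +oo[%classic : set R).

Lemma inverse_stable_law (a : R) (L : R -> {RV P >-> R}) (t : R) :
  0 < a <= 1 -> inverse_stable_subordinator a L -> 0 <= t ->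
  distribution P (L t) `]-oo, 0%R[%classic = 0%E /\
  forall q, (\int[distribution P (L t)]_(x in D0) (x ^+ q)%:E =
    ((t `^ a) ^+ q * q`!%:R / Gamma (a * q%:R + 1))%:E)%E.
Proof.
move=> a01 invL t0.
(* Both degenerate cases are deterministic: for t = 0 the set under the infimum contains 0 because
   [H 0 = 0] almost surely. *)
have det : (t == 0) || (a == 1) -> {ae P, forall w, L t w = t}.
  move=> ta; move: invL; rewrite /inverse_stable_subordinator.
  case: ifPn => [_|a1]; first exact.
  move=> [H sH] LH; rewrite (negbTE a1) orbF in ta; move: (LH t t0).
  rewrite (eqP ta); apply: filterS2 (levy_start (stable_levy sH)) => w H0 ->.
  apply/eqP; rewrite eq_le; apply/andP; split.
    by apply: ge_inf; [exists 0 => x []|rewrite /= H0].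
  by apply: lb_le_inf; [exists 0; rewrite /= H0|move=> x []].
have [ta|] := boolP ((t == 0) || (a == 1)).
  have Lt := det ta.
  have L0 : {ae P, forall w, 0 <= L t w} by apply: filterS Lt => w ->.
  split=> [|q]; first exact: distribution_neg.
  have -> : (\int[distribution P (L t)]_(x in D0) (x ^+ q)%:E =
      \int[distribution P (L t)]_(x in D0) (`|x| ^+ q)%:E)%E.
    by apply: eq_integral => x; rewrite inE/= in_itv/= andbT => x0; rewrite ger0_norm.
  rewrite (@integral_distribution_D0 _ _ _ _ (L t) (fun x => (`|x| ^+ q)%:E))//; last first.
    exact: measurable_normX.
  transitivity (\int[P]_w (cst (t ^+ q)%:E w))%E.
    apply: ge0_ae_eq_integral => //.
    - apply: measurable_EFin; apply: measurable_funX; exact: measurableT_comp.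
    - by move=> w _; rewrite lee_fin exprn_ge0.
    - by apply: filterS Lt => w -> _; rewrite ger0_norm.
  rewrite integral_cst// [X in (_ * X)%E](_ : _ = 1%E) ?mule1; last exact: probability_setT.
  congr EFin.
  case/orP: ta => /eqP ->.
    rewrite powR0 ?gt_eqF//; last by case/andP: a01.
    case: q => [|q]; last by rewrite !expr0n/= !mul0r.
    have G1 : Gamma (0 + 1) = 1 :> R by exact: (@Gamma_nat R 0).
    by rewrite !expr0 mulr0 G1 divr1 mul1r.
  by rewrite powRr1// mul1r Gamma_nat -mulrA mulfV ?mulr1// natr_fact_neq0.
rewrite negb_or => /andP[tn0 a1].
have {}t0 : 0 < t by rewrite lt_neqAle eq_sym tn0.
have {}a01 : 0 < a < 1.
  by case/andP: a01 => -> /=; rewrite le_eqVlt (negbTE a1).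
move: invL; rewrite /inverse_stable_subordinator (negbTE a1) => -[H sH] LH.
split=> [|q]; last exact: (inverse_stable_moment a01 sH q t0 (LH t (ltW t0))).
exact: distribution_neg (inverse_ge0 (LH t (ltW t0))).
Qed.

End inverse_stable.

(** * Mittag-Leffler moments and the Wright series *)

Section moment_growth.
Context {R : realType}.

(** The factorial divides each ratio by [r + 1], which beats a growth of the ratios of B of order
    [theta < 1]. *)
Lemma growth_cvgn (B : nat -> R) (K theta : R) (N : nat) (x : R) :
  0 <= K -> 0 <= theta < 1 -> (forall q, 0 <= B q) ->
  (forall q, B q.+1 <= K * q.+2%:R `^ theta * B q) ->
  cvgn (series (fun r => x ^+ r * B (N + r)%N / r`!%:R)).
Proof.
move=> K0 th B0 Bq; apply: (@ratio_cvgn _ _ (`|x| * K) theta N) => //.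
  by rewrite mulr_ge0.
move=> r; rewrite !normrM !normfV !normrX !normr_nat !(ger0_norm (B0 _)).
rewrite factS natrM addnS invfM exprS.
have -> : `|x| * `|x| ^+ r * B (N + r).+1 * (r.+1%:R^-1 * (r`!)%:R^-1) =
  B (N + r).+1 * (`|x| * `|x| ^+ r * r.+1%:R^-1 * (r`!)%:R^-1) by ring.
have -> : `|x| * K * (N + r).+2%:R `^ theta / r.+1%:R * (`|x| ^+ r * B (N + r)%N / (r`!)%:R) =
  (K * (N + r).+2%:R `^ theta * B (N + r)%N) * (`|x| * `|x| ^+ r * r.+1%:R^-1 * (r`!)%:R^-1) by ring.
by rewrite ler_wpM2r// !mulr_ge0 ?exprn_ge0 ?invr_ge0.
Qed.

(** The moments of the Mittag-Leffler law of index a, the law at time 1 of the inverse stable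
    subordinator; for a = 1 all of them are 1. *)
Definition ml_moment (a : R) (q : nat) : R := q`!%:R / Gamma (a * q%:R + 1).

Lemma ml_moment_ge0 a q : 0 < a -> 0 <= ml_moment a q.
Proof. by move=> a0; rewrite divr_ge0// ltW// Gamma_gt0// ltr_wpDl// mulr_ge0// ltW. Qed.

Lemma ml_momentS a q : 0 < a ->
  ml_moment a q.+1 = q`!%:R / (a * Gamma (a * q.+1%:R)).
Proof.
move=> a0; have aq : 0 < a * q.+1%:R by rewrite mulr_gt0.
have := Gamma_gt0 aq; rewrite /ml_moment (GammaS aq); set G := Gamma _ => G0.
rewrite factS natrM; field.
by rewrite !gt_eqF//= nat1r.
Qed.

(** The ratio of consecutive moments is [Gamma (a q + 1) / (a Gamma (a q + a))], bounded by
    [Gamma_growth] at [y = a q]. The exponent [1 - a] is below 1, so one law always has a convergent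
    moment series; for two laws the exponents add up to [2 - a - b], whence the condition
    [1 < a + b]. *)
Lemma ml_moment_growth a q : 0 < a <= 1 ->
  ml_moment a q.+1 <= a^-1 * q.+2%:R `^ (1 - a) * ml_moment a q.
Proof.
move=> a01; have /andP[a0 a1] := a01.
have aq : 0 <= a * q%:R by rewrite mulr_ge0// ltW.
rewrite ml_momentS// /ml_moment.
have -> : a * q.+1%:R = a * q%:R + a by rewrite -natr1; ring.
have G1 : 0 < Gamma (a * q%:R + 1) by rewrite Gamma_gt0// ltr_wpDl.
have G2 : 0 < Gamma (a * q%:R + a) by rewrite Gamma_gt0// ltr_wpDl.
have := Gamma_growth aq a01; set g1 := Gamma _ in G1 *; set g2 := Gamma _ in G2 * => h.
rewrite invfM mulrCA -mulrA ler_wpM2l ?invr_ge0 ?(ltW a0)// mulrCA ler_wpM2l//.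
rewrite ler_pdivlMr// mulrC ler_pdivrMr//; apply: (le_trans h); rewrite ler_wpM2r ?(ltW G2)//.
apply: ge0_ler_powR; rewrite ?subr_ge0 ?nnegrE ?ler0n//; first by rewrite addr_ge0// ltW.
have -> : q.+2%:R = q%:R + 2 :> R by rewrite -natrD addn2.
have q0 : 0 <= q%:R :> R by [].
have := ler_wpM2r q0 a1; lra.
Qed.

Lemma ml_moment_cvg a N (x : R) : 0 < a <= 1 ->
  cvgn (series (fun r => x ^+ r * ml_moment a (N + r)%N / r`!%:R)).
Proof.
move=> a01; have /andP[a0 a1] := a01; apply: (@growth_cvgn _ a^-1 (1 - a)).
- by rewrite invr_ge0 ltW.
- by rewrite subr_ge0 a1 ltrBlDr ltrDl.
- by move=> q; exact: ml_moment_ge0.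
- by move=> q; exact: ml_moment_growth.
Qed.

Lemma wright_termE (a b : R) N (x : R) r :
  wright_term (wright_top R N) (wright_bottom a b N) x r =
  x ^+ r * (ml_moment a (N + r)%N * ml_moment b (N + r)%N) / r`!%:R.
Proof.
rewrite /wright_term /wright_top /wright_bottom !big_cons !big_nil /=.
have E (c : R) : c * r%:R + (c * N%:R + 1) = c * (N + r)%:R + 1 by rewrite natrD; ring.
have -> : 1 * r%:R + (N%:R + 1) = (N + r)%:R + 1 :> R by rewrite natrD; ring.
rewrite !E Gamma_nat /ml_moment !mulr1 !invfM; ring.
Qed.

Lemma wright_cvg_gt1 (a b : R) N (x : R) : 0 < a <= 1 -> 0 < b <= 1 -> 1 < a + b ->
  wright_cvg (wright_top R N) (wright_bottom a b N) x.
Proof.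
move=> a01 b01 ab; have /andP[a0 a1] := a01; have /andP[b0 b1] := b01.
rewrite /wright_cvg (funext (wright_termE a b N x)).
apply: (@growth_cvgn (fun q => ml_moment a q * ml_moment b q) (a^-1 * b^-1) ((1 - a) + (1 - b))).
- by rewrite mulr_ge0 ?invr_ge0 ?ltW.
- by apply/andP; split; lra.
- by move=> q; rewrite mulr_ge0 ?ml_moment_ge0.
move=> q; rewrite powRD ?pnatr_eq0 ?implybT//.
have -> : a^-1 * b^-1 * (q.+2%:R `^ (1 - a) * q.+2%:R `^ (1 - b)) * (ml_moment a q * ml_moment b q) =
  (a^-1 * q.+2%:R `^ (1 - a) * ml_moment a q) * (b^-1 * q.+2%:R `^ (1 - b) * ml_moment b q) by ring.
by apply: ler_pM; rewrite ?ml_moment_ge0 ?ml_moment_growth.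
Qed.

End moment_growth.

Section laws.
Context {R : realType}.
Local Notation D0 := (`[0%R, +oo[%classic : set R).

Definition ml_law (a c : R) (m : probability R R) : Prop :=
  m `]-oo, 0%R[%classic = 0%E /\
  forall q, (\int[m]_(x in D0) (x ^+ q)%:E = (c ^+ q * ml_moment a q)%:E)%E.

Lemma null_negative_ge0 (m : probability R R) : m `]-oo, 0%R[%classic = 0%E ->
  {ae m, forall x, 0 <= x}.
Proof.
by move=> m0; exists `]-oo, 0%R[%classic; split=> // x /=; rewrite in_itv/= => /negP; rewrite -ltNge.
Qed.

Lemma ml_law_unique (a c : R) (m1 m2 : probability R R) : 0 < a <= 1 -> 0 <= c ->
  ml_law a c m1 -> ml_law a c m2 -> forall A, measurable A -> m1 A = m2 A.
Proof.
move=> a01 c0 [n1 M1] [n2 M2]; apply: laplace_unique => // u u0.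
have mid : measurable_fun D0 (fun x : R => x) by [].
have id0 (x : R) : D0 x -> 0 <= x by rewrite /= in_itv/= andbT.
have t0 : (u ^+ r * (c ^+ (0 + r) * ml_moment a (0 + r)%N) / r`!%:R) @[r --> \oo] --> (0 : R).
  have := cvg_series_cvg_0 (@ml_moment_cvg _ a 0 (u * c) a01); apply: cvg_trans.
  by apply: near_eq_cvg; apply: nearW => r; rewrite exprMn mulrA.
have int (m : probability R R) : m.-integrable D0 (EFin \o (fun x => expR (- (u * x)))).
  apply: (@prob_bounded_integrable _ _ _ _ _ _ 1) => //; first by meas.
  by move=> x /id0 x0; rewrite ger0_norm ?expR_ge0// expR_le1 oppr_le0 mulr_ge0// ltW.
have h1 := @cvg_moment_series _ _ R m1 D0 id _ 0 u (measurable_itv _) mid id0 M1 (ltW u0) t0.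
have h2 := @cvg_moment_series _ _ R m2 D0 id _ 0 u (measurable_itv _) mid id0 M2 (ltW u0) t0.
have h := cvg_unique (@Rhausdorff R) h1 h2.
have E (m : probability R R) : (\int[m]_(x in D0) (expR (- (u * x)))%:E =
    (\int[m]_(x in D0) (x ^+ 0 * expR (- (u * x))))%:E)%E.
  rewrite fineK; first by apply: eq_integral => x _; rewrite expr0 mul1r.
  rewrite (eq_integral (EFin \o (fun x => expR (- (u * x))))).
    exact: integrable_fin_num (int m).
  by move=> x _; rewrite expr0 mul1r.
rewrite !E; congr EFin; exact: h.
Qed.

Lemma ml_law_normX (a c : R) (m : probability R R) q : ml_law a c m ->
  (\int[m]_x (`|x| ^+ q)%:E = (c ^+ q * ml_moment a q)%:E)%E.
Proof.
move=> [m0 <-]; rewrite [RHS]integral_mkcond; apply: ge0_ae_eq_integral => //.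
- exact: measurable_normX.
- by apply/(measurable_restrictT _ (measurable_itv _)); apply: measurable_funTS; apply: measurable_EFin; apply: measurable_funX.
- by move=> x _; apply: erestrict_ge0 => v /=; rewrite in_itv/= andbT lee_fin => /exprn_ge0 ->.
- apply: filterS (null_negative_ge0 m0) => x x0 _.
  by rewrite patchE mem_set/= ?in_itv/= ?andbT// ger0_norm.
Qed.

(** Two laws with the same scaled moments coincide, so time becomes a factor in front of a variable
    with a fixed law. *)
Lemma ml_law_scale (a c : R) (m mu : probability R R) (g : R -> \bar R) :
  0 < a <= 1 -> 0 <= c -> ml_law a c m -> ml_law a 1 mu ->
  measurable_fun setT g -> (forall x, 0 <= g x)%E ->
  (\int[m]_x g x = \int[mu]_x g (c * `|x|)%R)%E.
Proof.
move=> a01 c0 mm mmu mg g0.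
have mf : measurable_fun [set: R] (fun x => c * `|x|).
  by apply: measurable_funM => //; exact: normr_measurable.
pose Y : {RV mu >-> R} := rv_of mu mf.
have Y0 : {ae mu, forall w, 0 <= Y w} by apply: aeW => x; rewrite mulr_ge0.
have lY : ml_law a c (distribution mu Y).
  split=> [|q]; first exact: distribution_neg.
  transitivity (\int[distribution mu Y]_(x in D0) (`|x| ^+ q)%:E)%E.
    by apply: eq_integral => x; rewrite inE/= in_itv/= andbT => x0; rewrite ger0_norm.
  rewrite (@integral_distribution_D0 _ _ _ _ Y (fun x => (`|x| ^+ q)%:E))//; last exact: measurable_normX.
  transitivity (\int[mu]_x ((c ^+ q)%:E * (`|x| ^+ q)%:E))%E.
    apply: eq_integral => x _; rewrite -EFinM; congr EFin.
    by rewrite /= normrM normr_id (ger0_norm c0) exprMn.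
  rewrite ge0_integralZl//=; last 2 first.
  - exact: measurable_normX.
  - by rewrite lee_fin exprn_ge0.
  by rewrite (ml_law_normX q mmu) expr1n mul1r.
transitivity (\int[distribution mu Y]_x g x)%E.
  by apply: eq_measure_integral => A mA _; exact: (ml_law_unique a01 c0 mm lY).
by rewrite ge0_integral_pushforward.
Qed.

End laws.

(** * Caputo derivatives of mixtures *)

Section caputo_kernel.
Context {R : realType}.
Local Notation mu := (@lebesgue_measure R).

(** Substituting [x = s v] in the Caputo integral of [x -> E[f(x^a Y)]] leaves this density:
    [a v^(a-1)] comes from the chain rule, the rest from the Caputo kernel. Extended by 0 so that
    integrals run over the whole line. *)
Definition caputo_kernel (a v : R) : R :=
  if 0 < v < 1 then a / Gamma (1 - a) * (v `^ (a - 1) * (1 - v) `^ (- a)) else 0.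

Lemma caputo_kernel_ge0 a v : 0 < a < 1 -> 0 <= caputo_kernel a v.
Proof.
move=> /andP[a0 a1]; rewrite /caputo_kernel; case: ifP => // _.
have G : 0 < Gamma (1 - a) by rewrite Gamma_gt0// subr_gt0.
by apply: mulr_ge0; [rewrite divr_ge0// ltW|rewrite mulr_ge0 ?powR_ge0].
Qed.

Lemma measurable_caputo_kernel a : measurable_fun [set: R] (caputo_kernel a).
Proof. by rewrite /caputo_kernel; meas. Qed.

(** The Beta integral with parameters [a (q + 1)] and [1 - a], whose sum is [a q + 1]. Multiplied by
    [ml_moment a q.+1] it gives back [ml_moment a q]. *)
Lemma caputo_kernel_moment a q : 0 < a < 1 ->
  (\int[mu]_v (caputo_kernel a v * (v `^ a) ^+ q)%:E =
   (a * Gamma (a * q.+1%:R) / Gamma (a * q%:R + 1))%:E)%E.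
Proof.
move=> a01; have /andP[a0 a1] := a01.
have b0 : 0 < 1 - a by rewrite subr_gt0.
have aq : 0 < a * q.+1%:R by rewrite mulr_gt0.
have aq1 : a * q.+1%:R + (1 - a) = a * q%:R + 1 by rewrite -natr1; ring.
have aq0 : 0 < a * q%:R + 1 by rewrite ltr_wpDl// mulr_ge0// ltW.
have c0 : 0 <= a / Gamma (1 - a) by rewrite divr_ge0 ?(ltW a0)// ltW// Gamma_gt0.
pose h (v : R) : R := v `^ (a * q.+1%:R - 1) * (1 - v) `^ ((1 - a) - 1).
transitivity ((a / Gamma (1 - a))%:E * \int[mu]_(v in `]0%R, 1%R[) (h v)%:E)%E.
  rewrite -ge0_integralZl//=; last 2 first.
  - by apply: measurable_funTS; apply: measurable_EFin; rewrite /h; meas.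
  - by move=> v _; rewrite lee_fin mulr_ge0 ?powR_ge0.
  rewrite [RHS]integral_mkcond; apply: eq_integral => v _.
  rewrite patchE; case: ifPn => [|] ; rewrite ?inE /caputo_kernel /h.
    rewrite /= in_itv/= => v01; rewrite v01; have /andP[v0 v1] := v01.
    rewrite -EFinM; congr EFin; rewrite -mulrA; congr (_ * _).
    rewrite mulrAC -[X in X * _](mulrC) -powR_mulrn ?powR_ge0// -powRrM -powRD ?(gt_eqF v0) ?implybT//.
    by congr (_ `^ _ * _ `^ _); rewrite -?natr1; ring.
  by rewrite notin_setE/= in_itv/= => /negP/negbTE ->; rewrite mul0r.
have := gamma_integral_beta (a * q.+1%:R) (1 - a).
rewrite aq1 -!GammaE//.
have := Gamma_gt0 aq; have := Gamma_gt0 aq0; have := Gamma_gt0 b0.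
set g1 := Gamma _; set g2 := Gamma _; set g3 := Gamma _ => g10 g20 g30.
rewrite -/(h _); case: (\int[mu]_(v in _) _)%E => [r||].
- rewrite -!EFinM => -[E]; congr EFin.
  have -> : g3 = g2 * r / g1 by rewrite -E mulfK ?gt_eqF.
  by field; rewrite !gt_eqF.
- by rewrite gt0_muley ?lte_fin.
- by rewrite gt0_muleNy ?lte_fin.
Qed.

Definition abs_ml_moments (a : R) (m : probability R R) : Prop :=
  forall q, (\int[m]_x (`|x| ^+ q)%:E = (ml_moment a q)%:E)%E.

Section transfer.
Variables (a : R) (m : probability R R).
Hypotheses (a01 : 0 < a <= 1) (mm : abs_ml_moments a m).
Variables (N : nat) (u c : R).
Hypotheses (u0 : 0 <= u) (c0 : 0 <= c).

Let e (z : R) := z ^+ N * expR (- (u * z)).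

Let u_moments_cvg0 :
  (u ^+ r * (c ^+ (N + r) * ml_moment a (N + r)%N) / r`!%:R) @[r --> \oo] --> (0 : R).
Proof.
have -> : (fun r => u ^+ r * (c ^+ (N + r) * ml_moment a (N + r)%N) / r`!%:R) =
    (fun r => c ^+ N * ((u * c) ^+ r * ml_moment a (N + r)%N / r`!%:R)).
  by apply/funext => r; rewrite exprD exprMn; ring.
rewrite -[X in _ --> X](mulr0 (c ^+ N)); apply: cvgM; first exact: cvg_cst.
exact: (cvg_series_cvg_0 (@ml_moment_cvg _ a N (u * c) a01)).
Qed.

Let moments_abs q : (\int[m]_y (1 * (c * `|y|) ^+ q)%:E = (c ^+ q * ml_moment a q)%:E)%E.
Proof.
rewrite EFinM -mm -ge0_integralZl//=.
- by apply: eq_integral => y _; rewrite mul1r exprMn EFinM.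
- exact: measurable_normX.
- by rewrite lee_fin exprn_ge0.
Qed.

Let mabs : measurable_fun [set: R] (fun y => c * `|y|).
Proof. by apply: measurable_funM => //; exact: normr_measurable. Qed.

Let abs0 y : [set: R] y -> 0 <= c * `|y|.
Proof. by move=> _; rewrite mulr_ge0. Qed.

(** Equal moments give equal moment series, hence equal integrals of the exponential monomial e. The
    measure space is arbitrary: it will be a product of Lebesgue measure with m, or m itself. *)
Let integral_e d (T : measurableType d) (m' : {measure set T -> \bar R}) (W X : T -> R) :
  measurable_fun setT W -> measurable_fun setT X ->
  (forall x, 0 <= W x) -> (forall x, 0 <= X x) ->
  (forall q, (\int[m']_x (W x * X x ^+ q)%:E = (c ^+ q * ml_moment a q)%:E)%E) ->
  (\int[m']_x (W x * e (X x))%:E = \int[m]_y (e (c * `|y|))%:E)%E.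
Proof.
move=> mW mX W0 X0 XM.
have h1 := @cvg_weighted_moment_series _ _ R m' setT W X _ measurableT mW mX
  (fun x _ => W0 x) (fun x _ => X0 x) XM N u u0 u_moments_cvg0.
have h2 := @cvg_weighted_moment_series _ _ R m setT (cst 1) _ _ measurableT
  (measurable_cst _) mabs (fun x _ => ler01) abs0 moments_abs N u u0 u_moments_cvg0.
have h := cvg_unique (@Rhausdorff R) h1 h2.
have i1 := @integrable_moment_exp _ _ R m' setT W X _ measurableT mW mX
  (fun x _ => W0 x) (fun x _ => X0 x) XM N u u0.
have i2 := @integrable_moment_exp _ _ R m setT (cst 1) _ _ measurableT
  (measurable_cst _) mabs (fun x _ => ler01) abs0 moments_abs N u u0.
have := congr1 EFin (h _); rewrite /Rintegral !fineK; last 2 first.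
- exact: integrable_fin_num i2.
- exact: integrable_fin_num i1.
move=> E; transitivity (\int[m']_x (W x * X x ^+ N * expR (- (u * X x)))%:E)%E.
  by apply: eq_integral => x _; rewrite /e mulrA.
by rewrite E; apply: eq_integral => x _; rewrite /e mul1r.
Qed.

(** On the product of Lebesgue measure and m take the weight [k(v) |y|] and the variable
    [c v^a |y|]: the moment of order q is [c^q * ml_moment a q.+1] times that of the kernel, which
    is the moment of [c |y|]. *)
Lemma caputo_kernel_transfer : a < 1 ->
  (\int[mu]_v \int[m]_y (caputo_kernel a v * `|y| * e (c * v `^ a * `|y|))%:E =
   \int[m]_y (e (c * `|y|))%:E)%E.
Proof.
move=> a1; have a01' : 0 < a < 1 by rewrite a1 andbT; case/andP: a01.
have a0 : 0 < a by case/andP: a01.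
pose W (z : R * R) := caputo_kernel a z.1 * `|z.2|.
pose X (z : R * R) := c * z.1 `^ a * `|z.2|.
have mk := measurable_caputo_kernel a.
have mW : measurable_fun setT W.
  apply: measurable_funM; first exact: measurableT_comp.
  exact: measurableT_comp (@normr_measurable R _) _.
have mX : measurable_fun setT X.
  apply: measurable_funM; last exact: measurableT_comp (@normr_measurable R _) _.
  by apply: measurable_funM => //; exact: (measurableT_comp (measurable_powR a)).
have W0 z : 0 <= W z by rewrite mulr_ge0 ?caputo_kernel_ge0.
have X0 z : 0 <= X z by rewrite !mulr_ge0 ?powR_ge0.
have me : measurable_fun [set: R] e by rewrite /e; meas.
rewrite -(@integral_e _ _ (mu \x m)%E W X)//.
  rewrite (@fubini_tonelli1 _ _ _ _ _ mu m (fun z => (W z * e (X z))%:E))//.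
    by apply: measurable_EFin; apply: measurable_funM => //; exact: measurableT_comp.
  by move=> z; rewrite lee_fin mulr_ge0// /e mulr_ge0 ?expR_ge0// exprn_ge0.
move=> q.
rewrite (@fubini_tonelli1 _ _ _ _ _ mu m (fun z => (W z * X z ^+ q)%:E)); last 2 first.
- by apply: measurable_EFin; apply: measurable_funM => //; exact: measurable_funX.
- by move=> z; rewrite lee_fin mulr_ge0// exprn_ge0.
transitivity (\int[mu]_v ((c ^+ q * ml_moment a q.+1)%:E *
    (caputo_kernel a v * (v `^ a) ^+ q)%:E))%E.
  apply: eq_integral => v _; rewrite /fubini_F.
  transitivity (\int[m]_y ((c ^+ q * (caputo_kernel a v * (v `^ a) ^+ q))%:E * (`|y| ^+ q.+1)%:E))%E.
    by apply: eq_integral => y _; rewrite -EFinM /W /X/= !exprMn exprS; congr EFin; ring.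
  rewrite ge0_integralZl//=; last 2 first.
  - exact: measurable_normX.
  - by rewrite lee_fin !mulr_ge0 ?exprn_ge0 ?powR_ge0 ?caputo_kernel_ge0.
  by rewrite mm -!EFinM; congr EFin; ring.
rewrite ge0_integralZl//=; last 3 first.
- by apply: measurable_EFin; apply: measurable_funM => //; apply: measurable_funX; exact: measurable_powR.
- by move=> v _; rewrite lee_fin mulr_ge0 ?exprn_ge0 ?powR_ge0 ?caputo_kernel_ge0.
- by rewrite lee_fin mulr_ge0 ?exprn_ge0 ?ml_moment_ge0.
rewrite caputo_kernel_moment// -EFinM; congr EFin; rewrite ml_momentS// /ml_moment.
have G1 : 0 < Gamma (a * q.+1%:R) by rewrite Gamma_gt0// mulr_gt0.
by move: G1; set g := Gamma _ => G1; field; rewrite !gt_eqF// Gamma_gt0// ltr_wpDl// mulr_ge0// ltW.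
Qed.

(** For a = 1 all moments of [|y|] are 1, so the extra weight [|y|] changes none of them. *)
Lemma abs_transfer1 : a = 1 ->
  (\int[m]_y (`|y| * e (c * `|y|))%:E = \int[m]_y (e (c * `|y|))%:E)%E.
Proof.
move=> a1; apply: (@integral_e _ _ m (fun y => `|y|) (fun y => c * `|y|)) => //.
- by move=> y; rewrite mulr_ge0.
move=> q; transitivity (\int[m]_y ((c ^+ q)%:E * (`|y| ^+ q.+1)%:E))%E.
  by apply: eq_integral => y _; rewrite -EFinM exprMn exprS; congr EFin; ring.
rewrite ge0_integralZl//=; last 2 first.
- exact: measurable_normX.
- by rewrite lee_fin exprn_ge0.
by rewrite mm /ml_moment a1 !mul1r !Gamma_nat !divff ?natr_fact_neq0.
Qed.

End transfer.
End caputo_kernel.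

(** * Polynomials times a decaying exponential *)

Section exponential_polynomials.
Context {R : realType}.

(** An inductive predicate, so that linear identities between integrals reduce to one monomial
    [z ^ N * e^(-L z)]. The rate L is an explicit parameter because L > 0 is what bounds these
    functions on the half-line. *)
Inductive expoly (L : R) : (R -> R) -> Prop :=
| expoly0 : expoly L (fun _ => 0)
| expoly_cons c N f : expoly L f ->
    expoly L (fun z => c * (z ^+ N * expR (- (L * z))) + f z).

Lemma expolyD L f g : expoly L f -> expoly L g -> expoly L (fun z => f z + g z).
Proof.
move=> Lf Lg; elim: Lf => [|c N h Lh IH].
  by rewrite (_ : (fun _ => _) = g)//; apply/funext => z; rewrite add0r.
have := expoly_cons c N IH; congr expoly; apply/funext => z; exact: addrA.
Qed.

Lemma expolyZ L f k : expoly L f -> expoly L (fun z => k * f z).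
Proof.
elim => [|c N h Lh IH].
  by rewrite (_ : (fun _ => _) = fun _ => 0); [exact: expoly0|apply/funext => z; rewrite mulr0].
by have := expoly_cons (k * c) N IH; congr expoly; apply/funext => z; ring.
Qed.

Lemma expolyX L f : expoly L f -> expoly L (fun z => z * f z).
Proof.
elim => [|c N h Lh IH].
  by rewrite (_ : (fun _ => _) = fun _ => 0); [exact: expoly0|apply/funext => z; rewrite mulr0].
by have := expoly_cons c N.+1 IH; congr expoly; apply/funext => z; rewrite exprS; ring.
Qed.

Lemma expoly_scale L f k : expoly L f -> expoly (L * k) (fun z => f (k * z)).
Proof.
elim => [|c N h Lh IH]; first exact: expoly0.
have := expoly_cons (c * k ^+ N) N IH; congr expoly; apply/funext => z.
by rewrite exprMn (mulrA L); ring.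
Qed.

Lemma expoly_sum L (I : Type) (r : seq I) (P : pred I) (f : I -> R -> R) :
  (forall i, P i -> expoly L (f i)) -> expoly L (fun z => \sum_(i <- r | P i) f i z).
Proof.
move=> Lf; elim: r => [|i r IH].
  by rewrite (_ : (fun _ => _) = fun _ => 0); [exact: expoly0|apply/funext => z; rewrite big_nil].
case: (boolP (P i)) => Pi.
  rewrite (_ : (fun _ => _) = fun z => f i z + \sum_(j <- r | P j) f j z).
    by apply: expolyD => //; exact: Lf.
  by apply/funext => z; rewrite big_cons Pi.
by move: IH; congr expoly; apply/funext => z; rewrite big_cons (negbTE Pi).
Qed.

Lemma measurable_expoly L f : expoly L f -> measurable_fun [set: R] f.
Proof.
elim => [|c N h _ IH]; first by [].
by apply: measurable_funD => //; meas.
Qed.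

Lemma exprn_expR_le N (y : R) : 0 <= y -> y ^+ N * expR (- y) <= N`!%:R.
Proof.
move=> y0; case: N => [|N]; first by rewrite expr0 mul1r expR_le1 oppr_le0.
rewrite expRN ler_pdivrMr ?expR_gt0// mulrC -ler_pdivrMr ?ltr0n ?fact_gt0//.
by apply: le_trans (expR_ge1Dxn N y0); rewrite lerDr.
Qed.

Lemma expoly_bounded L f : 0 < L -> expoly L f ->
  exists C, forall z, 0 <= z -> `|f z| <= C.
Proof.
move=> L0; elim => [|c N h _ [C hC]]; first by exists 0 => z _; rewrite normr0.
exists (`|c| * (N`!%:R / L ^+ N) + C) => z z0.
apply: (le_trans (ler_normD _ _)); apply: lerD; last exact: hC.
rewrite normrM ler_wpM2l// ger0_norm ?mulr_ge0 ?exprn_ge0 ?expR_ge0//.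
rewrite ler_pdivlMr ?exprn_gt0// mulrAC -exprMn (mulrC z).
by rewrite exprn_expR_le// mulr_ge0// ltW.
Qed.

End exponential_polynomials.

Section transfer.
Context d (S : measurableType d) {R : realType} (m : probability S R).
Local Notation mu := (@lebesgue_measure R).
Variables (a : R) (W1 W2 X : S -> R).
Hypotheses (a01 : 0 < a <= 1)
  (mX : measurable_fun [set: S] X) (X0 : forall w, 0 <= X w)
  (W10 : forall w, 0 <= W1 w) (W20 : forall w, 0 <= W2 w)
  (iW1 : m.-integrable setT (EFin \o W1)) (iW2 : m.-integrable setT (EFin \o W2)).

(** Differentiating in the scale produces the weight W1, and integration against the kernel turns it
    into W2. The pairs used are ([|z.1| |z.2|], [|z.2|]) for s and ([|z.2|], 1) for t: each Caputo
    derivative removes the factor belonging to its own variable. *)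
Definition caputo_transfer : Prop := forall N (u c : R), 0 <= u -> 0 <= c ->
  if a == 1 then
    (\int[m]_w (W1 w * ((c * X w) ^+ N * expR (- (u * (c * X w)))))%:E =
     \int[m]_w (W2 w * ((c * X w) ^+ N * expR (- (u * (c * X w)))))%:E)%E
  else
    (\int[mu]_v \int[m]_w (caputo_kernel a v * (W1 w *
       ((c * v `^ a * X w) ^+ N * expR (- (u * (c * v `^ a * X w))))))%:E =
     \int[m]_w (W2 w * ((c * X w) ^+ N * expR (- (u * (c * X w)))))%:E)%E.

Hypothesis T12 : caputo_transfer.

Let mW1 : measurable_fun setT W1. Proof. exact/measurable_EFinP/(measurable_int m iW1). Qed.
Lemma integrable_weight_expoly (W : S -> R) L f c : (forall w, 0 <= W w) ->
  m.-integrable setT (EFin \o W) -> 0 < L -> expoly L f -> 0 <= c ->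
  m.-integrable setT (EFin \o (fun w => W w * f (c * X w))).
Proof.
move=> W0 iW L0 Lf c0; have [C hC] := expoly_bounded L0 Lf.
have mW : measurable_fun setT W by exact/measurable_EFinP/(measurable_int m iW).
apply: (@integrable_le_Rfun _ _ _ m setT _ (fun w => C * W w)) => //.
- apply: measurable_funM => //; apply: (measurableT_comp (measurable_expoly Lf)).
  exact: measurable_funM.
- by move=> w _; rewrite normrM ger0_norm// mulrC ler_wpM2r// hC// mulr_ge0.
- exact: integrableZ_Rfun.
Qed.

Lemma Rintegral_expoly_cons (W : S -> R) L f c k N : (forall w, 0 <= W w) ->
  m.-integrable setT (EFin \o W) -> 0 < L -> expoly L f -> 0 <= c ->
  \int[m]_w (W w * (k * ((c * X w) ^+ N * expR (- (L * (c * X w)))) + f (c * X w))) =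
  k * \int[m]_w (W w * ((c * X w) ^+ N * expR (- (L * (c * X w))))) +
  \int[m]_w (W w * f (c * X w)).
Proof.
move=> W0 iW L0 Lf c0.
have Le : expoly L (fun z => z ^+ N * expR (- (L * z))).
  by have := expoly_cons 1 N (expoly0 L); congr expoly; apply/funext => z; rewrite mul1r addr0.
have i1 := integrable_weight_expoly W0 iW L0 Le c0.
have i2 := integrable_weight_expoly W0 iW L0 Lf c0.
transitivity (\int[m]_w (k * (W w * ((c * X w) ^+ N * expR (- (L * (c * X w))))) + W w * f (c * X w))).
  by apply: eq_Rintegral => w _; ring.
rewrite RintegralD//; last exact: integrableZ_Rfun.
by rewrite RintegralZl.
Qed.

Lemma transfer_expoly1 L f c : a = 1 -> 0 < L -> expoly L f -> 0 <= c ->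
  \int[m]_w (W1 w * f (c * X w)) = \int[m]_w (W2 w * f (c * X w)).
Proof.
move=> a1 L0 + c0; elim => [|k N h Lh IH].
  by under eq_Rintegral do rewrite mulr0; under [RHS]eq_Rintegral do rewrite mulr0.
rewrite !Rintegral_expoly_cons// IH; congr (_ * _ + _).
by have := @T12 N L c (ltW L0) c0; rewrite a1 eqxx /Rintegral => ->.
Qed.

(** Integrability in v is part of the claim. For a monomial everything is nonnegative and the finite
    iterated integral gives it; the sums with arbitrary coefficients follow by linearity. *)
Lemma transfer_expoly L f c : a < 1 -> 0 < L -> expoly L f -> 0 <= c ->
  mu.-integrable setT (EFin \o
    (fun v => caputo_kernel a v * \int[m]_w (W1 w * f (c * v `^ a * X w)))) /\
  \int[mu]_v (caputo_kernel a v * \int[m]_w (W1 w * f (c * v `^ a * X w))) =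
  \int[m]_w (W2 w * f (c * X w)).
Proof.
move=> a1 L0 + c0.
have a01' : 0 < a < 1 by rewrite a1 andbT; case/andP: a01.
have cv0 v : 0 <= c * v `^ a by rewrite mulr_ge0 ?powR_ge0.
elim => [|k N h Lh [IH1 IH2]].
  have E v : caputo_kernel a v * \int[m]_w (W1 w * 0) = 0.
    by under eq_Rintegral do rewrite mulr0; rewrite Rintegral_cst// mul0r mulr0.
  split; first by apply: eq_integrable (integrable0 _ _) => // v _ /=; rewrite E.
  under eq_Rintegral do rewrite E; under [RHS]eq_Rintegral do rewrite mulr0.
  by rewrite !Rintegral_cst// !mul0r.
pose e z := z ^+ N * expR (- (L * z)).
have Le : expoly L e.
  by have := expoly_cons 1 N (expoly0 L); congr expoly; apply/funext => z; rewrite mul1r addr0.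
have iWe (W : S -> R) c' (W0 : forall w, 0 <= W w) iW :=
  @integrable_weight_expoly W L e c' W0 iW L0 Le.
pose Q v := caputo_kernel a v * \int[m]_w (W1 w * e (c * v `^ a * X w)).
have e0 z : 0 <= z -> 0 <= e z by move=> z0; rewrite mulr_ge0 ?exprn_ge0 ?expR_ge0.
have me : measurable_fun [set: R] e by rewrite /e; meas.
have k0 v := caputo_kernel_ge0 v a01'.
pose K (z : R * S) : \bar R := (caputo_kernel a z.1 * (W1 z.2 * e (c * z.1 `^ a * X z.2)))%:E.
have mK : measurable_fun setT K.
  apply: measurable_EFin; apply: measurable_funM.
    exact: (measurableT_comp (measurable_caputo_kernel a)).
  apply: measurable_funM; first exact: measurableT_comp.
  apply: (measurableT_comp me); apply: measurable_funM; last exact: measurableT_comp.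
  by apply: measurable_funM => //; exact: (measurableT_comp (measurable_powR a)).
have ev0 v w : 0 <= W1 w * e (c * v `^ a * X w).
  by apply: mulr_ge0 => //; apply: e0; exact: mulr_ge0.
have K0 z : (0 <= K z)%E by rewrite lee_fin; apply: mulr_ge0.
have QE v : ((Q v)%:E = \int[m]_w K (v, w))%E.
  rewrite /Q EFinM fineK; last by apply: integrable_fin_num => //; exact: iWe.
  rewrite -ge0_integralZl//=.
  - apply: measurable_EFin; apply: measurable_funM => //; apply: (measurableT_comp me).
    exact: measurable_funM.
  - by move=> w _; rewrite lee_fin.
  - by rewrite lee_fin.
have mQ : measurable_fun [set: R] (fun v => (Q v)%:E).
  rewrite (funext QE); exact (@measurable_fun_fubini_tonelli_F _ _ _ _ _ m K mK K0).
have Q0 v : 0 <= Q v.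
  by rewrite -lee_fin QE; apply: integral_ge0.
have i2 := iWe W2 c W20 iW2 c0.
have QI : (\int[mu]_v (Q v)%:E = (\int[m]_w (W2 w * e (c * X w)))%:E)%E.
  transitivity (\int[mu]_v \int[m]_w K (v, w))%E; first by apply: eq_integral => v _; exact: QE.
  have := @T12 N L c (ltW L0) c0; rewrite (lt_eqF a1) => ->.
  by rewrite fineK//; exact: integrable_fin_num i2.
have iQ : mu.-integrable setT (EFin \o Q).
  apply/integrableP; split => //.
  under eq_integral do rewrite /= ger0_norm//.
  by rewrite QI ltry.
have E v : caputo_kernel a v * \int[m]_w (W1 w *
    (k * ((c * v `^ a * X w) ^+ N * expR (- (L * (c * v `^ a * X w)))) + h (c * v `^ a * X w))) =
    k * Q v + caputo_kernel a v * \int[m]_w (W1 w * h (c * v `^ a * X w)).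
  by rewrite Rintegral_expoly_cons// /Q; ring.
split.
  under eq_fun do rewrite E.
  by apply: integrableD_Rfun => //; exact: integrableZ_Rfun.
under eq_Rintegral do rewrite E.
rewrite RintegralD//; last exact: integrableZ_Rfun.
rewrite RintegralZl// IH2 Rintegral_expoly_cons//; congr (_ * _ + _).
by rewrite [LHS]/Rintegral QI.
Qed.

End transfer.

Section caputo_of_expectation.
Context {R : realType}.
Local Notation mu := (@lebesgue_measure R).

(** Integrability is assumed in the variable v, where the kernel form supplies it, and transported
    back to x; the signed identity comes from the positive and negative parts. *)
Lemma Rintegral_scale (c : R) (f : R -> R) : 0 < c ->
  mu.-integrable setT (EFin \o (fun v => f (c * v))) ->
  mu.-integrable setT (EFin \o f) /\
  \int[mu]_x f x = c * \int[mu]_v f (c * v).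
Proof.
move=> c0 ifc.
have mfc : measurable_fun [set: R] (fun v => f (c * v)).
  by case/integrableP: ifc => /measurable_EFinP.
have mf : measurable_fun [set: R] f.
  rewrite (_ : f = fun x => f (c * (c^-1 * x))); last first.
    by apply/funext => x; rewrite mulrA divff ?gt_eqF// mul1r.
  by apply: (measurableT_comp mfc); apply: measurable_funM.
have scale (h : R -> \bar R) : measurable_fun [set: R] h -> (forall x, 0 <= h x)%E ->
    (\int[mu]_x h x = c%:E * \int[mu]_x h (c * x)%R)%E.
  move=> mh h0; rewrite (@ge0_integral_affine R c 0)//; congr (_ * _)%E.
  by apply: eq_integral => x _; rewrite addr0.
have iff : mu.-integrable setT (EFin \o f).
  apply/integrableP; split; first exact: measurable_EFin.
  rewrite scale//; last by apply: measurable_EFin; exact: measurableT_comp.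
  by apply: lte_mul_pinfty; [rewrite lee_fin ltW| |case/integrableP: ifc].
split => //.
pose fc := EFin \o (fun v => f (c * v)).
have P := integrable_pos_fin_num measurableT ifc.
have N := integrable_neg_fin_num measurableT ifc.
have sp : (\int[mu]_x (EFin \o f)^\+ x = c%:E * \int[mu]_x fc^\+ x)%E.
  rewrite scale; [|by apply: measurable_funepos; exact: measurable_EFin|by []].
  by congr (_ * _)%E; apply: eq_integral => x _; rewrite ?funeposE ?funenegE.
have sn : (\int[mu]_x (EFin \o f)^\- x = c%:E * \int[mu]_x fc^\- x)%E.
  rewrite scale; [|by apply: measurable_funeneg; exact: measurable_EFin|by []].
  by congr (_ * _)%E; apply: eq_integral => x _; rewrite ?funeposE ?funenegE.
have -> : \int[mu]_x f x = fine (\int[mu]_x (EFin \o f)^\+ x - \int[mu]_x (EFin \o f)^\- x)%E.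
  by rewrite /Rintegral integralE.
have -> : \int[mu]_v f (c * v) = fine (\int[mu]_x fc^\+ x - \int[mu]_x fc^\- x)%E.
  by rewrite /Rintegral integralE.
rewrite sp sn; move: P N; rewrite -/fc.
case: (\int[mu]_x fc^\+ x)%E => // A _; case: (\int[mu]_x fc^\- x)%E => // B _.
by rewrite -!EFinM -!EFinB /= mulrBr.
Qed.

Context d (S : measurableType d) (m : probability S R).
Variables (a L : R) (W1 W2 X : S -> R) (phi : R -> R) (Phi : R -> S -> R) (g : R -> R).
Hypotheses (a01 : 0 < a <= 1)
  (mX : measurable_fun [set: S] X) (X0 : forall w, 0 <= X w)
  (W10 : forall w, 0 <= W1 w) (W20 : forall w, 0 <= W2 w)
  (iW1 : m.-integrable setT (EFin \o W1)) (iW2 : m.-integrable setT (EFin \o W2))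
  (T12 : caputo_transfer m a W1 W2 X)
  (L0 : 0 < L) (Lphi : expoly L phi)
  (iPhi : forall z : R, 0 < z -> m.-integrable setT (EFin \o Phi z))
  (dPhi : forall (z : R) w, 0 < z -> is_derive z 1 (Phi^~ w) (W1 w * phi (z * X w)))
  (gE : forall x : R, 0 < x -> g x = \int[m]_w Phi (x `^ a) w).

Let a0 : 0 < a. Proof. by case/andP: a01. Qed.

Let Q (z : R) : R := \int[m]_w (W1 w * phi (z * X w)).

Lemma is_derive_expectation (z : R) : 0 < z -> is_derive z 1 (fun z => \int[m]_w Phi z w) (Q z).
Proof.
move=> z0; have [C hC] := expoly_bounded L0 Lphi.
have C0 : 0 <= C by apply: le_trans (hC 0 (lexx _)).
(* The left end [z / 2] keeps the neighbourhood among positive numbers, where the integrability and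
   differentiability of Phi are available. *)
have zI : `](z / 2), (z + 1)[%classic z.
  by rewrite /= in_itv/= ltrDl ltr01 andbT ltr_pdivrMr// ltr_pMr// ltr1n.
have Ipos x : `](z / 2), (z + 1)[%classic x -> 0 < x.
  by rewrite /= in_itv/= => /andP[+ _]; apply: lt_trans; rewrite divr_gt0.
have p12 x w : 0 < x -> partial1of2 Phi x w = W1 w * phi (x * X w).
  by move=> x0; rewrite partial1of2E; have [_ ->] := dPhi w x0.
have iI x : `](z / 2), (z + 1)[%classic x -> m.-integrable setT (EFin \o Phi x).
  by move=> /Ipos; exact: iPhi.
have dI x w : `](z / 2), (z + 1)[%classic x -> setT w -> derivable (Phi^~ w) x 1.
  by move=> /Ipos x0 _; have [] := dPhi w x0.
have G0 w : 0 <= C * W1 w by rewrite mulr_ge0.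
have iG : m.-integrable setT (EFin \o (fun w => C * W1 w)) by exact: integrableZ_Rfun.
have bI x w : `](z / 2), (z + 1)[%classic x -> setT w -> `|partial1of2 Phi x w| <= C * W1 w.
  move=> /Ipos x0 _; rewrite p12// normrM ger0_norm// mulrC ler_wpM2r//.
  by apply: hC; apply: mulr_ge0 => //; exact: ltW.
have h1 := derivable_under_integral measurableT zI iI dI G0 iG bI.
have h2 := differentiation_under_integral measurableT zI iI dI G0 iG bI.
split => //; rewrite -derive1E h2; apply: eq_Rintegral => w _; exact: p12.
Qed.

Lemma is_derive_expectation_powR (x : R) : 0 < x -> is_derive x 1 g (a * x `^ (a - 1) * Q (x `^ a)).
Proof.
move=> x0; apply: (@near_eq_is_derive _ _ _ (fun x => \int[m]_w Phi (x `^ a) w)).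
  near=> y; rewrite gE//.
  by near: y; exact: lt_nbhsr.
have h := is_derive_expectation (powR_gt0 a x0).
have xa := isd_powR a x0 (isd_id x).
have h' := isd_comp (f := fun z => \int[m]_w Phi z w) (g := fun x => x `^ a) h xa.
by apply: isd_eq h' _; ring.
Unshelve. all: by end_near. Qed.

Lemma caputo_expectation (s : R) : 0 < s ->
  caputo_derivable a g s /\ caputo a g s = \int[m]_w (W2 w * phi (s `^ a * X w)).
Proof.
move=> s0; have dg x : 0 < x -> derivable g x 1.
  by move=> x0; have [] := is_derive_expectation_powR x0.
have g'E x : 0 < x -> derive1 g x = a * x `^ (a - 1) * Q (x `^ a).
  by move=> x0; rewrite derive1E; have [_ ->] := is_derive_expectation_powR x0.
have sa0 : 0 <= s `^ a by rewrite powR_ge0.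
have [a1|a1] := eqVneq a 1.
  rewrite /caputo_derivable /caputo a1 eqxx; split; first exact: dg.
  rewrite g'E// a1 subrr powRr0 !mul1r -a1.
  exact: (transfer_expoly1 mX X0 W10 W20 iW1 iW2 T12 a1 L0 Lphi).
have {}a1 : a < 1 by rewrite lt_neqAle a1; case/andP: a01.
have [iT IT] := transfer_expoly a01 mX X0 W10 W20 iW1 iW2 T12 a1 L0 Lphi sa0.
have G1 : 0 < Gamma (1 - a) by rewrite Gamma_gt0// subr_gt0.
pose F (x : R) := if 0 < x < s then derive1 g x / (s - x) `^ a else 0.
(* The powers of s reduce to [1 / s], which the Jacobian of [x = s v] cancels, and [Gamma (1 - a)]
   cancels the normalization of the Caputo integral. *)
have FE v : F (s * v) = Gamma (1 - a) / s *
    (caputo_kernel a v * \int[m]_w (W1 w * phi (s `^ a * v `^ a * X w))).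
  rewrite /F /caputo_kernel pmulr_rgt0// gtr_pMr//.
  case: ifPn => [/andP[v0 v1]|]; last by rewrite mul0r mulr0.
  have sv0 : 0 < s * v by rewrite mulr_gt0.
  have v1' : 0 < 1 - v by rewrite subr_gt0.
  rewrite g'E// -powRM ?(ltW s0) ?(ltW v0)// -/(Q _).
  have -> : s - s * v = s * (1 - v) by ring.
  move: (Q _) => q; rewrite powRN (powRM _ (ltW s0) (ltW v0)) (powRM _ (ltW s0) (ltW v1')).
  have -> : s `^ (a - 1) = s `^ a / s.
    by rewrite powRD ?(gt_eqF s0) ?implybT// powR_inv1// ltW.
  have := powR_gt0 a s0; have := powR_gt0 a v1'.
  move: (s `^ a) ((1 - v) `^ a) (v `^ (a - 1)) (Gamma _) G1 => sa va vb ga ga0 va0 sa0'.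
  by field; rewrite !gt_eqF.
have iFs : mu.-integrable setT (EFin \o (fun v => F (s * v))).
  by under eq_fun do rewrite FE; exact: integrableZ_Rfun.
have [iF IF] := Rintegral_scale s0 iFs.
have FD : EFin \o F = (fun x => (derive1 g x / (s - x) `^ a)%:E) \_ `]0%R, s[.
  apply/funext => x; rewrite patchE /F /=; case: ifPn.
    by move=> xs; rewrite mem_set//= in_itv.
  by move=> xs; rewrite memNset//= in_itv/=; exact/negP.
rewrite /caputo_derivable /caputo (lt_eqF a1); split.
  split; first by move=> x /andP[x0 _]; exact: dg.
  by apply/integrable_mkcond; [exact: measurable_itv|move: iF; rewrite FD].
have -> : \int[mu]_(x in `]0%R, s[) (derive1 g x / (s - x) `^ a) = \int[mu]_x F x.
  by rewrite /Rintegral integral_mkcond -FD.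
rewrite -IT IF.
under eq_Rintegral do rewrite FE.
rewrite RintegralZl//; move: (Rintegral _ _ _) => r.
by field; rewrite !gt_eqF.
Qed.

End caputo_of_expectation.

Lemma ge0_integralZ_fun d (T : measurableType d) {R : realType} (m : {measure set T -> \bar R})
    (k : R) (f : T -> R) : 0 <= k -> measurable_fun setT f -> (forall x, 0 <= f x) ->
  (\int[m]_x (k * f x)%:E = k%:E * \int[m]_x (f x)%:E)%E.
Proof.
move=> k0 mf f0; under eq_integral do rewrite EFinM.
have mf' : measurable_fun setT (fun x => (f x)%:E) by exact: measurable_EFin.
by rewrite (ge0_integralZl m measurableT mf')// => x _; rewrite lee_fin.
Qed.

Section kernel_swap.
Context {R : realType}.
Local Notation mu := (@lebesgue_measure R).
Variables (a : R) (m n : probability R R) (G : R -> R).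
Hypotheses (a01 : 0 < a <= 1) (mm : abs_ml_moments a m)
  (mG : measurable_fun [set: R] G) (G0 : forall x, 0 <= G x).
Variables (N : nat) (u c : R).
Hypotheses (u0 : 0 <= u) (c0 : 0 <= c).

Let e (z : R) := z ^+ N * expR (- (u * z)).

Let me : measurable_fun [set: R] e. Proof. by rewrite /e; meas. Qed.

Let e0 z : 0 <= z -> 0 <= e z.
Proof. by move=> z0; rewrite /e mulr_ge0 ?exprn_ge0 ?expR_ge0. Qed.

Let mabs : measurable_fun [set: R] (fun y : R => `|y|). Proof. exact: normr_measurable. Qed.

Let mey (x : R) : measurable_fun [set: R] (fun y => e (c * `|x| * `|y|)).
Proof. by apply: (measurableT_comp me); apply: measurable_funM. Qed.

(** Tonelli makes the x-integral outermost; for fixed x the transfer for the single law m applies at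
    the scale [c * |x|]. *)
Lemma caputo_kernel_swap : a < 1 ->
  (\int[mu]_v \int[n]_x \int[m]_y
     (caputo_kernel a v * (G x * `|y| * e (c * v `^ a * (`|x| * `|y|))))%:E =
   \int[n]_x \int[m]_y (G x * e (c * (`|x| * `|y|)))%:E)%E.
Proof.
move=> a1; have a01' : 0 < a < 1 by rewrite a1 andbT; case/andP: a01.
pose K (z : (R * R) * R) : \bar R := (caputo_kernel a z.1.1 * (G z.1.2 * `|z.2| *
  e (c * z.1.1 `^ a * (`|z.1.2| * `|z.2|))))%:E.
have mk := measurable_caputo_kernel a.
have m11 : measurable_fun setT (fun z : (R * R) * R => z.1.1).
  exact: (measurableT_comp measurable_fst measurable_fst).
have m12 : measurable_fun setT (fun z : (R * R) * R => z.1.2).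
  exact: (measurableT_comp measurable_snd measurable_fst).
have m2 : measurable_fun setT (fun z : (R * R) * R => z.2) by exact: measurable_snd.
have mK : measurable_fun setT K.
  apply: measurable_EFin; apply: measurable_funM; first exact: (measurableT_comp mk m11).
  apply: measurable_funM.
    by apply: measurable_funM; [exact: (measurableT_comp mG m12)|exact: (measurableT_comp mabs m2)].
  apply: (measurableT_comp me); apply: measurable_funM.
    by apply: measurable_funM => //; exact: (measurableT_comp (measurable_powR a) m11).
  by apply: measurable_funM; [exact: (measurableT_comp mabs m12)|exact: (measurableT_comp mabs m2)].
have K0 z : (0 <= K z)%E.
  rewrite lee_fin; apply: mulr_ge0; first exact: caputo_kernel_ge0.
  by rewrite mulr_ge0 ?e0// !mulr_ge0 ?powR_ge0.
pose H (z : R * R) : \bar R := (\int[m]_y K (z, y))%E.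
have mH : measurable_fun setT H.
  exact (@measurable_fun_fubini_tonelli_F _ _ _ _ _ m K mK K0).
have H0 z : (0 <= H z)%E by apply: integral_ge0.
transitivity (\int[mu]_v \int[n]_x H (v, x))%E; first by [].
rewrite fubini_tonelli//; apply: eq_integral => x _.
have cx : 0 <= c * `|x| by rewrite mulr_ge0.
have mex : measurable_fun setT (fun z : R * R =>
    caputo_kernel a z.1 * `|z.2| * e (c * `|x| * z.1 `^ a * `|z.2|)).
  apply: measurable_funM.
    by apply: measurable_funM; [exact: measurableT_comp|exact: (measurableT_comp mabs)].
  apply: (measurableT_comp me); apply: measurable_funM; last exact: (measurableT_comp mabs).
  by apply: measurable_funM => //; exact: (measurableT_comp (measurable_powR a)).
pose L (z : R * R) := caputo_kernel a z.1 * `|z.2| * e (c * `|x| * z.1 `^ a * `|z.2|).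
have L0 (z : R * R) : 0 <= L z.
  apply: mulr_ge0; first by apply: mulr_ge0 => //; exact: caputo_kernel_ge0.
  by apply: e0; apply: mulr_ge0 => //; apply: mulr_ge0 => //; exact: powR_ge0.
have mLE : measurable_fun setT (fun z => (L z)%:E) by exact: measurable_EFin.
have L0E z : (0 <= (L z)%:E)%E by rewrite lee_fin.
transitivity ((G x)%:E * \int[m]_y (e (c * `|x| * `|y|))%:E)%E; last first.
  rewrite -(ge0_integralZ_fun m (G0 x) (mey x)); last by move=> y; apply: e0; exact: mulr_ge0.
  by apply: eq_integral => y _; rewrite -(mulrA c).
have Gx0 : (0 <= (G x)%:E)%E by rewrite lee_fin.
have IL0 v : [set: R] v -> (0 <= \int[m]_y (L (v, y))%:E)%E by move=> _; apply: integral_ge0.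
have mIL := @measurable_fun_fubini_tonelli_F _ _ _ _ _ m _ mLE L0E.
rewrite -(caputo_kernel_transfer a01 mm N u0 cx a1).
rewrite -[RHS](@ge0_integralZl _ _ _ mu setT measurableT _ mIL _ IL0 Gx0).
apply: eq_integral => v _.
have mLv : measurable_fun [set: R] (fun y => L (v, y)).
  by apply: (measurableT_comp mex); exact: pair1_measurable.
rewrite -[RHS](ge0_integralZ_fun m (G0 x) mLv (fun y => L0 (v, y))).
apply: eq_integral => y _; rewrite /K/L/=; congr EFin.
have -> : c * v `^ a * (`|x| * `|y|) = c * `|x| * v `^ a * `|y| by ring.
by rewrite -!mulrA mulrCA.
Qed.

Lemma abs_transfer_iterated : a = 1 ->
  (\int[n]_x \int[m]_y (G x * `|y| * e (c * (`|x| * `|y|)))%:E =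
   \int[n]_x \int[m]_y (G x * e (c * (`|x| * `|y|)))%:E)%E.
Proof.
move=> a1; apply: eq_integral => x _.
have cx : 0 <= c * `|x| by rewrite mulr_ge0.
have ex0 (y : R) : 0 <= e (c * `|x| * `|y|) by apply: e0; exact: mulr_ge0.
transitivity ((G x)%:E * \int[m]_y (`|y| * e (c * `|x| * `|y|))%:E)%E.
  rewrite -(ge0_integralZ_fun m (G0 x)); last 2 first.
  - by apply: measurable_funM => //; exact: mey.
  - by move=> y; exact: mulr_ge0.
  by apply: eq_integral => y _; rewrite -(mulrA c) -mulrA.
transitivity ((G x)%:E * \int[m]_y (e (c * `|x| * `|y|))%:E)%E.
  by rewrite (abs_transfer1 a01 mm N u0 cx a1).
rewrite -(ge0_integralZ_fun m (G0 x) (mey x) ex0).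
by apply: eq_integral => y _; rewrite -(mulrA c).
Qed.

End kernel_swap.

(** * The product of the two reference laws *)

Section product_law.
Context {R : realType}.
Variables (a b : R) (m n : probability R R).
Hypotheses (a01 : 0 < a <= 1) (b01 : 0 < b <= 1)
  (mm : abs_ml_moments a m) (mn : abs_ml_moments b n).
Local Notation pi := (m \x n)%E.

Definition abs_prod (z : R * R) : R := `|z.1| * `|z.2|.

Lemma measurable_abs_prod : measurable_fun setT abs_prod.
Proof.
by apply: measurable_funM; apply: (measurableT_comp (@normr_measurable R _)).
Qed.

Lemma measurable_abs_snd : measurable_fun setT (fun z : R * R => `|z.2|).
Proof. exact: (measurableT_comp (@normr_measurable R _)). Qed.

Lemma abs_prod_ge0 z : 0 <= abs_prod z. Proof. by rewrite mulr_ge0. Qed.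

Lemma product_moments p q : (\int[pi]_z (`|z.1| ^+ p * `|z.2| ^+ q)%:E =
  (ml_moment a p * ml_moment b q)%:E)%E.
Proof.
rewrite (@fubini_tonelli1 _ _ _ _ _ m n (fun z => (`|z.1| ^+ p * `|z.2| ^+ q)%:E)); last 2 first.
- apply: measurable_EFin; apply: measurable_funM; apply: measurable_funX.
    exact: (measurableT_comp (@normr_measurable R _)).
  exact: measurable_abs_snd.
- by move=> z; rewrite lee_fin mulr_ge0 ?exprn_ge0.
have mX r : measurable_fun [set: R] (fun x : R => `|x| ^+ r).
  by apply: measurable_funX; exact: normr_measurable.
have X0 r (x : R) : 0 <= `|x| ^+ r by rewrite exprn_ge0.
rewrite EFinM muleC.
transitivity (\int[m]_x (ml_moment b q * `|x| ^+ p)%:E)%E.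
  apply: eq_integral => x _; rewrite /fubini_F/=.
  by rewrite (ge0_integralZ_fun n (exprn_ge0 p (normr_ge0 x)) (mX q) (X0 q)) mn EFinM muleC.
have b0 : 0 <= ml_moment b q by rewrite ml_moment_ge0//; case/andP: b01.
by rewrite -(mm p) -(ge0_integralZ_fun m b0 (mX p) (X0 p)).
Qed.

Lemma integral_abs_prodX q : (\int[pi]_z (abs_prod z ^+ q)%:E =
  (ml_moment a q * ml_moment b q)%:E)%E.
Proof. by rewrite -product_moments; apply: eq_integral => z _; rewrite exprMn. Qed.

Let integrable_ge0 (f : R * R -> R) r : measurable_fun setT f -> (forall z, 0 <= f z) ->
  (\int[pi]_z (f z)%:E = r%:E)%E -> pi.-integrable setT (EFin \o f).
Proof.
move=> mf f0 fr; apply/integrableP; split; first exact: measurable_EFin.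
under eq_integral do rewrite /= ger0_norm//.
by rewrite fr ltry.
Qed.

Lemma integrable_abs_prod : pi.-integrable setT (EFin \o abs_prod).
Proof.
apply: (@integrable_ge0 _ (ml_moment a 1 * ml_moment b 1)).
- exact: measurable_abs_prod.
- exact: abs_prod_ge0.
- by rewrite -integral_abs_prodX.
Qed.

Lemma integrable_abs_snd : pi.-integrable setT (EFin \o (fun z => `|z.2|)).
Proof.
apply: (@integrable_ge0 _ (ml_moment a 0 * ml_moment b 1)) => //.
- exact: measurable_abs_snd.
- by rewrite -product_moments; apply: eq_integral => z _; rewrite expr0 mul1r.
Qed.

Lemma product_integral12 (f : R * R -> R) (h : R -> R -> R) : measurable_fun setT f ->
  (forall z, 0 <= f z) -> (forall x y, f (x, y) = h x y) ->
  (\int[pi]_z (f z)%:E = \int[m]_x \int[n]_y (h x y)%:E)%E.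
Proof.
move=> mf f0 fh; rewrite (@fubini_tonelli1 _ _ _ _ _ m n (fun z => (f z)%:E)).
- by apply: eq_integral => x _; apply: eq_integral => y _; rewrite fh.
- exact: measurable_EFin.
- by move=> z; rewrite lee_fin.
Qed.

(** With m innermost, as the transfer in the first coordinate requires; [product_integral12] serves
    the second. *)
Lemma product_integral21 (f : R * R -> R) (h : R -> R -> R) : measurable_fun setT f ->
  (forall z, 0 <= f z) -> (forall x y, f (x, y) = h y x) ->
  (\int[pi]_z (f z)%:E = \int[n]_y \int[m]_x (h y x)%:E)%E.
Proof.
move=> mf f0 fh; rewrite (@fubini_tonelli2 _ _ _ _ _ m n (fun z => (f z)%:E)).
- by apply: eq_integral => y _; apply: eq_integral => x _; rewrite fh.
- exact: measurable_EFin.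
- by move=> z; rewrite lee_fin.
Qed.

Section transfers.
Variables (N : nat) (u c : R).
Hypotheses (u0 : 0 <= u) (c0 : 0 <= c).
Let e (z : R) := z ^+ N * expR (- (u * z)).

Let me (W : R * R -> R) k c' : measurable_fun setT W ->
  measurable_fun setT (fun z => k * (W z * e (c' * abs_prod z))).
Proof.
move=> mW; apply: measurable_funM => //; apply: measurable_funM => //.
have mE : measurable_fun [set: R] e by rewrite /e; meas.
by apply: (measurableT_comp mE); apply: measurable_funM => //; exact: measurable_abs_prod.
Qed.

Let me1 (W : R * R -> R) c' : measurable_fun setT W ->
  measurable_fun setT (fun z => W z * e (c' * abs_prod z)).
Proof. by move=> mW; have := me 1 c' mW; under eq_fun do rewrite mul1r. Qed.

Let e0 (W : R * R -> R) c' : 0 <= c' -> (forall z, 0 <= W z) ->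
  forall z, 0 <= W z * e (c' * abs_prod z).
Proof.
move=> c'0 W0 z; apply: mulr_ge0 => //; rewrite /e mulr_ge0 ?expR_ge0// exprn_ge0//.
by apply: mulr_ge0 => //; exact: abs_prod_ge0.
Qed.

Let cv0 v (p : R) : 0 <= c * v `^ p. Proof. by rewrite mulr_ge0 ?powR_ge0. Qed.

Let abs_prodE x y : abs_prod (x, y) = `|y| * `|x|. Proof. exact: mulrC. Qed.

Let abs_snd0 (z : R * R) : 0 <= `|z.2|. Proof. by []. Qed.

Lemma caputo_transfer_fst :
  if a == 1 then
    (\int[pi]_z (abs_prod z * e (c * abs_prod z))%:E = \int[pi]_z (`|z.2| * e (c * abs_prod z))%:E)%E
  else (\int[@lebesgue_measure R]_v \int[pi]_z
       (caputo_kernel a v * (abs_prod z * e (c * v `^ a * abs_prod z)))%:E =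
     \int[pi]_z (`|z.2| * e (c * abs_prod z))%:E)%E.
Proof.
have RHSE : (\int[pi]_z (`|z.2| * e (c * abs_prod z))%:E =
    \int[n]_y \int[m]_x (`|y| * e (c * (`|y| * `|x|)))%:E)%E.
  apply: product_integral21; [exact: (me1 _ measurable_abs_snd)|exact: e0|].
  by move=> x y; rewrite abs_prodE.
have [a1|a1] := eqVneq a 1.
  rewrite RHSE -(abs_transfer_iterated n a01 mm (fun x => normr_ge0 x) N u0 c0 a1).
  apply: product_integral21; [exact: (me1 _ measurable_abs_prod)|exact: (e0 _ abs_prod_ge0)|].
  by move=> x y; rewrite abs_prodE.
have {}a1 : a < 1 by rewrite lt_neqAle a1; case/andP: a01.
have a01' : 0 < a < 1 by rewrite a1 andbT; case/andP: a01.
rewrite RHSE -(caputo_kernel_swap n a01 mm (@normr_measurable R _) (fun x => normr_ge0 x) N u0 c0 a1).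
apply: eq_integral => v _; apply: product_integral21.
- exact: (me _ _ measurable_abs_prod).
- by move=> z; apply: mulr_ge0; [exact: caputo_kernel_ge0|exact: (e0 _ abs_prod_ge0)].
- by move=> x y; rewrite abs_prodE.
Qed.

Lemma caputo_transfer_snd :
  if b == 1 then
    (\int[pi]_z (`|z.2| * e (c * abs_prod z))%:E = \int[pi]_z (1 * e (c * abs_prod z))%:E)%E
  else (\int[@lebesgue_measure R]_v \int[pi]_z
       (caputo_kernel b v * (`|z.2| * e (c * v `^ b * abs_prod z)))%:E =
     \int[pi]_z (1 * e (c * abs_prod z))%:E)%E.
Proof.
have RHSE : (\int[pi]_z (1 * e (c * abs_prod z))%:E =
    \int[m]_x \int[n]_y (1 * e (c * (`|x| * `|y|)))%:E)%E.
  by apply: product_integral12; [exact: (me1 _ (measurable_cst _))|exact: (e0 c0 (fun=> ler01))|].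
have [b1|b1] := eqVneq b 1.
  rewrite RHSE -(abs_transfer_iterated m b01 mn (fun x : R => ler01) N u0 c0 b1).
  apply: product_integral12; [exact: (me1 _ measurable_abs_snd)|exact: e0|].
  by move=> x y; rewrite /abs_prod/= mul1r.
have {}b1 : b < 1 by rewrite lt_neqAle b1; case/andP: b01.
have b01' : 0 < b < 1 by rewrite b1 andbT; case/andP: b01.
rewrite RHSE -(caputo_kernel_swap m b01 mn (measurable_cst _) (fun x : R => ler01) N u0 c0 b1).
apply: eq_integral => v _; apply: product_integral12.
- exact: (me _ _ measurable_abs_snd).
- by move=> z; apply: mulr_ge0; [exact: caputo_kernel_ge0|exact: (e0 (cv0 v b) abs_snd0)].
- by move=> x y; rewrite /abs_prod/= mul1r.
Qed.

End transfers.

Lemma product_caputo_transfer_fst : caputo_transfer pi a abs_prod (fun z => `|z.2|) abs_prod.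
Proof. by move=> N u c u0 c0; exact: (caputo_transfer_fst N u0 c0). Qed.

Lemma product_caputo_transfer_snd : caputo_transfer pi b (fun z => `|z.2|) (cst 1) abs_prod.
Proof. by move=> N u c u0 c0; exact: (caputo_transfer_snd N u0 c0). Qed.

End product_law.

(** * The generalized Poisson law *)

Section counting_law.
Context {R : realType}.

Definition count_weight (k n : nat) (theta : 'I_k -> R) : R :=
  \sum_(m : {ffun 'I_k -> 'I_n.+1} | Theta m) \prod_(j < k) (theta j ^+ m j / (m j)`!%:R).

Definition count_prob (k : nat) (theta : 'I_k -> R) (n : int) : R :=
  if n is Posz n then count_weight n theta * expR (- \sum_(j < k) theta j) else 0.

Lemma count_probE k n (theta : 'I_k -> R) :
  \sum_(m : {ffun 'I_k -> 'I_n.+1} | Theta m) \prod_(j < k)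
    (theta j ^+ m j / (m j)`!%:R * expR (- theta j)) = count_prob theta n.
Proof.
rewrite /count_prob /count_weight mulr_suml; apply: eq_bigr => m _.
by rewrite big_split/= -expR_sum -sumrN.
Qed.

Lemma count_prob_ge0 k (theta : 'I_k -> R) n : (forall j, 0 <= theta j) -> 0 <= count_prob theta n.
Proof.
move=> t0; case: n => // n; rewrite mulr_ge0 ?expR_ge0// sumr_ge0// => m _.
by apply: prodr_ge0 => j _; rewrite divr_ge0// exprn_ge0.
Qed.

(** The bound is the number of solutions in Theta, each factor of each term being at most 1. Being
    uniform in theta, it dominates the integrand while a parameter varies. *)
Lemma count_prob_bounded k (n : int) : exists C : R,
  forall theta : 'I_k -> R, (forall j, 0 <= theta j) -> count_prob theta n <= C.
Proof.
case: n => n; last by exists 0.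
exists (\sum_(m : {ffun 'I_k -> 'I_n.+1} | Theta m) 1) => theta t0.
rewrite -count_probE; apply: ler_sum => m _.
apply: prodr_ile1 => j _; rewrite mulr_ge0 ?expR_ge0 ?divr_ge0 ?exprn_ge0//=.
rewrite mulrAC ler_pdivrMr ?ltr0n ?fact_gt0// mul1r.
exact: exprn_expR_le.
Qed.

Lemma count_prob_scale k (lam : 'I_k -> R) (n : nat) z :
  count_prob (fun j => lam j * z) n = \sum_(m : {ffun 'I_k -> 'I_n.+1} | Theta m)
    (\prod_(j < k) (lam j ^+ m j / (m j)`!%:R)) *
    (z ^+ (\sum_(j < k) m j) * expR (- ((\sum_(j < k) lam j) * z))).
Proof.
rewrite /count_prob /count_weight mulr_suml; apply: eq_bigr => m _.
rewrite -mulr_suml mulrA; congr (_ * _).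
rewrite expr_sum -big_split/=; apply: eq_bigr => j _.
by rewrite exprMn mulrAC.
Qed.

Lemma expoly_count_prob k (lam : 'I_k -> R) n :
  expoly (\sum_(j < k) lam j) (fun z => count_prob (fun j => lam j * z) n).
Proof.
case: n => n; last exact: expoly0.
rewrite (funext (count_prob_scale lam n)); apply: expoly_sum => m _.
have := expoly_cons (\prod_(j < k) (lam j ^+ m j / (m j)`!%:R)) (\sum_(j < k) m j)
  (expoly0 (\sum_(j < k) lam j)).
by congr expoly; apply/funext => z; rewrite addr0.
Qed.

(* Truncated at degree K, the generating polynomial of the weights is a product
   of exponential polynomials, whose derivative along an affine curve is, up to
   the truncation, multiplication by a fixed polynomial. *)
Definition trunc_exp (K d : nat) (t : R) : {poly R} :=
  \sum_(i < K) (t ^+ i / i`!%:R) *: 'X^(d * i).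

Definition genpoly (k K : nat) (theta : 'I_k -> R) : {poly R} :=
  \prod_(j < k) trunc_exp K j.+1 (theta j).

Lemma coef_trunc_exp K d t n :
  (trunc_exp K d t)`_n = \sum_(i < K) t ^+ i / i`!%:R * (n == d * i)%N%:R.
Proof. by rewrite coef_sum; apply: eq_bigr => i _; rewrite coefZ coefXn. Qed.

Lemma trunc_exp_stable K L d t n : (n < K)%N -> (K <= L)%N -> (0 < d)%N ->
  (trunc_exp L d t)`_n = (trunc_exp K d t)`_n.
Proof.
move=> nK KL d0; rewrite !coef_trunc_exp.
rewrite (big_ord_widen L (fun i => t ^+ i / i`!%:R * (n == d * i)%N%:R) KL) [RHS]big_mkcond/=.
apply: eq_bigr => i _; case: ltnP => // Ki.
case: eqP => [nd|_]; last by rewrite mulr0.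
by have := leq_pmull i d0; rewrite -nd leqNgt (leq_trans nK Ki).
Qed.

(** A backward shift by j reads the coefficient n - j of a polynomial truncated for n, whereas
    [coef_genpoly] identifies it at the truncation for n - j. *)
Lemma genpoly_stable k K L (theta : 'I_k -> R) n : (n < K)%N -> (K <= L)%N ->
  (genpoly L theta)`_n = (genpoly K theta)`_n.
Proof.
move=> nK KL; rewrite /genpoly.
pose eqK (p q : {poly R}) := forall i, (i < K)%N -> p`_i = q`_i.
suff : eqK (\prod_(j < k) trunc_exp L j.+1 (theta j)) (\prod_(j < k) trunc_exp K j.+1 (theta j)).
  exact.
apply: (big_ind2 eqK) => // [p p' q q' pp' qq' i iK|j _ i iK]; last exact: trunc_exp_stable.
rewrite !coefM; apply: eq_bigr => /= l _; rewrite pp' ?qq'//.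
  by rewrite (leq_ltn_trans _ iK)// leq_subr.
by rewrite (leq_ltn_trans _ iK)// -ltnS.
Qed.

Lemma coef_genpoly k n (theta : 'I_k -> R) : (genpoly n.+1 theta)`_n = count_weight n theta.
Proof.
rewrite /genpoly /trunc_exp bigA_distr_bigA/= coef_sum /count_weight [RHS]big_mkcond/=.
apply: eq_bigr => m _; rewrite scaler_prod coefZ prodrXr coefXn eq_sym /Theta.
by case: eqP; rewrite ?mulr1 ?mulr0.
Qed.

Definition is_derive_poly (K : nat) (f : R -> {poly R}) (df : {poly R}) (x : R) : Prop :=
  forall n, (n < K)%N -> is_derive x 1 (fun y => (f y)`_n) df`_n.

Lemma is_derive_polyM K f g df dg x :
  is_derive_poly K f df x -> is_derive_poly K g dg x ->
  is_derive_poly K (fun y => f y * g y) (df * g x + f x * dg) x.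
Proof.
move=> hf hg n nK; under eq_fun do rewrite coefM.
rewrite coefD !coefM -big_split/=; apply: isd_sum => i _; apply: isdM.
  by apply: hf; rewrite (leq_ltn_trans _ nK)// -ltnS.
by apply: hg; rewrite (leq_ltn_trans _ nK)// leq_subr.
Qed.

Lemma is_derive_trunc_exp K d (c e x : R) : (0 < d)%N ->
  is_derive_poly K (fun y => trunc_exp K d (c * y + e))
    (c *: 'X^d * trunc_exp K d (c * x + e)) x.
Proof.
move=> d0 n nK; under eq_fun do rewrite coef_trunc_exp.
rewrite -scalerAl coefZ coefXnM.
case: K nK => // K nK; under eq_fun do rewrite big_ord_recl.
have h1 : is_derive x 1 (fun y => (c * y + e) ^+ (ord0 : 'I_K.+1) / (ord0 : 'I_K.+1)`!%:R *
   (n == d * (ord0 : 'I_K.+1))%N%:R) 0.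
  by under eq_fun do rewrite expr0; exact: isd_cst.
have h2 : is_derive x 1 (fun y => \sum_(i < K) (c * y + e) ^+ lift ord0 i / (lift ord0 i)`!%:R *
   (n == d * lift ord0 i)%N%:R)
  (\sum_(i < K) c * ((c * x + e) ^+ i / i`!%:R) * (n == d * i.+1)%N%:R).
  apply: isd_sum => i _; under eq_fun do rewrite /= /bump/= add1n.
  der; rewrite factS natrM; move: (natr_fact_neq0 (R := R) i) (natr_succ_neq0 (R := R) i).
  move: (i.+1%:R : R) (i`!%:R : R) => a b b0 a0.
  by field; rewrite a0 b0.
have h := isdD h1 h2; apply: isd_eq h _; rewrite add0r.
case: ltnP => [nd|dn].
  rewrite mulr0 big1// => i _; case: eqP => [E|_]; last by rewrite mulr0.
  by move: nd; rewrite E mulnS ltnNge leq_addr.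
(* The last term of the truncated exponential, multiplied by [X^d], has degree [d * K.+1], beyond n.
   It is the one term without a counterpart in the derivative. *)
have nK' : (n - d == d * K)%N = false.
  by apply/negP => /eqP E; have := leq_pmull K d0; lia.
rewrite coef_trunc_exp big_ord_recr/= nK' mulr0 addr0.
rewrite mulr_sumr; apply: eq_bigr => i _; rewrite -mulrA; congr (_ * (_ * _)).
by rewrite mulnS -{1}(subnKC dn) eqn_add2l.
Qed.

Lemma is_derive_genpoly k K (c e : 'I_k -> R) (x : R) :
  is_derive_poly K (fun y => genpoly K (fun j => c j * y + e j))
    ((\sum_(j < k) c j *: 'X^(j.+1)) * genpoly K (fun j => c j * x + e j)) x.
Proof.
rewrite /genpoly; elim: (index_enum _) => [|j s IH] /=.
  move=> n _; under eq_fun do rewrite big_nil.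
  by rewrite !big_nil mul0r coef0; exact: isd_cst.
have h := is_derive_polyM (@is_derive_trunc_exp K _ (c j) (e j) x (ltn0Sn j)) IH.
under eq_fun do rewrite big_cons.
by rewrite !big_cons; move: h; congr is_derive_poly; rewrite mulrDl; congr (_ + _); ring.
Qed.

(** Affine curves cover both uses: e = 0 gives the derivative in the intensity z, and c supported on
    one index gives the derivative in one parameter. *)
Lemma is_derive_count_prob k (c e : 'I_k -> R) (x : R) (n : int) :
  is_derive x 1 (fun y => count_prob (fun j => c j * y + e j) n)
   (\sum_(j < k) c j * (count_prob (fun i => c i * x + e i) (n - j.+1%:Z) -
      count_prob (fun i => c i * x + e i) n)).
Proof.
case: n => n; last first.
  rewrite big1 => [|j _]; first exact: isd_cst.
  by rewrite subr0 [X in count_prob _ X](_ : _ = Negz (n + j.+1)) ?mulr0// NegzE; lia.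
have hw : is_derive x 1 (fun y => count_weight n (fun j => c j * y + e j))
    ((\sum_(j < k) c j *: 'X^(j.+1)) * genpoly n.+1 (fun j => c j * x + e j))`_n.
  under eq_fun do rewrite -coef_genpoly.
  exact: is_derive_genpoly.
have he : is_derive x 1 (fun y => \sum_(j < k) (c j * y + e j)) (\sum_(j < k) c j).
  by apply: isd_sum => j _; der; rewrite mul0r add0r mulr1 addr0.
rewrite /=; der; rewrite mulrN; set E := expR _.
transitivity (\sum_(j < k) (c j * (count_prob (fun i => c i * x + e i) (n%:Z - j.+1%:Z))) -
  \sum_(j < k) c j * (count_weight n (fun i => c i * x + e i) * E)); last first.
  by rewrite -sumrB; apply: eq_bigr => j _; rewrite mulrBr.
rewrite -mulr_suml; congr (_ + _); last by ring.
rewrite mulr_suml coef_sum mulr_suml; apply: eq_bigr => j _.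
rewrite -scalerAl coefZ coefXnM -mulrA; congr (_ * _).
case: ltnP => [nj|jn].
  by rewrite mul0r [X in count_prob _ X](_ : _ = Negz (j - n))// NegzE; lia.
rewrite [X in count_prob _ X](_ : _ = Posz (n - j.+1)%N); last by rewrite -subzn.
rewrite /= -coef_genpoly -(@genpoly_stable _ _ n.+1)//.
by rewrite ltnS leq_subr.
Qed.

End counting_law.

(** * The law of the fractional field *)

Section independent_substitution.
Context d (T : measurableType d) {R : realType} (P : probability T R).
Variables (G : set (set T)) (X Y : {RV P >-> R}).
Hypotheses (sG : <<s G >> `<=` measurable)
  (indep : forall (A : set T) (B C : set R), <<s G >> A -> measurable B -> measurable C ->
     P (A `&` X @^-1` B `&` Y @^-1` C) = (P A * P (X @^-1` B) * P (Y @^-1` C))%E).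

Local Notation TG := (g_sigma_algebraType G).
Local Notation laws := ((distribution P X \x distribution P Y)%E : probability (R * R)%type R).

Local Notation to_TG := (fun w : T => w : TG).

Let mid : measurable_fun [set: T] to_TG.
Proof. by move=> _ A mA; rewrite setTI; exact: sG. Qed.

Let J : {RV P >-> TG} := rv_of P mid.

Let mXY : measurable_fun [set: T] (fun w => (X w, Y w)).
Proof. by apply: measurable_fun_pair; exact: measurable_funPT. Qed.

Let XY : {RV P >-> (R * R)%type} := rv_of P mXY.

Let mW : measurable_fun [set: T] (fun w => (to_TG w, (X w, Y w))).
Proof. exact: measurable_fun_pair mid mXY. Qed.

Let W : {RV P >-> (TG * (R * R))%type} :=
  rv_of P mW.

(** As functions of B, the law of (X, Y) restricted to A and [P A] times the product law are finite
    measures; independence makes them agree on products of measurable sets, which generate. *)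
Let joint_rect (A : set T) (B : set (R * R)) : <<s G >> A -> measurable B ->
  P (A `&` XY @^-1` B) = (P A * laws B)%E.
Proof.
move=> GA mB; have mA := sG GA.
have fA : P A \is a fin_num by exact: fin_num_measure.
have pA : 0 <= fine (P A) by rewrite fine_ge0.
pose m1 := pushforward (mrestr P mA) XY.
pose m2 := mscale (NngNum pA) laws.
have m1E C : m1 C = P (A `&` XY @^-1` C) by rewrite /m1 /pushforward /mrestr setIC.
have m2E C : m2 C = (P A * laws C)%E by rewrite /m2 /mscale/= fineK.
rewrite -m1E -m2E.
pose GG : set (set (R * R)) := [set A `*` B | A in measurable & B in measurable].
apply: (@measure_unique _ R (R * R)%type GG (fun=> setT)) => //.
- exact: measurable_prod_measurableType.
- move=> _ _ [A1 mA1 [B1 mB1 <-]] [A2 mA2 [B2 mB2 <-]].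
  rewrite -setXI; exists (A1 `&` A2); first exact: measurableI.
  by exists (B1 `&` B2) => //; exact: measurableI.
- by move=> _; exists setT => //; exists setT => //; rewrite setXTT.
- by rewrite bigcup_const.
- move=> _ [B1 mB1 [B2 mB2 <-]].
  transitivity (P (A `&` XY @^-1` (B1 `*` B2))); first exact: m1E.
  transitivity (P A * laws (B1 `*` B2))%E; last by rewrite -m2E.
  rewrite [laws _]product_measure1E//= muleA; apply: etrans (indep GA mB1 mB2); congr (P _).
  by apply/seteqP; split => w /=; tauto.
- move=> _; change (m1 setT < +oo)%E; rewrite m1E preimage_setT setIT.
  by apply: le_lt_trans (probability_le1 _ _) _ => //; exact: ltry.
Qed.

Lemma measurable_substitution (S : set (TG * (R * R))) : measurable S ->
  measurable [set w | S (to_TG w, (X w, Y w))].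
Proof. by move=> mS; rewrite -[X in measurable X]setTI; exact: mW. Qed.

(** The identity, seen as a random element of the sample space with the sigma-algebra generated by
    G, is independent of (X, Y). The joint law is therefore a product, and integrating the sections
    of S freezes the random point. *)
Lemma independent_substitution (S : set (TG * (R * R))) : measurable S ->
  P [set w | S (to_TG w, (X w, Y w))] = (\int[laws]_z P [set w | S (to_TG w, z)])%E.
Proof.
move=> mS; have -> : P [set w | S (to_TG w, (X w, Y w))] = distribution P W S by [].
have -> : distribution P W S = (distribution P J \x laws)%E S.
  have rect (A : set TG) (B : set (R * R)) : measurable A -> measurable B ->
      distribution P W (A `*` B) = (distribution P J A * laws B)%E.
    by move=> mA mB; rewrite -[RHS](joint_rect mA mB); congr (P _).
  have U := @product_measure_unique _ _ _ _ R (distribution P J) laws (distribution P W) rect S mS.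
  by rewrite -U.
have IS : (\int[distribution P J \x laws]_z (\1_S z)%:E = (distribution P J \x laws) S)%E.
  by rewrite (integral_indic _ measurableT mS) setIT.
rewrite -IS.
rewrite (@fubini_tonelli2 _ _ _ _ _ (distribution P J) laws (fun z => (\1_S z)%:E)); last 2 first.
- by apply: measurable_EFin; exact: measurable_indic.
- by move=> z; rewrite lee_fin.
apply: eq_integral => z _; rewrite /fubini_G.
transitivity (distribution P J (ysection S z)); last first.
  by congr (P _); apply/seteqP; split => w; rewrite /ysection/= inE.
have mSz : measurable (ysection S z) by exact: measurable_ysection.
have Iz : (\int[distribution P J]_w (\1_(ysection S z) w)%:E = distribution P J (ysection S z))%E.
  by rewrite (integral_indic _ measurableT mSz) setIT.
rewrite -Iz.
apply: eq_integral => w _; congr EFin; rewrite !indicE.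
by congr (nat_of_bool _)%:R; apply/idP/idP; rewrite /ysection !inE /= inE.
Qed.

End independent_substitution.

Section fractional_field_law.
Context d (T : measurableType d) {R : realType} (P : probability T R).

Let measurable_natr (f : T -> nat) : measurable_fun [set: T] f ->
  measurable_fun [set: T] (fun w => (f w)%:R : R).
Proof.
by move=> mf; apply: (measurableT_comp (f := fun n : nat => n%:R : R)) mf.
Qed.

Lemma gprf_point_law k (lam : 'I_k -> R) (M : R -> R -> {RV P >-> nat}) (x y : R) (n : nat) :
  gprf lam M -> 0 <= x -> 0 <= y ->
  P [set w | M x y w = n] = (count_prob (fun j => lam j * (x * y)) n)%:E.
Proof.
move=> gM x0 y0.
have mM s t : measurable_fun [set: T] (fun w => (M s t w)%:R : R).
  by apply: measurable_natr; exact: measurable_funPT.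
have -> : P [set w | M x y w = n] = P [set w | rect_increment M 0 0 x y w = n%:R].
  apply: ae_eq_measure.
  - rewrite -[X in measurable X]setTI.
    exact: (measurable_funPT (M x y) measurableT [set n] I).
  - rewrite (_ : [set w | _] = (fun w => rect_increment M 0 0 x y w) @^-1` [set n%:R])//.
    rewrite -[X in measurable X]setTI.
    have mr : measurable_fun [set: T] (rect_increment M 0 0 x y).
      by apply: measurable_funD => //; apply: measurable_funB => //; exact: measurable_funB.
    exact: mr.
  - apply: filterS3 (gprf_left gM y0) (gprf_bottom gM x0) (gprf_left gM (lexx 0)) => w h1 h2 h3.
    rewrite /= /rect_increment h1 h2 h3 !subr0 addr0; split => [->//|].
    by move=> E; apply/eqP; rewrite -(eqr_nat R); exact/eqP.
have xx : (0 : R) <= 0 <= x by rewrite lexx.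
have yy : (0 : R) <= 0 <= y by rewrite lexx.
rewrite (gprf_law gM n xx yy) -count_probE; congr EFin; apply: eq_bigr => m _.
by apply: eq_bigr => j _; rewrite !subr0 mulrA.
Qed.

Variables (a b : R) (k : nat) (lam : 'I_k -> R) (Z : R -> R -> {RV P >-> nat}).
Hypotheses (a01 : 0 < a <= 1) (b01 : 0 < b <= 1) (lam0 : forall j, 0 < lam j)
  (fZ : fgprf a b lam Z).
Variables (m n : probability R R).
Hypotheses (mm : ml_law a 1 m) (mn : ml_law b 1 n).

Let F (l : nat) (z : R) : R := count_prob (fun j => lam j * z) l.

Let F0 l z : 0 <= z -> 0 <= F l z.
Proof. by move=> z0; apply: count_prob_ge0 => j; rewrite mulr_ge0// ltW. Qed.

Let mF l : measurable_fun [set: R] (F l).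
Proof. exact: measurable_expoly (expoly_count_prob lam l). Qed.

Lemma fgprf_law (l : nat) (s t : R) : 0 <= s -> 0 <= t ->
  P [set w | Z s t w = l] =
  (\int[(m \x n)%E]_z (count_prob (fun j => lam j * (s `^ a * t `^ b * abs_prod z)) l)%:E)%E.
Proof.
move=> s0 t0; case: fZ => M [L1 [L2 [gM iL1 iL2 ind ZM]]].
have [L10 ML1] := inverse_stable_law a01 iL1 s0.
have [L20 ML2] := inverse_stable_law b01 iL2 t0.
have law1 : ml_law a (s `^ a) (distribution P (L1 s)).
  by split => // q; rewrite ML1 -mulrA.
have law2 : ml_law b (t `^ b) (distribution P (L2 t)).
  by split => // q; rewrite ML2 -mulrA.
pose TG := g_sigma_algebraType (field_class M).
have sG : <<s field_class M >> `<=` @measurable d T.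
  apply: smallest_sub; first exact: sigma_algebra_measurable.
  move=> _ [i [B [_ mB ->]]]; rewrite -[X in measurable X]setTI.
  exact: (measurable_funPT (M i.1 i.2) measurableT B mB).
have indep (A : set T) (B C : set R) : <<s field_class M >> A -> measurable B -> measurable C ->
    P (A `&` L1 s @^-1` B `&` L2 t @^-1` C) = (P A * P (L1 s @^-1` B) * P (L2 t @^-1` C))%E.
  move=> mA mB mC; apply: ind => //; apply: sub_gen_smallest.
    by exists s, B.
  by exists t, C.
have mquad : measurable (@quadrant R).
  rewrite (_ : @quadrant R = `[0%R, +oo[%classic `*` `[0%R, +oo[%classic).
    exact: measurableX.
  by apply/seteqP; split => z; rewrite /quadrant/= !in_itv/= !andbT.
have mD : measurable [set x : TG * (R * R) | quadrant x.2].
  rewrite (_ : [set x | _] = setT `*` @quadrant R); first exact: measurableX.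
  by apply/seteqP; split => z //= [].
(* The quadrant is part of S because joint measurability of the field holds only there; the time
   changes lie in it almost surely. *)
pose S : set (TG * (R * R)) := [set x | quadrant x.2] `&`
  (fun x => M x.2.1 x.2.2 x.1) @^-1` [set l].
have mS : measurable S by exact: (gprf_measurable gM mD).
have mL i : measurable_fun [set: T] (L1 i) /\ measurable_fun [set: T] (L2 i).
  by split; exact: measurable_funPT.
have aeL (L : {RV P >-> R}) : distribution P L `]-oo, 0%R[%classic = 0%E ->
    {ae P, forall w, 0 <= L w}.
  move=> L0; exists (L @^-1` `]-oo, 0%R[); split => //.
    by rewrite -[X in measurable X]setTI; apply: (measurable_funPT L).
  by move=> w /= h; rewrite in_itv/= ltNge; apply/negP.
transitivity (P [set w | S ((w : TG), (L1 s w, L2 t w))]).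
  apply: ae_eq_measure.
  - rewrite -[X in measurable X]setTI.
    exact: (measurable_funPT (Z s t) measurableT [set l] I).
  - exact: (@measurable_substitution _ _ _ P _ (L1 s) (L2 t) sG S mS).
  apply: filterS2 (aeL _ L10) (aeL _ L20) => w h1 h2.
  by rewrite /S/= ZM//; split=> [//|[]].
rewrite (independent_substitution sG indep mS).
(* Outside the quadrant the section of S is empty, whence the value 0. *)
pose g (z : R * R) : \bar R :=
  (if (0 <= z.1) && (0 <= z.2) then F l (z.1 * z.2) else 0)%:E.
have mg : measurable_fun setT g.
  apply: measurable_EFin; apply: measurable_fun_ifT => //.
    by apply: measurable_and; apply: measurable_fun_ler.
  by apply: (measurableT_comp (mF l)); apply: measurable_funM.
have g0 z : (0 <= g z)%E.
  by rewrite /g; case: ifP => // /andP[z1 z2]; rewrite lee_fin F0// mulr_ge0.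
transitivity (\int[(distribution P (L1 s) \x distribution P (L2 t))%E]_z g z)%E.
  apply: eq_integral => z _; rewrite /g; case: ifPn => [/andP[z1 z2]|nz].
    rewrite -(gprf_point_law l gM z1 z2); congr (P _).
    by apply/seteqP; split => w /=; [by case|by move=> E; split].
  rewrite (_ : [set w | S (w, z)] = set0) ?measure0//.
  by apply/seteqP; split => // w [[z1 z2] _]; move: nz; rewrite z1 z2.
rewrite (@fubini_tonelli1 _ _ _ _ _ (distribution P (L1 s)) (distribution P (L2 t)) g mg g0).
have mG1 := @measurable_fun_fubini_tonelli_F _ _ _ _ _ (distribution P (L2 t)) g mg g0.
have G10 x : (0 <= fubini_F (distribution P (L2 t)) g x)%E by apply: integral_ge0.
rewrite (ml_law_scale a01 (powR_ge0 s a) law1 mm mG1 G10).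
pose h (z : R * R) : \bar R :=
  (count_prob (fun j => lam j * (s `^ a * t `^ b * abs_prod z)) l)%:E.
have mh : measurable_fun setT h.
  apply: measurable_EFin; apply: (measurableT_comp (mF l)).
  by apply: measurable_funM => //; exact: measurable_abs_prod.
have h0 z : (0 <= h z)%E.
  by rewrite lee_fin F0// !mulr_ge0 ?powR_ge0.
rewrite (@fubini_tonelli1 _ _ _ _ _ m n h mh h0).
apply: eq_integral => x _; rewrite /fubini_F.
have mgx : measurable_fun setT (fun y => g (s `^ a * `|x|, y)).
  by apply: (measurableT_comp mg); exact: pair1_measurable.
rewrite (ml_law_scale b01 (powR_ge0 t b) law2 mn mgx (fun y => g0 (_, y))).
apply: eq_integral => y _; rewrite /g /h /= !mulr_ge0 ?powR_ge0//=.
have -> : s `^ a * `|x| * (t `^ b * `|y|) = s `^ a * t `^ b * abs_prod (x, y).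
  by rewrite /abs_prod/=; ring.
by [].
Qed.

End fractional_field_law.

Section expectation_operator.
Context {R : realType} d (S : measurableType d) (m : probability S R) (X : S -> R).
Hypotheses (mX : measurable_fun [set: S] X) (X0 : forall w, 0 <= X w).
Variables (L c : R).
Hypotheses (L0 : 0 < L) (c0 : 0 <= c).

Definition expect (f : R -> R) : R := \int[m]_w f (c * X w).

Lemma integrable_expoly f : expoly L f -> m.-integrable setT (EFin \o (fun w => f (c * X w))).
Proof.
move=> Lf; have iW : m.-integrable setT (EFin \o (cst 1 : S -> R)).
  exact: finite_measure_integrable_cst.
have := integrable_weight_expoly mX X0 (fun w => ler01 : 0 <= cst 1 w) iW L0 Lf c0.
by under eq_fun do rewrite mul1r.
Qed.

Lemma expectD f g : expoly L f -> expoly L g ->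
  expect (fun z => f z + g z) = expect f + expect g.
Proof. by move=> Lf Lg; apply: RintegralD => //; exact: integrable_expoly. Qed.

Lemma expectZ r f : expoly L f -> expect (fun z => r * f z) = r * expect f.
Proof. by move=> Lf; apply: RintegralZl => //; exact: integrable_expoly. Qed.

Lemma expectB f g : expoly L f -> expoly L g ->
  expect (fun z => f z - g z) = expect f - expect g.
Proof. by move=> Lf Lg; apply: RintegralB => //; exact: integrable_expoly. Qed.

Lemma expect_sum (I : Type) (r : seq I) (P : pred I) (f : I -> R -> R) :
  (forall i, P i -> expoly L (f i)) ->
  expect (fun z => \sum_(i <- r | P i) f i z) = \sum_(i <- r | P i) expect (f i).
Proof.
move=> Lf; elim: r => [|i r IH].
  rewrite big_nil /expect; under eq_Rintegral do rewrite big_nil.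
  by rewrite Rintegral_cst// mul0r.
rewrite big_cons -IH; case: ifPn => Pi.
  rewrite -expectD; [|exact: Lf|exact: expoly_sum].
  by congr expect; apply/funext => z; rewrite big_cons Pi.
by congr expect; apply/funext => z; rewrite big_cons (negbTE Pi).
Qed.

End expectation_operator.

Section point_probabilities.
Context d (T : measurableType d) {R : realType} (P : probability T R).
Variables (a b : R) (k : nat) (lam : 'I_k -> R) (Z : R -> R -> {RV P >-> nat}).
Hypotheses (a01 : 0 < a <= 1) (b01 : 0 < b <= 1) (lam0 : forall j, 0 < lam j)
  (fZ : fgprf a b lam Z).
Variables (m n : probability R R).
Hypotheses (mm : ml_law a 1 m) (mn : ml_law b 1 n).

Lemma point_probE (l : int) (s t : R) : 0 <= s -> 0 <= t ->
  point_prob Z l s t = expect (m \x n)%E abs_prod (s `^ a * t `^ b)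
    (fun z => count_prob (fun j => lam j * z) l).
Proof.
move=> s0 t0; case: l => l; last first.
  rewrite /expect Rintegral_cst// mul0r /point_prob.
  by rewrite (_ : [set w | _] = set0) ?measure0//; apply/seteqP; split.
rewrite /point_prob /expect /Rintegral -(fgprf_law a01 b01 lam0 fZ mm mn l s0 t0).
by congr (fine (P _)); apply/seteqP; split => w /= => [[]|->].
Qed.

Let mm1 : abs_ml_moments a m. Proof. by move=> q; rewrite (ml_law_normX q mm) expr1n mul1r. Qed.
Let mn1 : abs_ml_moments b n. Proof. by move=> q; rewrite (ml_law_normX q mn) expr1n mul1r. Qed.

Lemma expect_wright N (c L : R) : 0 < L -> 0 <= c ->
  wright_cvg (wright_top R N) (wright_bottom a b N) (- (L * c)) ->
  expect (m \x n)%E abs_prod c (fun z => z ^+ N * expR (- (L * z))) =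
  c ^+ N * wright (wright_top R N) (wright_bottom a b N) (- (L * c)).
Proof.
move=> L0 c0 cv; have Lc0 : 0 <= L * c by rewrite mulr_ge0// ltW.
have XM := @integral_abs_prodX R a b m n b01 mm1 mn1.
(* The Wright argument [-(L * c)] is nonpositive, so the Wright terms are the moment terms up to
   sign and tend to 0 by convergence. *)
have t0 : (L * c) ^+ r * (ml_moment a (N + r) * ml_moment b (N + r)) / r`!%:R @[r --> \oo] --> (0 : R).
  apply/norm_cvg0P; have h := (norm_cvg0P _).2 (cvg_series_cvg_0 cv).
  rewrite (_ : (fun r => _) = fun r =>
    `|wright_term (wright_top R N) (wright_bottom a b N) (- (L * c)) r|); first exact: h.
  by apply/funext => r; rewrite wright_termE !normrM !normfV !normrX normrN !normrM.
have h := @cvg_moment_series _ _ R (m \x n)%E setT abs_prod _ N (L * c) measurableT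
  measurable_abs_prod (fun z _ => abs_prod_ge0 z) XM Lc0 t0.
have -> : wright (wright_top R N) (wright_bottom a b N) (- (L * c)) =
    \int[(m \x n)%E]_z (abs_prod z ^+ N * expR (- (L * c * abs_prod z))).
  rewrite /wright; apply/cvg_lim => //; move: h; apply: cvg_trans; apply: near_eq_cvg.
  by apply: nearW => r; rewrite /series/=; apply: eq_bigr => i _; rewrite wright_termE.
have XM1 q : (\int[(m \x n)%E]_z (cst 1 z * abs_prod z ^+ q)%:E =
    (ml_moment a q * ml_moment b q)%:E)%E.
  by rewrite -XM; apply: eq_integral => z _; rewrite mul1r.
have int := @integrable_moment_exp _ _ R (m \x n)%E setT (cst 1) abs_prod _ measurableT
  (measurable_cst _) measurable_abs_prod (fun z _ => ler01) (fun z _ => abs_prod_ge0 z) XM1 N _ Lc0.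
rewrite /expect -RintegralZl//.
  by apply: eq_Rintegral => z _; rewrite exprMn !mulrA.
by apply: eq_integrable int => // z _; rewrite /= mul1r.
Qed.

Lemma point_prob_wright (l : nat) (s t : R) : (0 < k)%N -> 0 <= s -> 0 <= t ->
  (forall mu : {ffun 'I_k -> 'I_l.+1}, Theta mu ->
     let N := (\sum_(j < k) mu j)%N in
     wright_cvg (wright_top R N) (wright_bottom a b N)
       (- \sum_(j < k) lam j * s `^ a * t `^ b)) ->
  point_prob Z l s t = \sum_(mu : {ffun 'I_k -> 'I_l.+1} | Theta mu)
    let N := (\sum_(j < k) mu j)%N in
    (\prod_(j < k) ((lam j * s `^ a * t `^ b) ^+ mu j / (mu j)`!%:R)) *
    wright (wright_top R N) (wright_bottom a b N) (- \sum_(j < k) lam j * s `^ a * t `^ b).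
Proof.
move=> k0 s0 t0 cv; rewrite point_probE//.
pose L := \sum_(j < k) lam j.
have L0 : 0 < L.
  by rewrite /L (bigD1 (Ordinal k0))//= ltr_wpDr// sumr_ge0// => j _; exact: ltW.
set c := s `^ a * t `^ b; have c0 : 0 <= c by rewrite mulr_ge0 ?powR_ge0.
have Lc : \sum_(j < k) lam j * s `^ a * t `^ b = L * c.
  by rewrite mulr_suml; apply: eq_bigr => j _; rewrite mulrA.
rewrite Lc in cv *.
pose e N z := z ^+ N * expR (- (L * z)).
have Le N : expoly L (e N).
  by have := expoly_cons 1 N (expoly0 L); congr expoly; apply/funext => z; rewrite mul1r addr0.
rewrite (funext (count_prob_scale lam l)).
have mX := @measurable_abs_prod R; have X0 := @abs_prod_ge0 R.
rewrite (expect_sum (m \x n)%E mX X0 L0 c0); last by move=> mu _; apply: expolyZ; exact: Le.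
apply: eq_bigr => mu Tmu; rewrite (expectZ (m \x n)%E mX X0 L0 c0 _ (Le _)) expect_wright//; last exact: cv.
rewrite mulrA; congr (_ * _).
rewrite expr_sum -big_split/=; apply: eq_bigr => j _.
have -> : lam j * s `^ a * t `^ b = lam j * c by rewrite mulrA.
by clearbody c; rewrite exprMn mulrAC.
Qed.

End point_probabilities.

(** * The governing system *)

Lemma shift_index (l : int) (r j : nat) : (r < j.+2)%N ->
  l - (j.+1 - r)%N%:Z - 1 = l - (j.+2 - r)%N%:Z.
Proof. by move=> rj; lia. Qed.

Section governing_system.
Context {R : realType}.
Variables (a b : R) (k : nat) (m n : probability R R).
Hypotheses (a01 : 0 < a <= 1) (b01 : 0 < b <= 1) (hk : (0 < k)%N).
Hypotheses (mm : ml_law a 1 m) (mn : ml_law b 1 n).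
Local Notation pi := ((m \x n)%E : probability (R * R)%type R).
Local Notation X := abs_prod.
Local Notation i0 := (Ordinal hk).
Variable p : ('I_k -> R) -> int -> R -> R -> R.
Hypothesis pE : forall lam : 'I_k -> R, (forall j, 0 < lam j) ->
  forall (l : int) (s t : R), 0 <= s -> 0 <= t ->
  p lam l s t = expect pi X (s `^ a * t `^ b) (fun z => count_prob (fun j => lam j * z) l).
Variable lam : 'I_k -> R.
Hypothesis lam0 : forall j, 0 < lam j.

Let a0 : 0 < a. Proof. by case/andP: a01. Qed.
Let b0 : 0 < b. Proof. by case/andP: b01. Qed.
Let mm1 : abs_ml_moments a m. Proof. by move=> q; rewrite (ml_law_normX q mm) expr1n mul1r. Qed.
Let mn1 : abs_ml_moments b n. Proof. by move=> q; rewrite (ml_law_normX q mn) expr1n mul1r. Qed.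

Let L := \sum_(j < k) lam j.
Let L0 : 0 < L.
Proof. by rewrite /L (bigD1 i0)//= ltr_wpDr// sumr_ge0// => j _; exact: ltW. Qed.

Let f (l : int) (z : R) : R := count_prob (fun j => lam j * z) l.
Let shift_diff (g : int -> R -> R) (l : int) (z : R) : R :=
  \sum_(j < k) lam j * (g (l - j.+1%:Z) z - g l z).
Let f1 := shift_diff f.
Let f2 := shift_diff f1.

Let Lf l : expoly L (f l). Proof. exact: expoly_count_prob. Qed.

Let expolyB g h : expoly L g -> expoly L h -> expoly L (fun z => g z - h z).
Proof.
move=> Lg Lh; have := expolyD Lg (expolyZ (-1) Lh).
by congr expoly; apply/funext => z; rewrite mulN1r.
Qed.

Let Lshift g l : (forall l, expoly L (g l)) -> expoly L (shift_diff g l).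
Proof. by move=> Lg; apply: expoly_sum => j _; apply: expolyZ; exact: expolyB. Qed.

Let Lf1 l : expoly L (f1 l). Proof. exact: Lshift. Qed.
Let Lf2 l : expoly L (f2 l). Proof. exact: Lshift. Qed.

Let df l (z : R) : is_derive z 1 (f l) (f1 l z).
Proof.
have := is_derive_count_prob lam (fun=> 0) z l.
have E y : (fun j => lam j * y + 0) = (fun j => lam j * y) by apply/funext => j; rewrite addr0.
by under eq_fun do rewrite E; rewrite E.
Qed.

Let df1 l (z : R) : is_derive z 1 (f1 l) (f2 l z).
Proof.
apply: isd_sum => j _.
have h := isdD (df (l - j.+1%:Z) z) (isdN (df l z)).
by apply: isd_eq (isdM (isd_cst (lam j) z) h) _; rewrite mul0r add0r.
Qed.

Let mX := @measurable_abs_prod R.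
Let X0 := @abs_prod_ge0 R.
Let iX : pi.-integrable setT (EFin \o (@abs_prod R)).
Proof. exact: (integrable_abs_prod b01 mm1 mn1). Qed.
Let i2 : pi.-integrable setT (EFin \o (fun z : R * R => `|z.2|)).
Proof. exact: (integrable_abs_snd b01 mm1 mn1). Qed.
Let i1 : pi.-integrable setT (EFin \o (cst 1 : R * R -> R)).
Proof. by apply: (@prob_bounded_integrable _ _ _ pi setT (cst 1) 1) => // z _; rewrite normr1. Qed.
Let abs2_ge0 (z : R * R) : 0 <= `|z.2|. Proof. by []. Qed.
Let one_ge0 (z : R * R) : 0 <= (cst 1 z : R). Proof. exact: ler01. Qed.

Let is_derive_mulr (c z : R) : is_derive z 1 (fun z : R => z * c) c.
Proof. by apply: isd_eq (isdM (isd_id z) (isd_cst c z)) _; rewrite mul1r mulr0 addr0. Qed.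

(** The derivative in the scale [s ^ a] produces the weight [|z.1| |z.2|]; the transfer removes
    [|z.1|], and [|z.2|] stays for the derivative in t. *)
Lemma caputo_first (l : int) (s t : R) : 0 < s -> 0 < t ->
  caputo_derivable a (fun x => p lam l x t) s /\
  caputo a (fun x => p lam l x t) s =
  \int[pi]_z (`|z.2| * (t `^ b * f1 l (t `^ b * (s `^ a * X z)))).
Proof.
move=> s0 t0; set h := t `^ b; have h0 : 0 < h by rewrite powR_gt0.
have Lh : 0 < L * h by rewrite mulr_gt0.
have Lphi : expoly (L * h) (fun z => h * f1 l (h * z)).
  by apply: expolyZ; exact: (expoly_scale h (Lf1 l)).
pose Phi z w := f l (z * (h * X w)).
have iPhi z : 0 < z -> pi.-integrable setT (EFin \o Phi z).
  move=> z0; have zh : 0 <= z * h by rewrite mulr_ge0 ?ltW.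
  have := integrable_expoly pi mX X0 L0 zh (Lf l).
  by under eq_fun do rewrite -mulrA.
have dPhi (z : R) w : 0 < z ->
    is_derive z 1 (Phi^~ w) (X w * (h * f1 l (h * (z * X w)))).
  move=> z0; apply: isd_eq (isd_comp (df l _) (is_derive_mulr (h * X w) z)) _.
  by rewrite (mulrCA z) mulrC; ring.
have gE x : 0 < x -> p lam l x t = \int[pi]_w Phi (x `^ a) w.
  move=> x0; rewrite (pE lam0 l (ltW x0) (ltW t0)); apply: eq_Rintegral => w _.
  by rewrite /Phi mulrA.
exact: (caputo_expectation a01 mX X0 X0 abs2_ge0 iX i2 (product_caputo_transfer_fst n a01 mm1)
  Lh Lphi iPhi dPhi gE s0).
Qed.

(** In the scale [z = t ^ b] the integrand is [|w.2|] times [z * f1 l (z * (h * X w))]; the product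
    rule gives the two terms of psi, and the transfer removes [|w.2|]. *)
Lemma caputo_second (l : int) (s t : R) : 0 < s -> 0 < t ->
  caputo_derivable b (fun y => caputo a (fun x => p lam l x y) s) t /\
  caputo b (fun y => caputo a (fun x => p lam l x y) s) t =
  expect pi X (s `^ a * t `^ b) (fun z => f1 l z + z * f2 l z).
Proof.
move=> s0 t0; set h := s `^ a; have h0 : 0 < h by rewrite powR_gt0.
have Lh : 0 < L * h by rewrite mulr_gt0.
pose psi z := f1 l z + z * f2 l z.
have Lpsi : expoly L psi by apply: expolyD => //; exact: expolyX.
have Lphi : expoly (L * h) (fun z => psi (h * z)) by exact: expoly_scale.
pose Phi z (w : R * R) := `|w.2| * (z * f1 l (z * (h * X w))).
have mf1 := measurable_expoly (Lf1 l).
have [C hC] := expoly_bounded L0 (Lf1 l).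
have iPhi z : 0 < z -> pi.-integrable setT (EFin \o Phi z).
  move=> z0; apply: (@integrable_le_Rfun _ _ _ pi setT _ (fun w => (z * C) * `|w.2|)) => //.
  - apply: measurable_funM; first exact: measurable_abs_snd.
    apply: measurable_funM => //; apply: (measurableT_comp mf1).
    by apply: measurable_funM => //; exact: measurable_funM.
  - move=> w _; rewrite normrM normr_id mulrC ler_wpM2r// normrM gtr0_norm//.
    rewrite ler_wpM2l ?(ltW z0)// hC// mulr_ge0 ?(ltW z0)// mulr_ge0 ?(ltW h0)//.
  - exact: integrableZ_Rfun.
have dPhi (z : R) w : 0 < z -> is_derive z 1 (Phi^~ w) (`|w.2| * psi (h * (z * X w))).
  move=> z0; have h1 := isd_comp (df1 l _) (is_derive_mulr (h * X w) z).
  have h2 := isdM (isd_cst `|w.2| z) (isdM (isd_id z) h1).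
  apply: isd_eq h2 _; rewrite /psi.
  have -> : h * (z * X w) = z * (h * X w) by ring.
  by ring.
have gE y : 0 < y -> caputo a (fun x => p lam l x y) s = \int[pi]_w Phi (y `^ b) w.
  move=> y0; rewrite (caputo_first l s0 y0).2; apply: eq_Rintegral => w _.
  by rewrite /Phi.
have [h1 h2] := caputo_expectation b01 mX X0 abs2_ge0 one_ge0 i2 i1
  (product_caputo_transfer_snd m b01 mn1) Lh Lphi iPhi dPhi gE t0.
split; first exact: h1.
rewrite h2 /expect; apply: eq_Rintegral => w _.
have -> : h * t `^ b * X w = h * (t `^ b * X w) by ring.
by rewrite mul1r.
Qed.

Let pos_set_param (x : R) : 0 < x -> forall j, 0 < set_param i0 lam x j.
Proof. by move=> x0 j; rewrite /set_param; case: ifP. Qed.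

Let is_derive_set_param (l : int) (x z : R) :
  is_derive x 1 (fun x => count_prob (fun j => set_param i0 lam x j * z) l)
    (z * (count_prob (fun j => set_param i0 lam x j * z) (l - 1) -
          count_prob (fun j => set_param i0 lam x j * z) l)).
Proof.
pose c (j : 'I_k) := if j == i0 then z else 0.
pose e (j : 'I_k) := if j == i0 then 0 else lam j * z.
have E y : (fun j => set_param i0 lam y j * z) = (fun j => c j * y + e j).
  apply/funext => j; rewrite /set_param /c /e; case: ifP => _.
    by rewrite addr0 mulrC.
  by rewrite mul0r add0r.
have h := is_derive_count_prob c e x l.
under eq_fun do rewrite E; apply: isd_eq h _; rewrite E.
rewrite (bigD1 i0)//= big1 ?addr0 => [|j ji]; first by rewrite /c eqxx.
by rewrite /c (negbTE ji) mul0r.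
Qed.

Lemma is_derive_lam (l : int) (s t : R) : 0 < s -> 0 < t ->
  is_derive (lam i0) 1 (fun x => p (set_param i0 lam x) l s t)
    (expect pi X (s `^ a * t `^ b) (fun z => z * f (l - 1) z - z * f l z)).
Proof.
move=> s0 t0; set c := s `^ a * t `^ b.
have c0 : 0 <= c by rewrite mulr_ge0 ?powR_ge0.
have cX0 w : 0 <= c * X w by rewrite mulr_ge0.
pose Psi x w := count_prob (fun j => set_param i0 lam x j * (c * X w)) l.
have x0 := lam0 i0; set x1 := lam i0 in x0 *.
have dPsi x w := is_derive_set_param l x (c * X w).
have xI : `](x1 / 2), (x1 + 1)[%classic x1.
  by rewrite /= in_itv/= ltrDl ltr01 andbT ltr_pdivrMr// ltr_pMr// ltr1n.
have Ipos x : `](x1 / 2), (x1 + 1)[%classic x -> 0 < x.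
  by rewrite /= in_itv/= => /andP[+ _]; apply: lt_trans; rewrite divr_gt0.
have iI x : `](x1 / 2), (x1 + 1)[%classic x -> pi.-integrable setT (EFin \o Psi x).
  move=> /Ipos xp; pose lx := set_param i0 lam x.
  have Lx : 0 < \sum_(j < k) lx j.
    rewrite (bigD1 i0)//= ltr_wpDr// ?pos_set_param//.
    by apply: sumr_ge0 => j _; rewrite ltW// pos_set_param.
  exact: (integrable_expoly pi mX X0 Lx c0 (expoly_count_prob lx l)).
have dI x w : `](x1 / 2), (x1 + 1)[%classic x -> setT w -> derivable (Psi^~ w) x 1.
  by move=> _ _; have [] := dPsi x w.
have p12 x w : partial1of2 Psi x w = c * X w *
    (count_prob (fun j => set_param i0 lam x j * (c * X w)) (l - 1) -
     count_prob (fun j => set_param i0 lam x j * (c * X w)) l).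
  by rewrite partial1of2E; have [_ ->] := dPsi x w.
have [C1 hC1] := @count_prob_bounded R k (l - 1).
have [C2 hC2] := @count_prob_bounded R k l.
pose B w := (`|C1| + `|C2|) * (c * X w).
have B0 w : 0 <= B w by rewrite mulr_ge0// addr_ge0.
have iB : pi.-integrable setT (EFin \o B).
  by apply: integrableZ_Rfun => //; exact: integrableZ_Rfun.
have bI x w : `](x1 / 2), (x1 + 1)[%classic x -> setT w -> `|partial1of2 Psi x w| <= B w.
  move=> /Ipos xp _; rewrite p12 normrM mulrC (ger0_norm (cX0 w)) /B ler_wpM2r//.
  have tp j : 0 <= set_param i0 lam x j * (c * X w).
    by rewrite mulr_ge0// ltW// pos_set_param.
  apply: le_trans (ler_normB _ _) _; apply: lerD; rewrite (ger0_norm (count_prob_ge0 _ tp)).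
    exact: le_trans (hC1 _ tp) (ler_norm _).
  exact: le_trans (hC2 _ tp) (ler_norm _).
have h1 := derivable_under_integral measurableT xI iI dI B0 iB bI.
have h2 := differentiation_under_integral measurableT xI iI dI B0 iB bI.
have hd : is_derive x1 1 (fun x => \int[pi]_w Psi x w)
    (expect pi X c (fun z => z * f (l - 1) z - z * f l z)).
  split => //; rewrite -derive1E h2; apply: eq_Rintegral => w _.
  rewrite p12 mulrBr /f.
  have -> : (fun j => set_param i0 lam x1 j * (c * X w)) = (fun j => lam j * (c * X w)).
    by apply/funext => j; rewrite /set_param; case: eqP => [->|].
  by [].
(* The representation [pE] holds at positive parameters only, which suffices because [lam i0] is
   positive. *)
apply: near_eq_is_derive hd.
near=> y; rewrite pE// ?ltW// => j; apply: pos_set_param.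
by near: y; exact: lt_nbhsr.
Unshelve. all: by end_near. Qed.

Section operators.
Variables (s t : R).
Hypotheses (s0 : 0 < s) (t0 : 0 < t).
Let c := s `^ a * t `^ b.
Let c0 : 0 <= c. Proof. by rewrite mulr_ge0 ?powR_ge0. Qed.
Let Ex g := expect pi X c g.
Let q := fun (lm : 'I_k -> R) (l : int) => p lm l s t.

Let ExD g h (Lg : expoly L g) (Lh : expoly L h) := expectD pi mX X0 L0 c0 Lg Lh.
Let ExB g h (Lg : expoly L g) (Lh : expoly L h) := expectB pi mX X0 L0 c0 Lg Lh.
Let ExZ r g (Lg : expoly L g) := expectZ pi mX X0 L0 c0 r Lg.

Let Ex_shift (g : int -> R -> R) l : (forall l, expoly L (g l)) ->
  Ex (shift_diff g l) = \sum_(j < k) lam j * (Ex (g (l - j.+1%:Z)) - Ex (g l)).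
Proof.
move=> Lg; rewrite /Ex /shift_diff (expect_sum pi mX X0 L0 c0); last first.
  by move=> j _; apply: expolyZ; exact: expolyB.
by apply: eq_bigr => j _; rewrite ExZ ?ExB//; exact: expolyB.
Qed.

Let zf (l : int) (z : R) := z * f l z.
Let Lzf l : expoly L (zf l). Proof. exact: expolyX. Qed.

Lemma partial_paramE (l : int) :
  partial_param i0 q lam l = Ex (zf (l - 1)) - Ex (zf l).
Proof.
rewrite /partial_param derive1E; have [_ ->] := is_derive_lam l s0 t0.
exact: (ExB (Lzf _) (Lzf _)).
Qed.

Let h (l : int) (z : R) := f l z + z * f1 l z.
Let Lh l : expoly L (h l). Proof. by apply: expolyD => //; exact: expolyX. Qed.

(** The parameter derivative is [-(I - B)] applied to [l -> E[z f_l]], and the sum of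
    [B^(j - r) (I - B)] over r from 1 to j telescopes to [I - B^j]. What remains is the shift
    formula for f', multiplied by z. *)
Lemma inner_operatorE (l : int) : inner_operator i0 q lam l = Ex (h l).
Proof.
rewrite /inner_operator /Ex /h ExD//; last exact: expolyX.
rewrite /q (pE lam0 l (ltW s0) (ltW t0)) -/c -/(Ex _); congr (_ + _).
have -> : (fun z => z * f1 l z) = shift_diff zf l.
  by apply/funext => z; rewrite /f1 /shift_diff mulr_sumr; apply: eq_bigr => j _; rewrite /zf; ring.
rewrite -/(Ex _) Ex_shift//; apply: eq_bigr => j _; congr (_ * _).
(* The index [j.+2 - r] is one more than the exponent of the shift, since [partial_paramE]
   contributes a further shift; [g 1] is the full shift by [j.+1] and [g j.+2] is unshifted. *)
pose g r := - Ex (zf (l - (j.+2 - r)%N%:Z)).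
have g1 : g 1%N = - Ex (zf (l - j.+1%:Z)) by rewrite /g subSS subn0.
have g2 : g j.+2 = - Ex (zf l) by rewrite /g subnn subr0.
transitivity (\sum_(1 <= r < j.+2) (g r.+1 - g r)).
  apply: eq_big_nat => r /andP[r1 rj]; rewrite /bshift partial_paramE /g opprK addrC subSS.
  by rewrite shift_index.
by rewrite telescope_sumr// g1 g2 opprK addrC.
Qed.

Lemma outer_operatorE (l : int) :
  outer_operator lam (inner_operator i0 q lam) l = Ex (fun z => f1 l z + z * f2 l z).
Proof.
have -> : (fun z => f1 l z + z * f2 l z) = shift_diff h l.
  apply/funext => z; rewrite /f2 /shift_diff mulr_sumr.
  rewrite [X in X + _](_ : _ = \sum_(j < k) lam j * (f (l - j.+1%:Z) z - f l z))// -big_split/=.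
  by apply: eq_bigr => j _; rewrite /h; ring.
rewrite Ex_shift// /outer_operator -sumrN; apply: eq_bigr => j _.
by rewrite /bshift !inner_operatorE -mulrN opprB.
Qed.

End operators.

Lemma governing_equation (l : nat) (s t : R) : 0 < s -> 0 < t ->
  [/\ forall y : R, 0 < y -> caputo_derivable a (fun x => p lam l x y) s,
      caputo_derivable b (fun y => caputo a (fun x => p lam l x y) s) t,
      derivable (fun x => p (set_param i0 lam x) l s t) (lam i0) 1 &
      caputo b (fun y => caputo a (fun x => p lam l x y) s) t =
      outer_operator lam (inner_operator i0 (fun lm r => p lm r s t) lam) l].
Proof.
move=> s0 t0; have [h1 h2] := caputo_second l s0 t0; split => //.
- by move=> y y0; exact: (caputo_first l s0 y0).1.
- by have [] := is_derive_lam l s0 t0.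
- by rewrite h2 outer_operatorE.
Qed.

End governing_system.

Section reference_laws.
Context d (T : measurableType d) {R : realType} (P : probability T R).

(** The time changes of any one field, taken at time 1, provide reference laws, which depend on the
    indices only through their moments and not on lam. *)
Lemma fgprf_ml_laws (a b : R) k (lam : 'I_k -> R) (Z : R -> R -> {RV P >-> nat}) :
  0 < a <= 1 -> 0 < b <= 1 -> fgprf a b lam Z ->
  exists m n : probability R R, ml_law a 1 m /\ ml_law b 1 n.
Proof.
move=> a01 b01 [M [L1 [L2 [_ iL1 iL2 _ _]]]].
have [L10 ML1] := inverse_stable_law a01 iL1 ler01.
have [L20 ML2] := inverse_stable_law b01 iL2 ler01.
exists (distribution P (L1 1)), (distribution P (L2 1)).
by split; split => // q; rewrite ?ML1 ?ML2 powR1 -mulrA.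
Qed.

Lemma point_prob_lt0 (Z : R -> R -> {RV P >-> nat}) (l : int) s t : l < 0 ->
  point_prob Z l s t = 0.
Proof.
by case: l => // l _; rewrite /point_prob (_ : [set w | _] = set0) ?measure0//; apply/seteqP; split.
Qed.

End reference_laws.

Lemma count_prob_origin {R : realType} k (lam : 'I_k -> R) : count_prob (fun j => lam j * 0) 0 = 1.
Proof.
change (count_weight 0 (fun j => lam j * 0) * expR (- \sum_(j < k) lam j * 0) = 1).
rewrite -coef_genpoly big1 => [|j _]; last by rewrite mulr0.
rewrite oppr0 expR0 mulr1 /genpoly big1 ?coef1// => j _.
by rewrite /trunc_exp big_ord1 expr0 muln0 expr0 divr1 scale1r.
Qed.

Theorem theorem4p1 (R : realType) (alpha beta : R) (k : nat)
  (halpha : 0 < alpha <= 1) (hbeta : 0 < beta <= 1) (hk : (0 < k)%N) :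
  (* the distribution, wherever the Wright series in the formula converge *)
  (forall (d : measure_display) (T : measurableType d) (P : probability T R)
     (lam : 'I_k -> R) (Z : R -> R -> {RV P >-> nat}),
     (forall j, 0 < lam j) -> fgprf alpha beta lam Z ->
     forall (n : nat) (s t : R), 0 <= s -> 0 <= t ->
     (forall m : {ffun 'I_k -> 'I_n.+1}, Theta m ->
        let N := (\sum_(j < k) m j)%N in
        wright_cvg (wright_top R N) (wright_bottom alpha beta N)
          (- \sum_(j < k) lam j * s `^ alpha * t `^ beta)) ->
     point_prob Z n s t =
     \sum_(m : {ffun 'I_k -> 'I_n.+1} | Theta m)
       let N := (\sum_(j < k) m j)%N in
       (\prod_(j < k) ((lam j * s `^ alpha * t `^ beta) ^+ m j / (m j)`!%:R)) *
       wright (wright_top R N) (wright_bottom alpha beta N)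
         (- \sum_(j < k) lam j * s `^ alpha * t `^ beta))
  /\
  (* convergence of these series *)
  (1 < alpha + beta -> forall (N : nat) (x : R),
     wright_cvg (wright_top R N) (wright_bottom alpha beta N) x)
  /\
  (* the governing system; Z lam is the field with parameters lam *)
  (forall (d : measure_display) (T : ('I_k -> R) -> measurableType d)
     (P : forall lam : 'I_k -> R, probability (T lam) R)
     (Z : forall lam : 'I_k -> R, R -> R -> {RV P lam >-> nat}),
     (forall lam : 'I_k -> R, (forall j, 0 < lam j) ->
        fgprf alpha beta lam (Z lam)) ->
     let p lam n s t := point_prob (Z lam) n s t in
     forall lam : 'I_k -> R, (forall j, 0 < lam j) ->
     (forall (n : nat) (s t : R), 0 < s -> 0 < t ->
        [/\ forall y : R, 0 < y -> caputo_derivable alpha (fun x => p lam n x y) s,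
            caputo_derivable beta
              (fun y => caputo alpha (fun x => p lam n x y) s) t,
            derivable (fun x => p (set_param (Ordinal hk) lam x) n s t)
              (lam (Ordinal hk)) 1 &
            caputo beta (fun y => caputo alpha (fun x => p lam n x y) s) t =
            outer_operator lam
              (inner_operator (Ordinal hk) (fun l m => p l m s t) lam) n])
     /\ p lam 0 0 0 = 1
     /\ (forall (n : int) (s t : R), n < 0 -> p lam n s t = 0)).
Proof.
split; [|split].
- move=> d T P lam Z lam0 fZ n s t s0 t0 cv.
  have [m1 [m2 [law1 law2]]] := fgprf_ml_laws halpha hbeta fZ.
  exact: (point_prob_wright halpha hbeta lam0 fZ law1 law2 hk s0 t0 cv).
- by move=> ab N x; exact: wright_cvg_gt1.
move=> d T P Z fZ p lam lam0.
have [m1 [m2 [law1 law2]]] := fgprf_ml_laws halpha hbeta (fZ lam lam0).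
(* The laws m1 and m2 come from the field with parameters lam but represent the fields with all
   positive parameters l, so the derivative in a parameter acts on the integrand alone. *)
have pE (l : 'I_k -> R) : (forall j, 0 < l j) -> forall (n : int) (s t : R), 0 <= s -> 0 <= t ->
    p l n s t = expect (m1 \x m2)%E abs_prod (s `^ alpha * t `^ beta)
      (fun z => count_prob (fun j => l j * z) n).
  by move=> l0 n s t; exact: (point_probE halpha hbeta l0 (fZ l l0) law1 law2).
split; [|split].
- by move=> n s t s0 t0; exact: (governing_equation halpha hbeta hk law1 law2 pE lam0).
- rewrite pE// !powR0 ?gt_eqF//; [|by case/andP: hbeta|by case/andP: halpha].
  rewrite /expect; under eq_Rintegral do rewrite !mul0r count_prob_origin.
  rewrite Rintegral_cst// mul1r.
  exact: (congr1 fine (probability_setT ((m1 \x m2)%E : probability (R * R)%type R))).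
- by move=> n s t n0; exact: point_prob_lt0.
Qed.
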